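(* The algebra $A_n=(\bigwedge M_n^*\otimes M_n)^G$ is a free left module over the subalgebra $AT_{n-1}$ (the exterior algebra generated by $T_0,\dots,T_{n-2}$), with basis $1,X,X^2,\dots,X^{2n-1}$. Moreover, the kernel of the canonical homomorphism $\mathcal{TA}_n\to A_n$ is the ideal generated by $X^{2n}$ and $O_n=nX^{2n-1}-\sum_{i=0}^{n-1}X^{2i}\wedge T_{n-i-1}$.
   Context: Let $F$ be a field of characteristic $0$, $n\ge1$, $M_n=M_n(F)$, $G=PGL_n(F)$ acting by conjugation. $\bigwedge M_n^*\otimes M_n$ is identified with the algebra of multilinear antisymmetric functions $M_n^k\to M_n$ ($k\ge0$) under the product $(f\wedge h)(v_1,\dots,v_{a+b})=\frac1{a!b!}\sum_{\sigma\in S_{a+b}}\epsilon_\sigma f(v_{\sigma(1)},\dots,v_{\sigma(a)})h(v_{\sigma(a+1)},\dots,v_{\sigma(a+b)})$; $G$ acts by automorphisms, and $A_n$ is the invariant subalgebra ($G$-equivariant such functions). $X\in A_n$ is the identity map $M_n\to M_n$, so $X^a=X^{\wedge a}$ equals the standard polynomial $S_a$. $T_h:=\mathrm{tr}(S_{2h+1}(x_1,\dots,x_{2h+1}))\in(\bigwedge^{2h+1}M_n^* )^G$ (viewed in $A_n$ as scalar-valued). $\mathcal{TA}_n$ is the formal graded algebra generated by $T_0,\dots,T_{n-1}$ ($\deg T_h=2h+1$) and $X$ ($\deg 1$), where the $T_h$ generate an exterior algebra, $X$ anticommutes with all $T_h$, and everything of degree $>n^2$ is zero; the canonical homomorphism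 $\mathcal{TA}_n\to A_n$ sends the formal $T_h$, $X$ to the functions of the same name. *)

(* Defs.v *)
From HB Require Import structures.
From mathcomp Require Import all_boot all_order all_algebra all_fingroup.
Unset Printing Implicit Defensive.
Import GRing.Theory.
Local Open Scope ring_scope.

Section Defs.
Variables (F : fieldType) (n : nat).

Definition forms (k : nat) := ('I_k -> 'M[F]_n) -> 'M[F]_n.

(* an element of the graded algebra: one component in each degree k *)
Definition E := forall k : nat, forms k.

Definition zeroE : E := fun k v => 0.

Definition upd {k} (v : 'I_k -> 'M[F]_n) (i : 'I_k) (y : 'M[F]_n) : 'I_k -> 'M[F]_n :=
  fun j => if j == i then y else v j.

Definition multilinear {k} (f : forms k) : Prop :=
  forall (v : 'I_k -> 'M[F]_n) (i : 'I_k) (a : F) (y z : 'M[F]_n),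
    f (upd v i (a *: y + z)) = a *: f (upd v i y) + f (upd v i z).

Definition antisymmetric {k} (f : forms k) : Prop :=
  forall (s : 'S_k) (v : 'I_k -> 'M[F]_n),
    f (fun i => v (s i)) = (-1) ^+ (odd_perm s) *: f v.

(* equivariance for PGL_n(F) acting by conjugation (= GL_n(F) acting by conjugation) *)
Definition equivariant {k} (f : forms k) : Prop :=
  forall (g : 'M[F]_n) (v : 'I_k -> 'M[F]_n), g \in unitmx ->
    f (fun i => g *m v i *m invmx g) = g *m f v *m invmx g.

Definition InA (x : E) : Prop :=
  forall k, [/\ multilinear (x k), antisymmetric (x k) & equivariant (x k)].

Definition wedgeab {a b} (f : forms a) (h : forms b) : forms (a + b) :=
  fun v => ((a`!)%:R^-1 * (b`!)%:R^-1) *: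
    \sum_(s : 'S_(a + b)) (-1) ^+ (odd_perm s) *:
       (f (fun i => v (s (lshift b i))) *m h (fun i => v (s (rshift a i)))).

Lemma le_ord {m : nat} (a : 'I_m.+1) : (a + (m - a))%N = m.
Proof. by rewrite subnKC // -ltnS. Qed.

Definition wedge (x y : E) : E :=
  fun m v => \sum_(a < m.+1)
     wedgeab (x a) (y (m - a)%N) (fun i => v (cast_ord (le_ord a) i)).

Definition oneE : E := fun k v => if k == 0%N then 1%:M else 0.

Definition Xe : E := fun k =>
  match k return forms k with
  | 1%N => fun v => v ord0
  | _ => fun _ => 0
  end.

Definition Xpow (i : nat) : E := iter i (wedge Xe) oneE.

Definition stdpoly {k} (v : 'I_k -> 'M[F]_n) : 'M[F]_n :=
  \sum_(s : 'S_k) (-1) ^+ (odd_perm s) *: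
     foldr (fun i acc => v (s i) *m acc) 1%:M (enum 'I_k).

Definition Te (h : nat) : E :=
  fun k v => if k == (2 * h + 1)%N then (\tr (stdpoly v))%:M else 0.

(* the subalgebra AT_{n-1} generated by T_0, ..., T_{n-2}:
   linear span of all finite products of these generators (empty product = 1) *)
Definition Tword (w : seq nat) : E := foldr (fun h acc => wedge (Te h) acc) oneE w.

Definition InAT (y : E) : Prop :=
  exists s : seq (F * seq nat),
    all (fun t => all (fun h => h < n.-1)%N t.2) s /\
    y = (fun k v => \sum_(t <- s) t.1 *: Tword t.2 k v).

Definition lincomb (c : 'I_(2 * n) -> E) : E :=
  fun k v => \sum_(i < 2 * n) wedge (c i) (Xpow i) k v.

(* Realised on its monomial basis T_S X^j  (S = {i_1 < ... < i_r} subset of {0..n-1},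
   T_S = T_{i_1} ... T_{i_r}); degrees > n^2 are zero, so j <= n^2. *)
Definition idxTA := ({set 'I_n} * 'I_(n ^ 2).+1)%type.
Definition TA := {ffun idxTA -> F}.

Definition degS (S : {set 'I_n}) : nat := (\sum_(h in S) (2 * h + 1))%N.
Definition degI (b : idxTA) : nat := (degS b.1 + b.2)%N.

(* number of pairs (s,u) in S x U with s > u : sign of reordering T_S T_U *)
Definition invSU (S U : {set 'I_n}) : nat :=
  #|[set p : 'I_n * 'I_n | [&& p.1 \in S, p.2 \in U & (p.2 < p.1)%N]]|.

(* (T_S X^i)(T_U X^j) = (-1)^(i|U|) T_S T_U X^(i+j) *)
Definition coefbp (a a' b : idxTA) : F :=
  if [&& [disjoint a.1 & a'.1], b.1 == a.1 :|: a'.1,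
         (b.2 : nat) == (a.2 + a'.2)%N & (degI b <= n ^ 2)%N]
  then (-1) ^+ (a.2 * #|a'.1| + invSU a.1 a'.1)%N else 0.

Definition mulTA (p q : TA) : TA :=
  [ffun b => \sum_(a : idxTA) \sum_(a' : idxTA) p a * q a' * coefbp a a' b].

Definition eTA (S : {set 'I_n}) (j : nat) : TA :=
  [ffun b : idxTA => ((b.1 == S) && ((b.2 : nat) == j) && (degS S + j <= n ^ 2)%N)%:R].

Definition oneTA : TA := eTA set0 0.
Definition XTA : TA := eTA set0 1.
Definition TTA (h : 'I_n) : TA := eTA [set h] 0.
Definition XpowTA (i : nat) : TA := iter i (mulTA XTA) oneTA.

Definition OTA : TA :=
  [ffun b => n%:R * XpowTA (2 * n - 1) b
             - \sum_(i < n) mulTA (XpowTA (2 * i)) (TTA (rev_ord i)) b].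

Definition TA_wf (p : TA) : Prop := forall b, (n ^ 2 < degI b)%N -> p b = 0.

Definition InIdeal (p : TA) : Prop :=
  exists s : seq (TA * bool * TA),
    p = [ffun b => \sum_(t <- s)
           mulTA (mulTA t.1.1 (if t.1.2 then XpowTA (2 * n) else OTA)) t.2 b].

Definition Tmono (S : {set 'I_n}) : E :=
  foldr (fun h acc => wedge (Te (val h)) acc) oneE (enum S).

Definition phiTA (p : TA) : E :=
  fun k v => \sum_(b : idxTA) p b *: wedge (Tmono b.1) (Xpow b.2) k v.

End Defs.

(* Main.v *)
Require Import Defs.
From HB Require Import structures.
From mathcomp Require Import all_boot all_order all_algebra all_fingroup.
From mathcomp Require Import zify.
From Stdlib Require Import FunctionalExtensionality.
Unset Printing Implicit Defensive.
Import GRing.Theory.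
Local Open Scope ring_scope.

(**
Let [Lam] be the exterior algebra on generators [xi (p, q)] dual to the matrix units.
Sending an antisymmetric [f] of degree [k] to
[1/k! * sum_i xi (i 1) ... xi (i k) *: f (e (i 1), ..., e (i k))] embeds the algebra of
antisymmetric functions into the matrices over [Lam]; it sends [X] to the generic
matrix [Xi = (xi (p, q))] and [T_h] to [\tr (Xi ^+ (2 * h + 1))].

The relations [Xi ^+ (2 * n) = 0] and [O_n = 0] are the two components of the
Cayley-Hamilton theorem for [Xi ^+ 2 + eps *: Xi], where [eps] is one more odd
generator: its entries commute, and products of two of its power sums vanish.

By the first fundamental theorem (double centralizer of the symmetric group acting
on tensors, with Maschke's averaging) every equivariant multilinear function is a
combination of products of traces of words times a word; after antisymmetrization
these become products of the [T_h] and of a power of [X], and [O_n] eliminates [T_{n-1}].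

The determinant of [n^2] matrices is an invariant of degree [n^2], and
[T_0 ... T_{n-2} X^{2n-1}] is the only monomial of that degree in the spanning set, so it
is nonzero.  Multiplying a linear relation by suitable monomials moves one of its
terms to this top monomial and kills the others, hence linear independence.
*)

(** Those of [Xi ^+ 2] commute, but since the traces of its powers vanish, its Cayley-Hamilton
    identity gives only [Xi ^+ (2 * n) = 0] and sees no [T_h]. Adding [eps *: Xi] is a first-order
    deformation that keeps the entries commuting: the j-th power sum becomes [j] times
    [eps * T_(j-1)], Newton's formulas collapse to their linear part, and dividing by [j] is one of
    the places where characteristic 0 enters.

    The top monomial has the right degree because the sum of [2h+1] over [h < n-1] is [(n-1)^2], and
    [(n-1)^2 + (2n-1) = n^2], the number of generators [xi (p, q)].

    For the kernel, the two relations rewrite every formal monomial, modulo the ideal, into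
    monomials [T_S X^j] with [n-1] outside [S] and [j < 2n]. Their images are linearly independent,
    so an element with zero image reduces to zero, that is, lies in the ideal. *)

Lemma mulr_signCA (R : pzRingType) (b : nat) (x y : R) : x * ((-1) ^+ b * y) = (-1) ^+ b * (x * y).
Proof. by rewrite mulrA (commr_sign x b) mulrA. Qed.

(** * Products of pairwise anticommuting elements *)

Section Anticommuting.
Variables (R : pzRingType) (I : eqType) (a : I -> R).
Hypothesis anti : forall i j, a i * a j = - (a j * a i).
Hypothesis sq0 : forall i, a i * a i = 0.

Lemma anti_prodC (i : I) (s : seq I) :
  a i * \prod_(j <- s) a j = (-1) ^+ size s * (\prod_(j <- s) a j * a i).
Proof.
elim: s => [|j s IH]; first by rewrite big_nil !mul1r mulr1.
rewrite big_cons mulrA anti mulNr -mulrA IH /= exprS -mulrA mulN1r; congr (- _).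
by rewrite !mulrA; congr (_ * _ * _); apply/commr_sign.
Qed.

Lemma anti_prod_dup (s : seq I) : ~~ uniq s -> \prod_(j <- s) a j = 0.
Proof.
elim: s => [//|i s IH] /=; rewrite negb_and negbK big_cons.
case/orP => [|/IH->]; last by rewrite mulr0.
case/splitPr => s1 s2; rewrite big_cat big_cons /= mulrA anti_prodC.
by rewrite -!mulrA (mulrA (a i)) sq0 mul0r !mulr0.
Qed.

End Anticommuting.

(* The sign depends on the two lists only, not on the anticommuting family. *)
Lemma anti_prod_perm (I : eqType) (s t : seq I) : perm_eq s t ->
  {b : nat | forall (R : pzRingType) (a : I -> R),
     (forall i j, a i * a j = - (a j * a i)) ->
     \prod_(j <- s) a j = (-1) ^+ b * \prod_(j <- t) a j}.
Proof.
elim: s t => [|i s IH] t pst.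
  exists 0%N => R a _; move: pst; rewrite perm_sym => /perm_nilP->.
  by rewrite mul1r.
have it : i \in t by rewrite -(perm_mem pst) mem_head.
move: pst; rewrite -[t](cat_take_drop (index i t)) (drop_nth i) ?index_mem // nth_index //.
move: (take _ _) (drop _ _) => t1 t2 pst.
have /IH[b eb] : perm_eq s (t1 ++ t2).
  by rewrite -(perm_cons i) (perm_trans pst) // perm_catC /= perm_cons perm_catC.
exists (b + size t1)%N => R a anti; rewrite big_cons (eb R a anti) !big_cat big_cons /=.
by rewrite mulr_signCA (mulrA (a i)) (anti_prodC _ _ _ anti) exprD -!mulrA.
Qed.

(** * The exterior algebra *)

Section Ext.
Variables (F : fieldType) (m : nat).
Definition ext := {ffun {set 'I_m} -> F}.
HB.instance Definition _ := GRing.Zmodule.copy ext {ffun {set 'I_m} -> F}.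

Implicit Types (x y z : ext) (A B C D : {set 'I_m}).

Definition extscale (c : F) x : ext := [ffun A => c * x A].

Lemma extscaleA c d x : extscale c (extscale d x) = extscale (c * d) x.
Proof. by apply/ffunP => A; rewrite !ffunE mulrA. Qed.
Lemma extscale1 : left_id 1 extscale.
Proof. by move=> x; apply/ffunP => A; rewrite !ffunE mul1r. Qed.
Lemma extscaleDr : right_distributive extscale +%R.
Proof. by move=> c x y; apply/ffunP => A; rewrite !ffunE mulrDr. Qed.
Lemma extscaleDl x : {morph extscale^~ x : c d / c + d}.
Proof. by move=> c d; apply/ffunP => A; rewrite !ffunE mulrDl. Qed.

HB.instance Definition _ := GRing.Zmodule_isLmodule.Build F ext
  extscaleA extscale1 extscaleDr extscaleDl.

(** The number of inversions in the increasing list of [A] followed by that of [B]; its parity is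
    the sign of the product of the two basis monomials. *)
Definition ninv A B : nat := (\sum_(a in A) \sum_(b in B) (b < a))%N.

Lemma inv0s B : ninv set0 B = 0%N. Proof. by rewrite /ninv big_set0. Qed.
Lemma invs0 A : ninv A set0 = 0%N.
Proof. by rewrite /ninv big1 // => a _; rewrite big_set0. Qed.

Lemma invUl A B C : [disjoint A & B] -> ninv (A :|: B) C = (ninv A C + ninv B C)%N.
Proof. by move=> d; rewrite /ninv -bigU //=; apply: eq_bigl => a; rewrite inE. Qed.

Lemma invUr A B C : [disjoint B & C] -> ninv A (B :|: C) = (ninv A B + ninv A C)%N.
Proof.
move=> d; rewrite /ninv -big_split /=; apply: eq_bigr => a _.
by rewrite -bigU //=; apply: eq_bigl => b; rewrite inE.
Qed.

Lemma invC A B : [disjoint A & B] -> (ninv A B + ninv B A = #|A| * #|B|)%N.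
Proof.
move=> d; rewrite /ninv [X in (_ + X)%N]exchange_big -big_split /=.
rewrite -sum_nat_const; apply: eq_bigr => a aA.
rewrite -big_split -sum1_card /=; apply: eq_bigr => b bB.
have : a != b by apply: contraTneq bB => <-; apply/negbT; apply: disjointFr d aA.
by rewrite -(inj_eq val_inj) /=; case: ltngtP.
Qed.

Definition extmul x y : ext :=
  [ffun C : {set 'I_m} => \sum_(A : {set 'I_m} | A \subset C) (-1) ^+ ninv A (C :\: A) * (x A * y (C :\: A))].
Definition ext1 : ext := [ffun A => (A == set0)%:R].

(** Both sides are sums over the ordered partitions of [D] into [A], [B] and the rest; in both, the
    sign counts the inversions between the three pairs of blocks, which is the summand [G]. *)
Lemma extmulA : associative extmul.
Proof.
move=> x y z; apply/ffunP => D; rewrite !ffunE.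
pose G A B := (-1) ^+ (ninv A B + ninv A (D :\: A :\: B) + ninv B (D :\: A :\: B))
              * (x A * y B * z (D :\: A :\: B)) : F.
transitivity (\sum_(A : {set 'I_m} | A \subset D) \sum_(B : {set 'I_m} | B \subset D :\: A) G A B).
  apply: eq_bigr => A sA; rewrite ffunE mulr_sumr mulr_sumr.
  apply: eq_bigr => B sB; rewrite /G.
  rewrite -{1}(setID (D :\: A) B) (setIidPr sB) invUr; last first.
    by rewrite -setI_eq0 setDE setICA setICr setI0.
  by rewrite -addnA exprD; rewrite addnA exprD [(-1) ^+ (ninv A B + _)]exprD -!mulrA;
    do 2!congr (_ * _); rewrite mulrCA.
transitivity (\sum_(C : {set 'I_m} | C \subset D) \sum_(A : {set 'I_m} | A \subset C) G A (C :\: A)); last first.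
  apply: eq_bigr => C sC; rewrite ffunE mulr_suml mulr_sumr.
  apply: eq_bigr => A sA; rewrite /G.
  have -> : D :\: A :\: (C :\: A) = D :\: C.
    by apply/setP => i; rewrite !inE; have := subsetP sA i; do 3!case: (i \in _) => //=;
      move/(_ isT).
  have -> : ninv C (D :\: C) = (ninv A (D :\: C) + ninv (C :\: A) (D :\: C))%N.
    rewrite -invUl; last by rewrite -setI_eq0 setDE setICA setICr setI0.
    by rewrite -{1}(setID C A) (setIidPr sA).
  by rewrite -addnA exprD -!mulrA mulrCA.
rewrite [RHS](exchange_big_dep (fun A : {set 'I_m} => A \subset D)) /=; last first.
  by move=> C A sC sA; apply: subset_trans sA sC.
apply: eq_bigr => A sA.
rewrite [RHS](reindex_onto (fun B => A :|: B) (fun C => C :\: A)) /=; last first.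
  by move=> C /andP[_ sAC]; rewrite -{2}(setID C A) (setIidPr sAC).
apply: eq_big => [B|B sB].
  rewrite subUset sA subsetUl andbT setDUl setDv set0U subsetD /=.
  by apply/andP/andP => -[-> h]; split=> //;
    [apply/eqP/setDidPl | apply/setDidPl/eqP].
congr (G _ _); rewrite setDUl setDv set0U.
by apply/esym/setDidPl; move: sB; rewrite subsetD => /andP[].
Qed.

Lemma extmul1l : left_id ext1 extmul.
Proof.
move=> x; apply/ffunP => C; rewrite ffunE (bigD1 set0) ?sub0set //= big1 => [|A].
  by rewrite inv0s ffunE eqxx setD0 !mul1r addr0.
by case/andP => _ /negPf n0; rewrite ffunE n0 mul0r mulr0.
Qed.

Lemma extmul1r : right_id ext1 extmul.
Proof.
move=> x; apply/ffunP => C; rewrite ffunE (bigD1 C) //= big1 => [|A].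
  by rewrite setDv invs0 ffunE eqxx mulr1 mul1r addr0.
case/andP => sA nA; rewrite ffunE setD_eq0 [C \subset A]negbTE ?mulr0 //.
by apply: contra nA => sC; rewrite eqEsubset sA.
Qed.

Lemma extmulDl : left_distributive extmul +%R.
Proof.
move=> x y z; apply/ffunP => C; rewrite !ffunE -big_split /=.
by apply: eq_bigr => A _; rewrite ffunE mulrDl mulrDr.
Qed.

Lemma extmulDr : right_distributive extmul +%R.
Proof.
move=> x y z; apply/ffunP => C; rewrite !ffunE -big_split /=.
by apply: eq_bigr => A _; rewrite ffunE !mulrDr.
Qed.

Lemma ext1_neq0 : ext1 != 0.
Proof. by apply/eqP => /ffunP/(_ set0)/eqP; rewrite !ffunE eqxx oner_eq0. Qed.

HB.instance Definition _ := GRing.Zmodule_isNzRing.Build ext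
  extmulA extmul1l extmul1r extmulDl extmulDr ext1_neq0.

Lemma extmulE x y C :
  (x * y) C = \sum_(A : {set 'I_m} | A \subset C) (-1) ^+ ninv A (C :\: A) * (x A * y (C :\: A)).
Proof. by rewrite ffunE. Qed.

Lemma extZl (c : F) x y : c *: (x * y) = c *: x * y.
Proof.
apply/ffunP => C; rewrite ffunE !extmulE mulr_sumr; apply: eq_bigr => A _.
by rewrite ffunE -!mulrA; rewrite [LHS]mulrCA.
Qed.

Lemma extZr (c : F) x y : c *: (x * y) = x * (c *: y).
Proof.
apply/ffunP => C; rewrite ffunE !extmulE mulr_sumr; apply: eq_bigr => A _.
by rewrite [(c *: y) _]ffunE [LHS]mulrCA; congr (_ * _); rewrite mulrCA.
Qed.

HB.instance Definition _ := GRing.Lmodule_isLalgebra.Build F ext extZl.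
HB.instance Definition _ := GRing.Lalgebra_isAlgebra.Build F ext extZr.

(** Swapping two disjoint blocks changes the sign by [#|A| * #|B|], by [invC]. The condition on
    supports covers both homogeneous factors and, with [b = 0], factors that are merely even. *)
Lemma ext_signcomm (b : nat) x y :
    (forall A B, [disjoint A & B] -> x A != 0 -> y B != 0 -> odd (#|A| * #|B|) = odd b) ->
  x * y = (-1) ^+ b * (y * x).
Proof.
move=> h; rewrite -signr_odd mulr_sign; apply/ffunP => C; rewrite !extmulE.
transitivity ((-1) ^+ odd b * (y * x) C); last by case: odd; rewrite ?mulN1r ?ffunE ?mul1r.
rewrite extmulE (reindex_onto (fun A => C :\: A) (fun A => C :\: A)) /=; last first.
  by move=> A sA; rewrite setDDr setDv set0U (setIidPr sA).
rewrite mulr_sumr; apply: eq_big => [A|A /andP[_ /eqP eA]].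
  rewrite subsetDl /=; apply/eqP/idP => [<-|sA]; first exact: subsetDl.
  by rewrite setDDr setDv set0U (setIidPr sA).
rewrite eA mulrA [y A * _]mulrC.
have [->|x0] := eqVneq (x (C :\: A)) 0; first by rewrite !mul0r !mulr0.
have [->|y0] := eqVneq (y A) 0; first by rewrite !mulr0.
have d : [disjoint C :\: A & A] by rewrite -setI_eq0 setDE -setIA [_ :&: A]setIC setICr setI0.
congr (_ * _); rewrite -[LHS]signr_odd -[X in _ * X]signr_odd -signr_addb; congr (_ ^+ _).
by rewrite -(h _ _ d x0 y0) -invC // oddD -addbA addbb addbF.
Qed.

Definition homs D (d : nat) x := forall A, ~~ ((A \subset D) && (#|A| == d)) -> x A = 0.

Lemma homsP D d x A : homs D d x -> x A != 0 -> A \subset D /\ #|A| = d.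
Proof.
by move=> hx x0; have [/andP[? /eqP]|/hx xA0] := boolP ((A \subset D) && (#|A| == d));
  last by rewrite xA0 eqxx in x0.
Qed.

Lemma homsPn D d x : (forall A, x A != 0 -> A \subset D /\ #|A| = d) -> homs D d x.
Proof. by move=> h A; apply: contraNeq => /h[-> ->]; rewrite eqxx. Qed.

Lemma homs_comm D d d' x y : homs D d x -> homs D d' y -> x * y = (-1) ^+ (d * d') * (y * x).
Proof. by move=> hx hy; apply: ext_signcomm => A B _ /(homsP _ _ _ _ hx)[_ ->] /(homsP _ _ _ _ hy)[_ ->]. Qed.

Lemma homsM D d d' x y : homs D d x -> homs D d' y -> homs D (d + d') (x * y).
Proof.
move=> hx hy; apply: homsPn => C; rewrite extmulE => nz.
have [A /andP[sA nA]] : exists A : {set 'I_m}, (A \subset C) && (x A * y (C :\: A) != 0).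
  apply/existsP; apply: contraR nz; rewrite negb_exists => /forallP h.
  rewrite big1 // => A sA; move: (h A); rewrite sA /= negbK => /eqP->.
  by rewrite mulr0.
move: nA; rewrite mulf_eq0 negb_or => /andP[/(homsP _ _ _ _ hx)[s1 e1] /(homsP _ _ _ _ hy)[s2 e2]].
rewrite -(setID C A) (setIidPr sA) subUset s1 s2; split=> //.
by rewrite cardsU -e1 -e2 setIDA (setIC A) -setIDA setDv setI0 cards0 subn0.
Qed.

Lemma homs0 D d : homs D d 0. Proof. by move=> A _; rewrite ffunE. Qed.
Lemma homs1 D : homs D 0 1.
Proof.
apply: homsPn => A; rewrite ffunE; have [->|_] := eqVneq A set0.
  by rewrite sub0set cards0.
by rewrite eqxx.
Qed.
Lemma homsD D d x y : homs D d x -> homs D d y -> homs D d (x + y).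
Proof. by move=> hx hy A h; rewrite ffunE hx // hy // addr0. Qed.
Lemma homsZ D d c x : homs D d x -> homs D d (c *: x).
Proof. by move=> hx A h; rewrite ffunE hx // mulr0. Qed.
Lemma homsN D d x : homs D d x -> homs D d (- x).
Proof. by move=> hx A h; rewrite ffunE hx // oppr0. Qed.
Lemma homs_sum D d (I : Type) (r : seq I) (P : pred I) (f : I -> ext) :
  (forall i, P i -> homs D d (f i)) -> homs D d (\sum_(i <- r | P i) f i).
Proof. by move=> h; apply: big_ind => //; [exact: homs0 | exact: homsD]. Qed.
Lemma homs_gt D d x : homs D d x -> (#|D| < d)%N -> x = 0.
Proof.
move=> hx lt; apply/ffunP => A; rewrite [RHS]ffunE; apply: hx; apply/negP.
by case/andP => /subset_leq_card le /eqP eA; rewrite eA leqNgt lt in le.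
Qed.
Lemma homsS D D' d x : D \subset D' -> homs D d x -> homs D' d x.
Proof.
by move=> sD hx; apply: homsPn => A /(homsP _ _ _ _ hx)[s ->]; split=> //; apply: subset_trans sD.
Qed.

Definition ebas A : ext := [ffun B => (B == A)%:R].

Lemma ebasM A B : [disjoint A & B] -> ebas A * ebas B = (-1) ^+ ninv A B * ebas (A :|: B).
Proof.
move=> d; apply/ffunP => C; rewrite extmulE -signr_odd mulr_sign.
have -> : (if odd (ninv A B) then - ebas (A :|: B) else ebas (A :|: B)) C
   = (-1) ^+ ninv A B * (C == A :|: B)%:R.
  by rewrite -signr_odd mulr_sign; case: odd; rewrite !ffunE.
have dAB : (A :|: B) :\: A = B.
  by rewrite setDUl setDv set0U; apply/setDidPl; rewrite disjoint_sym.
have [->|nC] := eqVneq C (A :|: B).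
  rewrite (bigD1 A) ?subsetUl //= dAB !ffunE !eqxx big1 ?addr0 ?mulr1 // => A' /andP[_ /negPf nA].
  by rewrite ffunE nA mul0r mulr0.
rewrite mulr0 big1 // => A' sA; rewrite !ffunE.
have [eA|] := eqVneq A' A; last by rewrite mul0r mulr0.
have [eB|] := eqVneq (C :\: A') B; last by rewrite !mulr0.
by case/eqP: nC; rewrite -eB -eA -{1}(setID C A') (setIidPr sA).
Qed.

Definition gen i : ext := ebas [set i].

Lemma gen_homs D i : i \in D -> homs D 1 (gen i).
Proof.
move=> iD; apply: homsPn => A; rewrite ffunE; have [->|] := eqVneq A [set i]; last by rewrite eqxx.
by rewrite sub1set cards1.
Qed.

Lemma gen_anti i j : gen i * gen j = - (gen j * gen i).
Proof.
by rewrite (homs_comm setT 1 1) ?mulN1r //; apply: gen_homs; rewrite inE.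
Qed.

Lemma gen_sq i : gen i * gen i = 0.
Proof.
apply: (homs_gt [set i] 2); last by rewrite cards1.
by apply: (homsM _ 1 1); apply: gen_homs; rewrite inE.
Qed.

Lemma gen_prod (s : seq 'I_m) : uniq s ->
  {b : nat | \prod_(i <- s) gen i = (-1) ^+ b * ebas [set i in s]}.
Proof.
elim: s => [|i s IH] /=.
  by exists 0%N; rewrite big_nil mul1r; apply/ffunP => A; rewrite !ffunE; congr (_ == _)%:R;
    apply/setP => i; rewrite !inE.
case/andP=> nis /IH[b eb].
exists (b + ninv [set i] [set j in s])%N; rewrite big_cons eb mulr_signCA.
rewrite ebasM ?disjoints1 ?inE // exprD -!mulrA; do 2!congr (_ * _).
by congr ebas; apply/setP => j; rewrite !inE.
Qed.

Lemma gen_prod_sorted (s : seq 'I_m) : sorted (fun i j : 'I_m => (i < j)%N) s ->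
  \prod_(i <- s) gen i = ebas [set i in s].
Proof.
elim: s => [|i s IH] /=.
  by move=> _; rewrite big_nil; apply/ffunP => A; rewrite !ffunE; congr (_ == _)%:R;
    apply/setP => i; rewrite !inE.
move=> ps; have /allP lt : all (fun j : 'I_m => (i < j)%N) s.
  by apply: order_path_min ps => a b c; apply: ltn_trans.
rewrite big_cons IH ?(path_sorted ps) // ebasM; last first.
  by rewrite disjoints1 inE; apply/negP => /lt; rewrite ltnn.
have -> : ninv [set i] [set j in s] = 0%N.
  rewrite /ninv big_set1 big1 // => j; rewrite inE => /lt ij.
  by rewrite ltnNge ltnW.
by rewrite mul1r; congr ebas; apply/setP => j; rewrite !inE.
Qed.

End Ext.

(** * Newton's identities for the characteristic polynomial *)

Section Newton.
Variables (R : comNzRingType) (n : nat) (A : 'M[R]_n).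

Lemma deriv_prod (I : finType) (f : I -> {poly R}) :
  (\prod_i f i)^`() = \sum_i (f i)^`() * \prod_(j | i != j) f j.
Proof.
suff H (s : seq I) : uniq s -> (\prod_(i <- s) f i)^`() =
    \sum_(i <- s) (f i)^`() * \prod_(j <- s | i != j) f j.
  by rewrite H ?index_enum_uniq.
elim: s => [|i s IH] /=; first by rewrite !big_nil derivC.
case/andP=> nis us; rewrite !big_cons derivM IH // eqxx /=; congr (_ * _ + _).
  rewrite [RHS]big_seq_cond [LHS]big_seq; apply: eq_bigl => j.
  by case js: (j \in s) => //=; apply/esym; apply: contraNneq nis => ->.
rewrite mulr_sumr big_seq [RHS]big_seq; apply: eq_bigr => j js.
rewrite big_cons; have -> : j != i by apply: contraNneq nis => <-.
by rewrite mulrCA.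
Qed.

Local Notation cpm := (char_poly_mx A).
Definition adjcoef k : 'M[R]_n := map_mx (coefp k) (\adj cpm).
Definition charcoef k := (char_poly A)`_k.
Local Notation B := adjcoef.
Local Notation c := charcoef.

(** Jacobi's formula: differentiating the Leibniz expansion factor by factor leaves only the
    diagonal entries, whose derivative is 1, each times its cofactor. *)
Lemma deriv_char_poly : (char_poly A)^`() = \tr (\adj cpm).
Proof.
rewrite /char_poly /determinant (raddf_sum (@deriv R)) /mxtrace.
transitivity (\sum_(s : 'S_n) \sum_i ((cpm i (s i))^`() *
     ((-1) ^+ s * \prod_(j | i != j) cpm j (s j)))).
  apply: eq_bigr => s _ /=; have -> (p : {poly R}) : ((-1) ^+ s * p)^`() = (-1) ^+ s * p^`().
    by rewrite !mulr_sign; case: (odd_perm s) => //; rewrite derivN.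
  rewrite deriv_prod mulr_sumr; apply: eq_bigr => i _.
  by rewrite mulrCA.
rewrite exchange_big; apply: eq_bigr => i _ /=.
rewrite !mxE expand_cofactor [RHS]big_mkcond; apply: eq_bigr => s _ /=.
rewrite !mxE derivB derivC subr0 derivMn derivX eq_sym.
by case: eqP => _; rewrite ?mul1r ?mul0r.
Qed.

Lemma adj_char_poly :
  'X *: \adj cpm - map_mx polyC A *m \adj cpm = (char_poly A)%:M :> 'M[{poly R}]_n.
Proof. by rewrite -mul_scalar_mx -mulmxBl mul_mx_adj. Qed.

Lemma adj_coef k : B k = (c k.+1)%:M + A *m B k.+1.
Proof.
have e := adj_char_poly; apply/matrixP => i j; have := congr1 (fun M : 'M[{poly R}]_n => (M i j)`_k.+1) e.
rewrite !mxE coefB coefXM /= => /eqP; rewrite subr_eq => /eqP->.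
rewrite coefMn /c; congr (_ + _).
by rewrite coef_sum; apply: eq_bigr => l _; rewrite !mxE coefCM.
Qed.

Lemma adj_coef0 : (c 0)%:M + A *m B 0 = 0.
Proof.
have e := adj_char_poly; apply/matrixP => i j; have := congr1 (fun M : 'M[{poly R}]_n => (M i j)`_0) e.
rewrite !mxE coefB coefXM /= => /eqP; rewrite subr_eq => /eqP e0; rewrite [RHS]e0.
rewrite coefMn /c; congr (_ + _).
by rewrite coef_sum; apply: eq_bigr => l _; rewrite !mxE coefCM.
Qed.

Lemma char_coef_gt k : (n < k)%N -> c k = 0.
Proof. by move=> lt; rewrite /c nth_default // size_char_poly. Qed.

Lemma char_coef_lead : c n = 1.
Proof. by have /monicP := char_poly_monic A; rewrite /lead_coef size_char_poly. Qed.

(** Descending induction: the coefficients vanish beyond the largest degree [D] of an entry, and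
    [adj_coef] carries this down to [n] because [c l.+1 = 0] for [l >= n]. *)
Lemma adj_coef_ge k : (n <= k)%N -> B k = 0.
Proof.
pose D := (\max_i \max_j size ((\adj cpm) i j))%N.
suff H d l : (n <= l)%N -> (D <= l + d)%N -> B l = 0.
  by move=> le; apply: (H D) => //; apply: leq_addl.
elim: d l => [|d IH] l le ld.
  apply/matrixP => i j; rewrite !mxE /= nth_default //; rewrite addn0 in ld.
  apply: leq_trans ld; apply: leq_trans (leq_bigmax i).
  by have := leq_bigmax (F := fun j => size ((\adj cpm) i j)) j; rewrite mxE.
have z : B l.+1 = 0 by apply: IH; [exact: leqW | rewrite addSnnS].
by rewrite adj_coef z char_coef_gt // mulmx0 raddf0 addr0.
Qed.

Lemma adj_coefE k : B k = \sum_(i < n - k) c (k.+1 + i) *: A ^+ i.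
Proof.
move: {2}(n - k)%N (erefl (n - k)%N) => d; elim: d k => [|d IH] k ed.
  by rewrite ed big_ord0 adj_coef_ge // -subn_eq0 ed.
have ed' : (n - k.+1 = d)%N by rewrite subnS ed.
rewrite ed big_ord_recl expr0 addn0 adj_coef -scalemx1; congr (_ + _).
rewrite IH // ed' mulmx_sumr; apply: eq_bigr => i _.
by rewrite -scalemxAr exprS -[A *m _]/(A * _) addnS addSn.
Qed.

(** Newton's identities, from two expressions for the trace of [B (k-1)]: a coefficient of the
    derivative of the characteristic polynomial, and the expansion [adj_coefE]. The case [k = 0] is
    the trace of [adj_coef0]. *)
Lemma char_coef_trace k : (k <= n)%N ->
  c k *+ k = \sum_(i < (n - k).+1) c (k + i) * \tr (A ^+ i).
Proof.
case: k => [_|k lt].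
  rewrite mulr0n subn0 big_ord_recl expr0.
  have := congr1 mxtrace adj_coef0; rewrite raddf0 raddfD /= adj_coefE subn0 => e.
  rewrite -[LHS]e.
  congr (_ + _); first by rewrite mxtrace_scalar mxtrace1 mulr_natr.
  rewrite mulmx_sumr raddf_sum; apply: eq_bigr => i _.
  by rewrite /= -scalemxAr mxtraceZ exprS.
transitivity (\tr (B k)).
  rewrite /mxtrace; under [RHS]eq_bigr do rewrite mxE /=.
  by rewrite -coef_sum -/(\tr _) -deriv_char_poly coef_deriv.
rewrite adj_coefE raddf_sum -subSn // subSS; apply: eq_bigr => i _.
by rewrite /= mxtraceZ.
Qed.

Lemma Cayley_Hamilton_sum : \sum_(i < n.+1) c i *: A ^+ i = 0.
Proof.
rewrite -[RHS]adj_coef0 big_ord_recl expr0 scalemx1; congr (_ + _).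
rewrite adj_coefE subn0 mulmx_sumr; apply: eq_bigr => i _.
by rewrite -scalemxAr exprS.
Qed.

(* The hypotheses say that all products of two power sums vanish, so that only
   the linear part of Newton's formulas survives. *)
Lemma Cayley_Hamilton_sq0 (q : nat -> R) :
    (forall (x : R) j, (0 < j)%N -> x *+ j = 0 -> x = 0) ->
    (forall j, (0 < j)%N -> \tr (A ^+ j) = q j *+ j) ->
    (forall i j, (0 < i)%N -> (0 < j)%N -> q i * q j = 0) ->
  A ^+ n = \sum_(j < n) q j.+1 *: A ^+ (n - j.+1).
Proof.
move=> tf trq qq.
(* Strong induction with Newton's identity for [c (n - j)]. The intermediate terms are products of
   two values of [q], hence zero; what remains is the last one, with leading coefficient [c n = 1],
   and [j] is cancelled by [tf]. *)
have cq j : (0 < j <= n)%N -> c (n - j) = - q j.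
  elim/ltn_ind: j => j IH /andP[j0 jn].
  apply/eqP; rewrite -subr_eq0 opprK; apply/eqP/(tf _ j j0); rewrite mulrnDl.
  have := char_coef_trace (n - j) (leq_subr _ _); rewrite subKn // big_ord_recl /=.
  have nE : c (n - j) *+ n = c (n - j) *+ (n - j) + c (n - j) *+ j by rewrite -mulrnDr subnK.
  rewrite addn0 expr0 mxtrace1 mulr_natr nE -addrA => e.
  have {e} : c (n - j) *+ j + \sum_(i < j) c (n - j + bump 0 i) * \tr (A ^+ bump 0 i) = 0.
    by apply: (addrI (c (n - j) *+ (n - j))); rewrite addr0 -e.
  case: j {nE} j0 jn IH => // j _ jn IH; rewrite big_ord_recr /= big1 => [|i _].
    rewrite add0r trq //; congr (_ = 0); congr (_ + _).
    by rewrite /bump /= add1n subnK // char_coef_lead mul1r.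
  rewrite trq // mulrnAr /bump /= add1n.
  have -> : (n - j.+1 + i.+1 = n - (j - i))%N.
    by have := ltn_ord i; lia.
  rewrite IH ?mulNr ?qq ?oppr0 ?mul0rn //.
  - by rewrite subn_gt0.
  - by rewrite ltnS leq_subr.
  - by rewrite subn_gt0 ltn_ord (leq_trans (leq_subr _ _)) // ltnW.
have := Cayley_Hamilton_sum; rewrite big_ord_recr /= char_coef_lead scale1r addrC.
move/eqP; rewrite addr_eq0 => /eqP->; rewrite -sumrN (reindex_inj rev_ord_inj) /=.
by apply: eq_bigr => j _; rewrite cq ?scaleNr ?opprK //= ltn_ord.
Qed.

End Newton.

(** * Multilinear functions *)

Definition vcons {T : Type} {k : nat} (y : T) (v : 'I_k -> T) (r : 'I_k.+1) : T :=
  if unlift ord0 r is Some r' then v r' else y.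

Lemma vcons0 {T : Type} {k : nat} (y : T) (v : 'I_k -> T) : vcons y v ord0 = y.
Proof. by rewrite /vcons unlift_none. Qed.

Lemma vconsS {T : Type} {k : nat} (y : T) (v : 'I_k -> T) r : vcons y v (lift ord0 r) = v r.
Proof. by rewrite /vcons liftK. Qed.

Lemma vconsE {T : Type} {k : nat} (v : 'I_k.+1 -> T) :
  v = vcons (v ord0) (fun r => v (lift ord0 r)).
Proof.
apply: functional_extensionality => r; rewrite /vcons.
by case: unliftP => [r' ->|->].
Qed.

Lemma big_ffun_recl (R : nmodType) (T : finType) (k : nat) (H : {ffun 'I_k.+1 -> T} -> R) :
  \sum_i H i = \sum_t \sum_(i : {ffun 'I_k -> T}) H [ffun r => vcons t i r].
Proof.
rewrite pair_bigA /= (reindex (fun p : T * {ffun 'I_k -> T} => [ffun r => vcons p.1 p.2 r])) //=.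
exists (fun i : {ffun 'I_k.+1 -> T} => (i ord0, [ffun r => i (lift ord0 r)])) => [[t i]|i] _ /=.
  rewrite ffunE vcons0; congr (_, _); apply/ffunP => r; by rewrite !ffunE vconsS.
apply/ffunP => r; rewrite ffunE; case: (unliftP ord0 r) => [r' ->|->].
  by rewrite vconsS ffunE.
by rewrite vcons0.
Qed.

Lemma big_ffun_ord0 (R : nmodType) (T : finType) (H : {ffun 'I_0 -> T} -> R) i0 :
  \sum_i H i = H i0.
Proof.
by rewrite (big_pred1 i0) // => i /=; apply/esym/eqP/ffunP => -[].
Qed.

Section Multilinear.
Variables (F : fieldType) (n : nat).
Implicit Type (V : lmodType F).

Definition mlin {k : nat} {V} (G : ('I_k -> 'M[F]_n) -> V) : Prop :=
  forall v i a y z, G (upd F n v i (a *: y + z)) = a *: G (upd F n v i y) + G (upd F n v i z).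

Lemma upd_vcons0 k (v : 'I_k -> 'M[F]_n) y z : upd F n (vcons y v) ord0 z = vcons z v.
Proof.
apply: functional_extensionality => r; rewrite /upd.
by case: (unliftP ord0 r) => [r' ->|->]; rewrite ?vconsS ?vcons0.
Qed.

Lemma upd_vconsS k (v : 'I_k -> 'M[F]_n) y z i :
  upd F n (vcons y v) (lift ord0 i) z = vcons y (upd F n v i z).
Proof.
apply: functional_extensionality => r; rewrite /upd.
by case: (unliftP ord0 r) => [r' ->|->]; rewrite ?vconsS ?vcons0 // (inj_eq lift_inj).
Qed.

Lemma mlin_sum k V (G : ('I_k -> 'M[F]_n) -> V) v i (T : finType) (a : T -> F) y : mlin G ->
  G (upd F n v i (\sum_t a t *: y t)) = \sum_t a t *: G (upd F n v i (y t)).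
Proof.
move=> lG; have G0 : G (upd F n v i 0) = 0.
  have := lG v i 1 0 0; rewrite !scale1r addr0 => e.
  by apply: (addrI (G (upd F n v i 0))); rewrite addr0.
elim: (index_enum T) => [|t r IH]; first by rewrite !big_nil.
by rewrite !big_cons lG IH.
Qed.

Lemma mlin_expand k V (G : ('I_k -> 'M[F]_n) -> V) (T : finType)
    (a : 'I_k -> T -> F) (e : 'I_k -> T -> 'M[F]_n) : mlin G ->
  G (fun r => \sum_t a r t *: e r t) =
  \sum_(i : {ffun 'I_k -> T}) (\prod_r a r (i r)) *: G (fun r => e r (i r)).
Proof.
elim: k G a e => [|k IH] G a e lG.
  rewrite (big_ffun_ord0 _ _ _ (ffun0 (card_ord 0))) big_ord0 scale1r; congr G.
  by apply: functional_extensionality => -[].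
rewrite big_ffun_recl exchange_big /= [X in G X]vconsE.
have lG' : mlin (fun v : 'I_k -> 'M[F]_n => G (vcons (\sum_t a ord0 t *: e ord0 t) v)).
  by move=> v i c y z; rewrite -!upd_vconsS.
rewrite (IH _ _ (fun r => e (lift ord0 r)) lG'); apply: eq_bigr => i _.
rewrite -(upd_vcons0 _ _ 0) mlin_sum // scaler_sumr; apply: eq_bigr => t _.
rewrite upd_vcons0 scalerA mulrC big_ord_recl ffunE vcons0; congr (_ *: G _).
  by congr (_ * _); apply: eq_bigr => r _; rewrite ffunE vconsS.
rewrite [RHS]vconsE ffunE vcons0; congr vcons.
by apply: functional_extensionality => r; rewrite ffunE vconsS.
Qed.

End Multilinear.

(** * Polarization and the double centralizer of the symmetric group *)

Section CharZero.
Variable F : fieldType.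
Hypothesis char0 : [pchar F] =i pred0.

Lemma natf0 m : (m%:R == 0 :> F) = (m == 0)%N.
Proof. by move/pcharf0P: char0. Qed.

Lemma natr_inj : injective (fun m => m%:R : F).
Proof.
move=> a b; wlog le : a b / (a <= b)%N => [H|e].
  by case: (leqP a b) => [/H//|/ltnW/H h /esym/h].
have /eqP : (b - a)%:R = 0 :> F by rewrite natrB // e subrr.
rewrite natf0 subn_eq0 => le'; apply/eqP; by rewrite eqn_leq le.
Qed.

Lemma fact_neq0 m : m`!%:R != 0 :> F.
Proof. by rewrite natf0 -lt0n fact_gt0. Qed.

(** The images of the natural numbers are pairwise distinct and provide more roots than the degree
    allows. *)
Lemma poly_eq0_char0 (p : {poly F}) : (forall t, p.[t] = 0) -> p = 0.
Proof.
move=> h; apply/eqP; apply: contraT => p0.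
pose s := [seq m%:R : F | m <- iota 0 (size p)].
have := max_poly_roots p0 (rs := s); rewrite size_map size_iota ltnn => ->//.
  by apply/allP => t _; apply/eqP/h.
by rewrite map_inj_uniq ?iota_uniq //; apply: natr_inj.
Qed.

Lemma opp_eq0 (x : F) : x = - x -> x = 0.
Proof.
move=> /eqP; rewrite -addr_eq0 -mulr2n -mulr_natr mulf_eq0 natf0 orbF; exact/eqP.
Qed.

(** Ryser's formula for the permanent. Expanding the right side over functions [f], the coefficient
    of [f] is a signed count of the sets containing its image, which is zero unless [f] is onto,
    that is, a permutation. *)
Lemma polarization K (b : 'I_K -> 'I_K -> F) :
  \sum_(s : 'S_K) \prod_r b (s r) r =
  \sum_(S : {set 'I_K}) (-1) ^+ #|~: S| * \prod_r \sum_(i in S) b i r.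
Proof.
transitivity (\sum_(S : {set 'I_K}) \sum_(f : {ffun 'I_K -> 'I_K} | f \in ffun_on (mem S))
     (-1) ^+ #|~: S| * \prod_r b (f r) r); last first.
  by apply: eq_bigr => S _; rewrite bigA_distr_big mulr_sumr.
rewrite (exchange_big_dep predT) //=.
under eq_bigr => f _ do rewrite -mulr_suml.
rewrite (bigID (fun f : {ffun 'I_K -> 'I_K} => injectiveb f)) /= [X in _ + X]big1 ?addr0.
  rewrite (reindex (@pval _)) /=; last first.
    pose in_Sn := insubd (1%g : 'S_K).
    by exists in_Sn => /= f If; first apply: val_inj; apply: insubdK.
  apply: eq_big => [s|s _]; first exact/esym/(valP s).
  rewrite (big_pred1 setT) ?setCT ?cards0 ?mul1r => [|S] /=.
    by apply: eq_bigr => r _; rewrite -pvalE.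
  apply/ffun_onP/eqP => [h|-> r]; last by rewrite inE.
  apply/setP => i; rewrite inE -[i](permKV s); have := h (s^-1 i)%g.
  by rewrite pvalE => ->.
move=> f nif; suff -> : \sum_(S : {set 'I_K} | f \in ffun_on (mem S)) (-1) ^+ #|~: S| = 0 :> F.
  by rewrite mul0r.
have [x xf] : exists x, x \notin codom f.
  apply/existsP; apply: contraR nif; rewrite negb_exists => /forallP h.
  have /image_injP fi : #|image f predT| == #|'I_K|.
    by apply/eqP/eq_card => x; rewrite !inE; apply/negPn/h.
  by apply/injectiveP => y z; apply: fi.
(* Toggling a point [x] missed by [f] is a sign-reversing involution on the sets that contain the
   image of [f]. *)
pose tg (S : {set 'I_K}) := if x \in S then S :\ x else x |: S.
have tgK : involutive tg.
  move=> S; rewrite /tg; case: (boolP (x \in S)) => xS.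
    by rewrite !inE eqxx /= setD1K.
  by rewrite !inE eqxx /= setU1K.
apply: opp_eq0; rewrite {1}(reindex_inj (inv_inj tgK)) /= -sumrN.
apply: eq_big => [S|S _].
  apply/ffun_onP/ffun_onP => h r; have := h r; have : f r != x.
  - by apply: contraNneq xf => <-; apply: codom_f.
  - by rewrite /tg; case: ifP => _; rewrite !inE => /negPf->.
  - by apply: contraNneq xf => <-; apply: codom_f.
  - by rewrite /tg; case: ifP => _; rewrite !inE => /negPf->.
rewrite /tg; case: ifP => xS.
  have -> : ~: (S :\ x) = x |: ~: S by apply/setP => y; rewrite !inE negb_and negbK.
  by rewrite cardsU1 !inE xS exprS mulN1r.
have -> : ~: S = x |: ~: (x |: S).
  by apply/setP => y; rewrite !inE negb_or; case: eqP => // ->; rewrite xS.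
by rewrite cardsU1 !inE eqxx /= exprS mulN1r opprK.
Qed.

Section Invariants.
Variables (n K : nat).
Local Notation J := {ffun 'I_K -> 'I_n}.
Local Notation V := {ffun J * J -> F^o}.

Definition fperm (L : J) (s : 'S_K) : J := [ffun r => L (s r)].

Lemma fpermM L s t : fperm (fperm L t) s = fperm L (s * t)%g.
Proof. by apply/ffunP => r; rewrite !ffunE permM. Qed.

Lemma fperm1 L : fperm L 1%g = L.
Proof. by apply/ffunP => r; rewrite ffunE perm1. Qed.

Lemma fperm_inj s : injective (fperm^~ s).
Proof. by move=> L M e; rewrite -(fperm1 L) -(fperm1 M) -(mulVg s) -!fpermM e. Qed.

Definition pact (s : 'S_K) (x : V) : V := [ffun p => x (fperm p.1 s, p.2)].

Lemma pact_is_linear s : linear (pact s).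
Proof. by move=> a x y; apply/ffunP => p; rewrite !ffunE. Qed.
HB.instance Definition _ s :=
  GRing.isLinear.Build F V V _ (pact s) (pact_is_linear s).

Lemma pactM s t x : pact t (pact s x) = pact (s * t)%g x.
Proof. by apply/ffunP => p; rewrite !ffunE /= fpermM. Qed.

Definition pmat (s : 'S_K) : V := [ffun p => (p.2 == fperm p.1 s)%:R].

Lemma pact_pmat s t : pact s (pmat t) = pmat (t * s)%g.
Proof. by apply/ffunP => p; rewrite !ffunE /= fpermM. Qed.

Definition pspace : {vspace V} := (\sum_(s : 'S_K) <[pmat s]>)%VS.

Lemma pmat_pspace s : pmat s \in pspace.
Proof. by rewrite memvE /pspace (sumv_sup s). Qed.

Lemma pact_pspace s x : x \in pspace -> pact s x \in pspace.
Proof.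
case/memv_sumP => xs hx ->; rewrite linear_sum memv_suml // => t _.
by have /vlineP[a ->] := hx t isT; rewrite linearZ /= memvZ // pact_pmat pmat_pspace.
Qed.

(* Maschke's averaging of a linear projection onto [pspace]. *)
Definition pproj (x : V) : V := \sum_(s : 'S_K) pact s (projv pspace (pact s^-1%g x)).

Lemma pproj_is_linear : linear pproj.
Proof.
move=> a x y; rewrite /pproj scaler_sumr -big_split /=; apply: eq_bigr => s _.
by rewrite !linearP.
Qed.
HB.instance Definition _ := GRing.isLinear.Build F V V _ pproj pproj_is_linear.

Lemma pproj_mem x : pproj x \in pspace.
Proof. by apply: memv_suml => s _; apply/pact_pspace/memv_proj. Qed.

Lemma pproj_id x : x \in pspace -> pproj x = K`!%:R *: x.
Proof.
move=> hx; rewrite /pproj (eq_bigr (fun=> x)) => [|s _].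
  by rewrite sumr_const card_Sn scaler_nat.
rewrite projv_id ?pact_pspace // pactM mulVg.
by apply/ffunP => -[p q]; rewrite ffunE /= fperm1.
Qed.

Lemma pproj_act t x : pact t (pproj x) = pproj (pact t x).
Proof.
rewrite /pproj linear_sum [RHS](reindex_inj (mulIg t)) /=; apply: eq_bigr => s _.
by rewrite !pactM invMg mulgA mulgV mul1g.
Qed.

Definition pdelta (A B : J) : V := [ffun p => (p == (A, B))%:R].

Lemma pdelta_sum (x : V) : x = \sum_A \sum_B x (A, B) *: pdelta A B.
Proof.
apply/ffunP => -[A B]; rewrite sum_ffunE (bigD1 A) //= [X in _ + X]big1 ?addr0.
  rewrite sum_ffunE (bigD1 B) //= [X in _ + X]big1 ?addr0.
    by rewrite !ffunE eqxx /= [_ *: _]mulr1.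
  by move=> B' nB; rewrite !ffunE xpair_eqE (eq_sym B) (negPf nB) andbF [_ *: _]mulr0.
move=> A' nA; rewrite sum_ffunE big1 // => B' _.
by rewrite !ffunE xpair_eqE (eq_sym A) (negPf nA) [_ *: _]mulr0.
Qed.

Lemma pact_pdelta t A B : pact t (pdelta (fperm A t) B) = pdelta A B.
Proof.
apply/ffunP => -[L M]; rewrite !ffunE /= !xpair_eqE.
by rewrite (inj_eq (fperm_inj t)).
Qed.

(** The averaged projection satisfies [pproj C = K! C]: its matrix coefficients commute with [C],
    which can therefore be moved out until [pproj] acts on the identity matrix [pmat 1], an element
    of [pspace]. Hence [C] itself lies in the span of the permutation matrices. *)
Lemma double_centralizer (C : V) :
    (forall Q : J -> J -> F, (forall s L M, Q (fperm L s) (fperm M s) = Q L M) ->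
      forall L M, \sum_A C (L, A) * Q A M = \sum_A Q L A * C (A, M)) ->
  exists a : 'S_K -> F, forall L M, C (L, M) = \sum_s a s * (M == fperm L s)%:R.
Proof.
move=> comC.
(* For fixed [M] and [B] this is a matrix in [L] and [A]; its invariance under simultaneous
   permutation of both indices is the equivariance of [pproj]. *)
pose Q M B L A : F := pproj (pdelta A B) (L, M).
have Qinv M B s L A : Q M B (fperm L s) (fperm A s) = Q M B L A.
  rewrite /Q -[in RHS](pact_pdelta s) -pproj_act [in RHS]ffunE.
  by [].
have pE x L M : pproj x (L, M) = \sum_A \sum_B x (A, B) * Q M B L A.
  rewrite {1}(pdelta_sum x) linear_sum sum_ffunE; apply: eq_bigr => A _.
  rewrite linear_sum sum_ffunE; apply: eq_bigr => B _.
  by rewrite linearZ ffunE.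
have : pproj C = K`!%:R *: C.
  apply/ffunP => -[L M]; rewrite pE exchange_big /=.
  transitivity (\sum_B \sum_A C (L, A) * Q M B A B).
    apply: eq_bigr => B _; rewrite (comC (Q M B) (Qinv M B)).
    by apply: eq_bigr => A _; rewrite mulrC.
  rewrite exchange_big /= (eq_bigr (fun A => C (L, A) * (pproj (pmat 1%g) (A, M)))).
    rewrite pproj_id ?pmat_pspace // (bigD1 M) //= big1 ?addr0.
      by rewrite !ffunE /= fperm1 eqxx [_ *: 1]mulr1 mulrC.
    move=> A nA; rewrite !ffunE /= fperm1 eq_sym (negPf nA) [_ *: 0]mulr0.
    by rewrite mulr0.
  move=> A _; rewrite pE -mulr_sumr; congr (_ * _).
  rewrite exchange_big /=; apply: eq_bigr => B _; rewrite (bigD1 B) //= big1 ?addr0.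
    by rewrite ffunE /= fperm1 eqxx mul1r.
  by move=> D nD; rewrite ffunE /= fperm1 eq_sym (negPf nD) mul0r.
move/(congr1 ( *:%R K`!%:R^-1)); rewrite scalerA mulVf ?fact_neq0 // scale1r => CE.
have /memv_sumP[xs hx Cs] : C \in pspace by rewrite -CE memvZ // pproj_mem.
have /all_sig[a ha] s : {a | xs s = a *: pmat s}.
  exists (coord [tuple pmat s] ord0 (xs s)).
  have := hx s isT; rewrite -span_seq1 => /(coord_span (X := [tuple pmat s])).
  by rewrite big_ord1.
exists a => L M; rewrite Cs sum_ffunE; apply: eq_bigr => s _.
by rewrite ha !ffunE.
Qed.

End Invariants.
End CharZero.

(** * The first fundamental theorem for matrix invariants *)

Section ScalarFFT.
Variable F : fieldType.
Hypothesis char0 : [pchar F] =i pred0.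
Variables (n K : nat) (G : ('I_K -> 'M[F]_n) -> F^o).
Hypothesis linG : mlin F n G.
Hypothesis invG : forall g v, g \in unitmx -> G (fun r => g *m v r *m invmx g) = G v.

Local Notation J := {ffun 'I_K -> 'I_n}.

Definition gcoef (M L : J) : F := G (fun r => delta_mx (M r) (L r)).

Lemma mul_delta_sum (g : 'M[F]_n) (i l : 'I_n) : g *m delta_mx i l = \sum_m g m i *: delta_mx m l.
Proof.
apply/matrixP => p q; rewrite summxE (bigD1 p) //= !mxE (bigD1 i) //= !mxE !eqxx /=.
rewrite big1 ?addr0; last by move=> j /negPf nj; rewrite mxE nj mulr0.
rewrite big1 ?addr0 // => j /negPf nj; by rewrite !mxE eq_sym nj mulr0.
Qed.

Lemma delta_mul_sum (g : 'M[F]_n) (i l : 'I_n) : delta_mx i l *m g = \sum_m g l m *: delta_mx i m.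
Proof.
apply/matrixP => p q; rewrite summxE (bigD1 q) //= !mxE (bigD1 l) //= !mxE !eqxx /= andbT.
rewrite big1 ?addr0 1?mulrC; last by move=> j /negPf nj; rewrite mxE nj andbF mul0r.
rewrite big1 ?addr0 // => j /negPf nj; by rewrite !mxE [q == j]eq_sym nj andbF mulr0.
Qed.

Definition gcomm (D : J -> J -> F) : Prop :=
  forall I L, \sum_M D M I * gcoef M L = \sum_M D L M * gcoef I M.

(** Invariance gives [G (g v) = G (v g)]; expanding both sides on matrix units says that the matrix
    of [G] commutes with the K-th tensor power of [g]. *)
Lemma gcomm_unit g : g \in unitmx -> gcomm (fun M I => \prod_r g (M r) (I r)).
Proof.
move=> ug I L.
have e : G (fun r => g *m delta_mx (I r) (L r)) = G (fun r => delta_mx (I r) (L r) *m g).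
  rewrite -[RHS](invG g) //; congr G; apply: functional_extensionality => r.
  by rewrite !mulmxA mulmxK.
have eL : (fun r => g *m delta_mx (I r) (L r)) =
     (fun r => \sum_m g m (I r) *: delta_mx m (L r)).
  by apply: functional_extensionality => r; rewrite mul_delta_sum.
have eR : (fun r => delta_mx (I r) (L r) *m g) =
     (fun r => \sum_m g (L r) m *: delta_mx (I r) m).
  by apply: functional_extensionality => r; rewrite delta_mul_sum.
move: e; rewrite eL eR.
rewrite (mlin_expand _ _ _ _ _ _ (fun r m => g m (I r)) (fun r m => delta_mx m (L r))) //.
by rewrite (mlin_expand _ _ _ _ _ _ (fun r m => g (L r) m) (fun r m => delta_mx (I r) m)).
Qed.

(** Singular [g] are reached by a polynomial argument: the defect [P] of the identity for [g + t I]
    becomes zero at every [t] once multiplied by the determinant of [g + t I], a nonzero polynomial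
    in [t]. *)
Lemma gcomm_all (g : 'M[F]_n) : gcomm (fun M I => \prod_r g (M r) (I r)).
Proof.
(* This is the matrix [g + 'X I]; its determinant is monic, hence nonzero. *)
move=> I L; pose gt := char_poly_mx (- g).
pose P : {poly F} := \sum_(M : J) (\prod_r gt (M r) (I r)) * (gcoef M L)%:P
     - \sum_(M : J) (\prod_r gt (L r) (M r)) * (gcoef I M)%:P.
have gtE t p q : (gt p q).[t] = (g + t%:M) p q.
  by rewrite !mxE !hornerE hornerMn hornerX opprK addrC.
have PE t : P.[t] = \sum_(M : J) (\prod_r (g + t%:M) (M r) (I r)) * gcoef M L
     - \sum_(M : J) (\prod_r (g + t%:M) (L r) (M r)) * gcoef I M.
  rewrite hornerD hornerN !horner_sum; congr (_ - _); apply: eq_bigr => M _.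
    by rewrite hornerM hornerC horner_prod; congr (_ * _); apply: eq_bigr => r _; rewrite gtE.
  by rewrite hornerM hornerC horner_prod; congr (_ * _); apply: eq_bigr => r _; rewrite gtE.
have : char_poly (- g) * P = 0.
  apply: poly_eq0_char0 => // t; rewrite hornerM.
  have -> : (char_poly (- g)).[t] = \det (g + t%:M).
    rewrite /char_poly -horner_evalE -det_map_mx; congr (\det _).
    by apply/matrixP => p q; rewrite mxE /= horner_evalE gtE.
  have [->|d0] := eqVneq (\det (g + t%:M)) 0; first by rewrite mul0r.
  by rewrite PE (gcomm_unit (g + t%:M)) ?subrr ?mulr0 // unitmxE unitfE.
move/eqP; rewrite mulf_eq0 (negPf (monic_neq0 (char_poly_monic _))) /= => /eqP P0.
have /eqP := PE 0; rewrite P0 horner0 eq_sym subr_eq0 => /eqP.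
by rewrite raddf0 addr0.
Qed.

Lemma gcomm_sum (T : finType) (a : T -> F) (D : T -> J -> J -> F) :
  (forall t, gcomm (D t)) -> gcomm (fun M I => \sum_t a t * D t M I).
Proof.
move=> h I L.
under eq_bigr => M _ do rewrite mulr_suml.
under [RHS]eq_bigr => M _ do rewrite mulr_suml.
rewrite exchange_big [RHS]exchange_big; apply: eq_bigr => t _ /=.
under eq_bigr => M _ do rewrite -mulrA.
under [RHS]eq_bigr => M _ do rewrite -mulrA.
by rewrite -!mulr_sumr h.
Qed.

Lemma gcomm_ext D D' : (forall M I, D M I = D' M I) -> gcomm D -> gcomm D'.
Proof.
move=> e h I L; under eq_bigr => M _ do rewrite -e.
by under [RHS]eq_bigr => M _ do rewrite -e.
Qed.

(** By [polarization], the orbit sum of a matrix unit of the tensor space is a signed sum of tensor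
    powers of the matrices [g S], to which [gcomm_all] applies. *)
Lemma gcomm_orbit (x y : J) :
  gcomm (fun M I => \sum_(s : 'S_K) ((M == fperm _ _ x s) && (I == fperm _ _ y s))%:R).
Proof.
pose g (S : {set 'I_K}) : 'M[F]_n := \sum_(i in S) delta_mx (x i) (y i).
have h := gcomm_sum _ (fun S : {set 'I_K} => (-1) ^+ #|~: S|) _ (fun S => gcomm_all (g S)).
apply: gcomm_ext h => M I.
transitivity (\sum_(s : 'S_K) \prod_r (delta_mx (x (s r)) (y (s r)) : 'M[F]_n) (M r) (I r)).
  rewrite (polarization _ char0 _ (fun i r => (delta_mx (x i) (y i) : 'M[F]_n) (M r) (I r))).
  apply: eq_bigr => S _; congr (_ * _); apply: eq_bigr => r _.
  by rewrite /g summxE.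
apply: eq_bigr => s _.
have [/andP[/eqP-> /eqP->]|h'] := boolP (_ && _).
  by rewrite big1 // => r _; rewrite !ffunE mxE !eqxx.
apply/eqP/prodf_eq0; move: h'; rewrite negb_and => h'.
suff [r hr] : exists r, ~~ ((M r == x (s r)) && (I r == y (s r))).
  by exists r; rewrite // mxE (negPf hr).
apply/existsP; apply: contraLR h'; rewrite negb_exists => /forallP hh.
rewrite negb_or !negbK; apply/andP; split; apply/eqP/ffunP => r; rewrite ffunE;
  by have := hh r; rewrite negbK => /andP[/eqP ? /eqP].
Qed.

(** An invariant matrix is the average of its coefficients times orbit sums of matrix units; the
    factor [K!] is divided out. *)
Lemma gcomm_inv (Q : J -> J -> F) :
  (forall s L M, Q (fperm _ _ L s) (fperm _ _ M s) = Q L M) -> gcomm Q.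
Proof.
move=> hQ.
have := gcomm_sum _ (fun p : J * J => K`!%:R^-1 * Q p.1 p.2) _
  (fun p => gcomm_orbit p.1 p.2).
apply: gcomm_ext => M I.
under eq_bigr => p _ do rewrite -mulrA.
rewrite -mulr_sumr; apply: (mulfI (fact_neq0 _ char0 K)).
rewrite mulrA mulfV ?fact_neq0 // mul1r.
under eq_bigr => p _ do rewrite mulr_sumr.
rewrite exchange_big /= -card_Sn mulr_natl -sumr_const; apply: eq_bigr => s _.
pose M' := fperm _ _ M s^-1%g; pose I' := fperm _ _ I s^-1%g.
have MK : fperm _ _ M' s = M by rewrite fpermM mulgV fperm1.
have IK : fperm _ _ I' s = I by rewrite fpermM mulgV fperm1.
rewrite (bigD1 (M', I')) //= MK IK !eqxx mulr1 big1 ?addr0 => [|[p q] /=].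
  by rewrite -(hQ s) MK IK.
rewrite xpair_eqE -{1}MK -{1}IK !(inj_eq (fperm_inj _ _ s)) => h.
by rewrite [M' == p]eq_sym [I' == q]eq_sym (negPf h) mulr0.
Qed.

(** The trace of the tensor product of the [A r] composed with the permutation [s] of the tensor
    factors; it factors over the cycles of [s]. *)
Definition ptrace {k} (s : 'S_k) (A : 'I_k -> 'M[F]_n) : F :=
  \sum_(L : {ffun 'I_k -> 'I_n}) \prod_r A r (L (s r)) (L r).

Lemma invariant_span : exists a : 'S_K -> F, forall v, G v = \sum_s a s * ptrace s v.
Proof.
have [Q hQ L M|a ha] := double_centralizer _ char0 n K [ffun p => gcoef p.2 p.1].
  have := gcomm_inv _ hQ M L.
  under eq_bigr => A _ do rewrite mulrC.
  under [X in _ = X -> _]eq_bigr => A _ do rewrite mulrC.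
  move=> e; under eq_bigr => A _ do rewrite ffunE /=.
  rewrite e; apply: eq_bigr => A _; by rewrite ffunE mulrC.
exists a => v.
have ev : v = (fun r => \sum_(t : 'I_n * 'I_n) v r t.1 t.2 *: delta_mx t.1 t.2).
  apply: functional_extensionality => r; rewrite {1}[v r]matrix_sum_delta.
  by rewrite (pair_bigA _ (fun i j => v r i j *: delta_mx i j)).
rewrite {1}ev (mlin_expand _ _ _ _ _ _ (fun r t => v r t.1 t.2) (fun _ t => delta_mx t.1 t.2)) //.
under eq_bigr => i _.
  have -> : G (fun r => delta_mx (i r).1 (i r).2) =
      gcoef [ffun r => (i r).1] [ffun r => (i r).2].
    by congr G; apply: functional_extensionality => r; rewrite !ffunE.
  have := ha [ffun r => (i r).2] [ffun r => (i r).1]; rewrite ffunE /= => ->.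
  rewrite [_ *: _]mulr_sumr.
  over.
rewrite exchange_big; apply: eq_bigr => s _ /=.
under eq_bigr do rewrite mulrCA.
rewrite -mulr_sumr; congr (_ * _).
rewrite (bigID (fun i : {ffun 'I_K -> 'I_n * 'I_n} =>
  [ffun r => (i r).1] == fperm _ _ [ffun r => (i r).2] s)) /= [X in _ + X]big1 ?addr0; last first.
  by move=> i /negPf->; rewrite mulr0.
rewrite (reindex_onto (fun L : J => [ffun r => (L (s r), L r)])
  (fun i : {ffun 'I_K -> 'I_n * 'I_n} => [ffun r => (i r).2])) /=; last first.
  move=> i /eqP/ffunP h; apply/ffunP => r; rewrite !ffunE.
  by have := h r; rewrite !ffunE => <-; case: (i r).
apply: eq_big => [L|L _].
  apply/andP; split; apply/eqP/ffunP => r; by rewrite !ffunE.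
have -> : [ffun r => ([ffun r0 => (L (s r0), L r0)] r).1] ==
    fperm _ _ [ffun r => ([ffun r0 => (L (s r0), L r0)] r).2] s.
  by apply/eqP/ffunP => r; rewrite !ffunE.
by rewrite mulr1; apply: eq_bigr => r _; rewrite !ffunE.
Qed.

End ScalarFFT.

(** * From permutations of tensor factors to products of traces of words *)

Section TraceWords.
Variables (F : fieldType) (n : nat).

Definition wprod (v : nat -> 'M[F]_n) (u : seq nat) : 'M[F]_n := \prod_(l <- u) v l.

Lemma perm_drop0 k (s : 'S_k.+1) : s ord0 = ord0 ->
  {t : 'S_k | forall i, s (lift ord0 i) = lift ord0 (t i)}.
Proof.
move=> s0.
have h i : {j | s (lift ord0 i) = lift ord0 j}.
  case: (unliftP ord0 (s (lift ord0 i))) => [j ->|e]; first by exists j.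
  by move: e; rewrite -[in RHS]s0 => /perm_inj.
pose t i := sval (h i).
have tE i : s (lift ord0 i) = lift ord0 (t i) by rewrite /t; case: (h i).
have ti : injective t.
  by move=> i j e; apply/(@lift_inj _ ord0)/(@perm_inj _ s); rewrite !tE e.
by exists (perm ti) => i; rewrite permE tE.
Qed.

Lemma flatten_enum_recl k (w : 'I_k.+1 -> seq nat) :
  flatten [seq w r | r <- enum 'I_k.+1] =
  w ord0 ++ flatten [seq w (lift ord0 r) | r <- enum 'I_k].
Proof. by rewrite enum_ordSl /= -map_comp. Qed.

(* Contracting the vertex [ord0] of the cycle through it either splits off a trace
   or concatenates two words. *)
Lemma ptrace_words k (s : 'S_k) (w : 'I_k -> seq nat) :
  {ws : seq (seq nat) | perm_eq (flatten ws) (flatten [seq w r | r <- enum 'I_k]) &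
    forall v, ptrace F n s (fun r => wprod v (w r)) = \prod_(u <- ws) \tr (wprod v u)}.
Proof.
elim: k s w => [|k IH] s w.
  exists [::]; first by rewrite enum_ord0.
  by move=> v; rewrite /ptrace (big_ffun_ord0 _ _ _ (ffun0 (card_ord 0))) big_ord0 big_nil.
set j := s ord0.
(* Composing with this transposition removes [ord0] from its cycle, so the result restricts to a
   permutation [t] of the remaining [k] points. *)
have t0 : (s * tperm ord0 j)%g ord0 = ord0 by rewrite permM tpermR.
have [t tE] := perm_drop0 _ _ t0.
have sE i : s (lift ord0 i) = tperm ord0 j (lift ord0 (t i)).
  by rewrite -tE permM tpermK.
have PE v : ptrace F n s (fun r => wprod v (w r)) =
    \sum_(L : {ffun 'I_k -> 'I_n}) \sum_x wprod v (w ord0) (vcons x L j) x *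
      \prod_i wprod v (w (lift ord0 i)) (vcons x L (tperm ord0 j (lift ord0 (t i)))) (L i).
  rewrite /ptrace big_ffun_recl exchange_big; apply: eq_bigr => L _; apply: eq_bigr => x _.
  rewrite big_ord_recl !ffunE vcons0; congr (_ * _); apply: eq_bigr => i _.
  by rewrite !ffunE vconsS sE.
case: (unliftP ord0 j) => [j' ej|ej].
  (* The point that [s] sends to [ord0]. Summing over the index at [ord0] multiplies the matrices at
     [ord0] and at [i0], in this order. *)
  pose i0 := (t^-1)%g j'.
  pose w' i := if i == i0 then w ord0 ++ w (lift ord0 i0) else w (lift ord0 i).
  have [ws pws hws] := IH t w'; exists ws.
    apply: perm_trans pws _; rewrite flatten_enum_recl.
    apply/seq.permP => a; rewrite count_cat !count_flatten !sumnE !big_map /=.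
    rewrite (bigD1 i0) // [in RHS](bigD1 i0) //= /w' eqxx count_cat -!addnA; congr (_ + (_ + _))%N.
    by apply: eq_bigr => i /negPf->.
  move=> v; rewrite PE -hws; apply: eq_bigr => L _.
  have w0 : wprod v (w' i0) = wprod v (w ord0) *m wprod v (w (lift ord0 i0)).
    by rewrite /w' eqxx /wprod big_cat.
  rewrite [RHS](bigD1 i0) //= w0 mxE mulr_suml; apply: eq_bigr => x _.
  rewrite (bigD1 i0) //= mulrA; congr (_ * _ * _).
  - by rewrite permKV ej vconsS.
  - by rewrite /i0 permKV -ej tpermR vcons0.
  apply: eq_bigr => i ni; rewrite /w' (negPf ni) tpermD ?vconsS //.
  by rewrite ej (inj_eq lift_inj) -(inj_eq (@perm_inj _ t^-1%g)) permK eq_sym.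
have [ws pws hws] := IH t (fun i => w (lift ord0 i)); exists (w ord0 :: ws).
  by rewrite flatten_enum_recl /= perm_cat2l.
move=> v; rewrite PE big_cons -hws /mxtrace /ptrace mulr_sumr.
apply: eq_bigr => L _; rewrite mulr_suml; apply: eq_bigr => x _.
rewrite ej vcons0; congr (_ * _); apply: eq_bigr => i _.
by rewrite tperm1 perm1 vconsS.
Qed.

(** Cyclic invariance of the trace brings a chosen letter to the end of its word. *)
Lemma word_rotate k (ws : seq (seq nat)) : k \in flatten ws ->
  {us : seq (seq nat) & {u0 : seq nat | perm_eq (k :: flatten us ++ u0) (flatten ws) &
    forall v, \prod_(u <- ws) \tr (wprod v u) =
      (\prod_(u <- us) \tr (wprod v u)) * \tr (wprod v u0 *m v k)}}.
Proof.
move=> kws.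
have hs : has (fun u => k \in u) ws.
  by case/flattenP: kws => u uws ku; apply/hasP; exists u.
pose m := find (fun u => k \in u) ws; pose u := nth [::] ws m.
have ku : k \in u by apply: (nth_find [::] hs).
have wsE : ws = take m ws ++ u :: drop m.+1 ws.
  by rewrite -{1}(cat_take_drop m ws) (drop_nth [::]) // -has_find.
pose u1 := take (index k u) u; pose u2 := drop (index k u).+1 u.
have uE : u = u1 ++ k :: u2.
  by rewrite -{1}(cat_take_drop (index k u) u) (drop_nth 0%N) ?index_mem // nth_index.
exists (take m ws ++ drop m.+1 ws); exists (u2 ++ u1).
  rewrite [in X in perm_eq _ X]wsE !flatten_cat /= uE.
  apply/seq.permP => a; rewrite /= !count_cat /=; lia.
move=> v; rewrite {1}wsE !big_cat big_cons /= mulrCA mulrC; congr (_ * _).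
rewrite uE /wprod !big_cat big_cons /=.
rewrite -[_ * (_ * _)]/(_ *m (_ *m _)) mxtrace_mulC -[_ * _]/(_ *m _) -mulmxA mxtrace_mulC.
exact: (etrans (congr1 mxtrace (mulmxA _ _ _)) (mxtrace_mulC _ _)).
Qed.

(** Words use natural numbers as letters. Letters from [k] on stand for [y], so that letter [k] can
    serve as one additional test matrix. *)
Definition vext {k} (v : 'I_k -> 'M[F]_n) (y : 'M[F]_n) (l : nat) : 'M[F]_n :=
  if insub l is Some r then v r else y.

Lemma vext_ord k (v : 'I_k -> 'M[F]_n) y (r : 'I_k) : vext v y r = v r.
Proof. by rewrite /vext insubT // => h; congr v; apply: val_inj. Qed.

Lemma vext_ge k (v : 'I_k -> 'M[F]_n) y l : (k <= l)%N -> vext v y l = y.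
Proof. by move=> h; rewrite /vext insubF // ltnNge h. Qed.

Lemma wprod_vext k (v : 'I_k -> 'M[F]_n) y u :
  all (fun l => l < k)%N u -> wprod (vext v y) u = wprod (vext v 0) u.
Proof.
move=> /allP h; rewrite /wprod big_seq [RHS]big_seq; apply: eq_bigr => l /h lk.
by rewrite /vext insubT.
Qed.

Lemma mxtrace_nondeg (A B : 'M[F]_n) : (forall y, \tr (A *m y) = \tr (B *m y)) -> A = B.
Proof.
move=> h; apply/matrixP => i j; have := h (delta_mx j i).
have tE (C : 'M[F]_n) : \tr (C *m delta_mx j i) = C i j.
  rewrite /mxtrace (bigD1 i) //= big1 ?addr0 => [|l nl]; rewrite mxE.
    rewrite (bigD1 j) //= big1 ?addr0 ?mxE ?eqxx ?mulr1 // => l nl.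
    by rewrite mxE (negPf nl) mulr0.
  by rewrite big1 // => l' _; rewrite mxE (negPf nl) andbF mulr0.
by rewrite !tE.
Qed.

Definition trmono {k} (p : seq (seq nat) * seq nat) (v : 'I_k -> 'M[F]_n) : 'M[F]_n :=
  (\prod_(u <- p.1) \tr (wprod (vext v 0) u)) *: wprod (vext v 0) p.2.

(** The function [\tr (f v *m y)] is a scalar invariant in one more variable, hence a combination of
    products of traces of words. Each product contains [y] once; rotating it to the end and using
    that the trace form is nondegenerate removes [y] and leaves a word outside the traces. *)
Theorem equivariant_span k (f : forms F n k) : [pchar F] =i pred0 ->
    multilinear F n f -> equivariant F n f ->
  exists s : seq (F * (seq (seq nat) * seq nat)),
    all (fun t => perm_eq (flatten t.2.1 ++ t.2.2) (iota 0 k)) s /\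
    forall v, f v = \sum_(t <- s) t.1 *: trmono t.2 v.
Proof.
move=> char0 lf ef.
pose W (v : 'I_k.+1 -> 'M[F]_n) (r : 'I_k) := v (widen_ord (leqnSn k) r).
pose G v : F^o := \tr (f (W v) *m v ord_max).
have updW v r y : W (upd F n v (widen_ord (leqnSn k) r) y) = upd F n (W v) r y.
  by apply: functional_extensionality => i; rewrite /W /upd -!(inj_eq val_inj).
have updM v y : W (upd F n v ord_max y) = W v.
  apply: functional_extensionality => i; rewrite /W /upd -!(inj_eq val_inj) /=.
  by rewrite (ltn_eqF (ltn_ord i)).
have lG : mlin F n G.
  move=> v r a y z; rewrite /G; have [rk|rk] := ltnP r k.
    have -> : r = widen_ord (leqnSn k) (Ordinal rk) by apply: val_inj.
    have um x : upd F n v (widen_ord (leqnSn k) (Ordinal rk)) x ord_max = v ord_max.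
      by rewrite /upd -(inj_eq val_inj) /= gtn_eqF.
    by rewrite !updW !um lf mulmxDl mxtraceD -scalemxAl mxtraceZ.
  have -> : r = ord_max by apply: val_inj; apply/eqP; rewrite eqn_leq rk /= -ltnS ltn_ord.
  have um x : upd F n v ord_max x ord_max = x by rewrite /upd eqxx.
  by rewrite !updM !um mulmxDr mxtraceD -scalemxAr mxtraceZ.
have iG g v : g \in unitmx -> G (fun r => g *m v r *m invmx g) = G v.
  move=> ug; rewrite /G [f _](ef g (W v)) // !mulmxA mulmxKV // mxtrace_mulC !mulmxA.
  by rewrite mulVmx // mul1mx.
have [a ha] := invariant_span _ char0 _ _ _ lG iG.
pose ws (s : 'S_k.+1) := ptrace_words _ s (fun r => [:: val r]).
have pws s : perm_eq (flatten (s2val (ws s))) (iota 0 k.+1).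
  by apply: perm_trans (s2valP (ws s)) _; rewrite flatten_map1 val_enum_ord.
have kws s : k \in flatten (s2val (ws s)) by rewrite (perm_mem (pws s)) mem_iota add0n /=.
pose rw s := word_rotate k _ (kws s).
pose us s := projT1 (rw s); pose u0 s := s2val (projT2 (rw s)).
have pu s : perm_eq (flatten (us s) ++ u0 s) (iota 0 k).
  have : perm_eq (k :: flatten (us s) ++ u0 s) (iota 0 k.+1).
    by apply: perm_trans (pws s); rewrite /us /u0; case: (projT2 (rw s)).
  by rewrite -[k.+1]addn1 iotaD /= add0n perm_sym perm_catC perm_sym perm_cons.
exists [seq (a s, (us s, u0 s)) | s <- enum {: 'S_k.+1}]; split.
  by apply/allP => t /mapP[s _ ->] /=.
move=> v; rewrite big_map ?big_enum /=; apply: mxtrace_nondeg => y.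
pose v' : 'I_k.+1 -> 'M[F]_n := fun r => vext v y r.
have -> : \tr (f v *m y) = G v'.
  rewrite /G /v' /= vext_ge //; congr (\tr (f _ *m _)).
  by apply: functional_extensionality => r; rewrite /W vext_ord.
rewrite ha mulmx_suml raddf_sum; apply: eq_bigr => s _ /=.
rewrite -scalemxAl mxtraceZ; congr (_ * _).
have -> : ptrace F n s v' = ptrace F n s (fun r => wprod (vext v y) [:: val r]).
  congr (ptrace _ _ s _); apply: functional_extensionality => r.
  by rewrite /wprod big_seq1.
have allk : all (fun l => l < k)%N (flatten (us s) ++ u0 s).
  by apply/allP => l; rewrite (perm_mem (pu s)) mem_iota.
rewrite /trmono /= -scalemxAl mxtraceZ.
have -> : ptrace F n s (fun r => wprod (vext v y) [:: val r]) =
   \prod_(u <- s2val (ws s)) \tr (wprod (vext v y) u) by case: (ws s).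
have -> : \prod_(u <- s2val (ws s)) \tr (wprod (vext v y) u) =
   (\prod_(u <- us s) \tr (wprod (vext v y) u)) * \tr (wprod (vext v y) (u0 s) *m vext v y k).
  by rewrite /us /u0; case: (projT2 (rw s)).
move: allk; rewrite all_cat => /andP[au a0].
rewrite vext_ge // wprod_vext //; congr (_ * _).
rewrite big_seq [RHS]big_seq; apply: eq_bigr => u uu; rewrite wprod_vext //.
by apply/allP => l lu; apply: (allP au); apply/flattenP; exists u.
Qed.

End TraceWords.

(** * Antisymmetric functions as matrices over the exterior algebra *)

Section Gamma.
Variables (F : fieldType) (n : nat).
Hypothesis char0 : [pchar F] =i pred0.

Local Notation T := ('I_n * 'I_n)%type.
(* The generator [ord0] is an extra odd parameter, independent of the matrix entries. *)
Local Notation Lam := (ext F (n * n).+1).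

Definition xidx (t : T) : 'I_(n * n).+1 := lift ord0 (mxvec_index t.1 t.2).
Definition xi (t : T) : Lam := gen F _ (xidx t).

Lemma xidx_inj : injective xidx.
Proof.
by move=> [a b] [c d] /lift_inj /cast_ord_inj /enum_rank_inj.
Qed.

Lemma xi_anti t u : xi t * xi u = - (xi u * xi t). Proof. exact: gen_anti. Qed.
Lemma xi_sq t : xi t * xi t = 0. Proof. exact: gen_sq. Qed.

Definition inL : 'M[F]_n -> 'M[Lam]_n := map_mx (in_alg Lam).
Definition eT (t : T) : 'M[F]_n := delta_mx t.1 t.2.

Lemma inL_mul (x y : Lam) A B : (x *: inL A) *m (y *: inL B) = (x * y) *: inL (A *m B).
Proof.
apply/matrixP => i j; rewrite !mxE rmorph_sum mulr_sumr /=; apply: eq_bigr => l _.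
by rewrite !mxE /= !mulr_algr -!scalerAl -!scalerAr scalerA.
Qed.

Lemma algM (c d : F) : c%:A * d%:A = (c * d)%:A :> Lam.
Proof. by rewrite mulr_algl scalerA. Qed.

Lemma mulmxZA (c : F) (A B : 'M[Lam]_n) : A *m (c%:A *: B) = c%:A *: (A *m B).
Proof.
apply/matrixP => i j; rewrite !mxE mulr_sumr; apply: eq_bigr => l _.
by rewrite mxE !mulr_algl scalerAr.
Qed.

Definition xip {k} (i : 'I_k -> T) : Lam := \prod_(l < k) xi (i l).

Lemma xip_enum k (i : 'I_k -> T) : xip i = \prod_(l <- enum 'I_k) xi (i l).
Proof. by rewrite enumT. Qed.

(** On both sides the first of the two letters is carried across the block between them, at the same
    sign; the exchange of the now adjacent letters gives the minus sign. *)
Lemma xip_tperm k (i : 'I_k -> T) x y : x != y -> xip (fun l => i (tperm x y l)) = - xip i.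
Proof.
move=> nxy; wlog lt : x y nxy / (x < y)%N => [H|].
  have [/H->//|le|e] := ltngtP x y; last by rewrite (val_inj e) eqxx in nxy.
  by rewrite tpermC H // eq_sym.
have [s1 [s2 [s3 eE]]] : exists s1 s2 s3, enum 'I_k = s1 ++ x :: s2 ++ y :: s3.
  pose e := enum 'I_k; have ix : index x e = x by rewrite index_enum_ord.
  exists (take x e), (take (y - x.+1) (drop x.+1 e)), (drop y.+1 e).
  rewrite -/e -{1}(cat_take_drop x e); congr (_ ++ _).
  rewrite (drop_nth x) ?size_enum_ord // nth_ord_enum; congr (_ :: _).
  rewrite -{1}(cat_take_drop (y - x.+1) (drop x.+1 e)); congr (_ ++ _).
  rewrite drop_drop subnK // (drop_nth y) ?size_enum_ord // nth_ord_enum //.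
have := enum_uniq 'I_k; rewrite eE cat_uniq /= cat_uniq /= mem_cat inE !negb_or.
case/and5P=> _ /andP[x1 h1] /and3P[x2 _ x3] _ /andP[/andP[y2 _] /andP[y3 _]].
have y1 : y \notin s1 by move: h1; rewrite has_cat negb_or /= negb_or => /and3P[].
have fixE (s : seq 'I_k) : x \notin s -> y \notin s ->
    \prod_(l <- s) xi (i (tperm x y l)) = \prod_(l <- s) xi (i l).
  move=> hx hy; rewrite big_seq [RHS]big_seq; apply: eq_bigr => l ls; rewrite tpermD //.
    by apply: contraNneq hx => ->.
  by apply: contraNneq hy => ->.
rewrite !xip_enum eE !big_cat !big_cons !big_cat !big_cons /= tpermL tpermR.
rewrite !fixE //.
have a2 t := anti_prodC _ _ xi xi_anti t [seq i l | l <- s2].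
rewrite !big_map in a2; rewrite -[RHS]mulrN; congr (_ * _).
rewrite !mulrA (a2 (i y)) (a2 (i x)) -!mulrA -mulrN; congr (_ * _); rewrite -mulrN; congr (_ * _).
by rewrite !mulrA xi_anti mulNr.
Qed.

Lemma xip_perm k (i : 'I_k -> T) (s : 'S_k) : xip (fun l => i (s l)) = (-1) ^+ s * xip i.
Proof.
have [ts -> dts] := prod_tpermP s; elim: ts dts => [|t ts IH] /=.
  move=> _; rewrite big_nil odd_perm1 mul1r; congr xip.
  by apply: functional_extensionality => l; rewrite perm1.
case/andP=> dt /IH {}IH; rewrite big_cons odd_mul_tperm dt signr_addb expr1 mulN1r mulNr -IH.
rewrite -(xip_tperm _ _ _ _ dt); congr xip.
by apply: functional_extensionality => l; rewrite permM.
Qed.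

Lemma xip_seq k (i : 'I_k -> T) : xip i = \prod_(t <- [seq i l | l <- enum 'I_k]) xi t.
Proof. by rewrite big_map -xip_enum. Qed.

Lemma xip_big k (i : 'I_k -> T) : (n * n < k)%N -> xip i = 0.
Proof.
move=> lt; rewrite xip_seq (anti_prod_dup _ _ _ xi_anti xi_sq) //.
apply: contraL lt => /card_uniqP; rewrite size_map size_enum_ord -leqNgt => <-.
by apply: leq_trans (max_card _) _; rewrite card_prod !card_ord.
Qed.

Definition Sk k (f : forms F n k) : 'M[Lam]_n :=
  \sum_(i : {ffun 'I_k -> T}) xip i *: inL (f (fun l => eT (i l))).

Lemma Sk_ext k (f g : forms F n k) : (forall v, f v = g v) -> Sk k f = Sk k g.
Proof. by move=> e; apply: eq_bigr => i _; rewrite e. Qed.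

Lemma SkZ k c (f : forms F n k) : Sk k (fun v => c *: f v) = c%:A *: Sk k f.
Proof.
rewrite /Sk scaler_sumr; apply: eq_bigr => i _; rewrite /inL map_mxZ /= !scalerA.
by congr (_ *: _); rewrite mulr_algl mulr_algr.
Qed.

Lemma Sk_sum k (I : Type) (r : seq I) (P : pred I) (f : I -> forms F n k) :
  Sk k (fun v => \sum_(j <- r | P j) f j v) = \sum_(j <- r | P j) Sk k (f j).
Proof.
rewrite /Sk exchange_big /=; apply: eq_bigr => i _.
by rewrite /inL raddf_sum /= scaler_sumr.
Qed.

(** No antisymmetry of [f] is assumed: the sign comes from the product of the generators after
    reindexing. Thus [Sk] sees only the antisymmetric part of [f], and can be evaluated on words
    before any antisymmetrization. *)
Lemma Sk_perm k (f : forms F n k) (s : 'S_k) :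
  Sk k (fun v => f (fun l => v (s l))) = (-1) ^+ s *: Sk k f.
Proof.
rewrite /Sk [in RHS](reindex_inj (h := fun i : {ffun 'I_k -> T} => [ffun l => i (s l)])) /=.
  rewrite scaler_sumr; apply: eq_bigr => i _; rewrite scalerA; congr (_ *: _).
    have -> : xip [ffun l => i (s l)] = (-1) ^+ s * xip i.
      rewrite -xip_perm; apply: eq_bigr => l _; by rewrite ffunE.
    by rewrite mulrA -signr_addb addbb mul1r.
  by congr (inL (f _)); apply: functional_extensionality => l; rewrite ffunE.
move=> i j e; apply/ffunP => l; have /ffunP/(_ (s^-1 l)%g) := e.
by rewrite !ffunE permKV.
Qed.

Lemma Sk_cat a b (f : forms F n a) (h : forms F n b) :
  Sk (a + b) (fun v => f (fun l => v (lshift b l)) *m h (fun l => v (rshift a l))) =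
  Sk a f *m Sk b h.
Proof.
rewrite /Sk mulmx_suml; under [RHS]eq_bigr do rewrite mulmx_sumr.
rewrite pair_bigA /=.
pose J (p : {ffun 'I_a -> T} * {ffun 'I_b -> T}) : {ffun 'I_(a + b) -> T} :=
  [ffun l => match fintype.split l with inl i => p.1 i | inr j => p.2 j end].
have Jl p l : J p (lshift b l) = p.1 l.
  by rewrite ffunE -[lshift b l]/(unsplit (inl l)) unsplitK.
have Jr p l : J p (rshift a l) = p.2 l.
  by rewrite ffunE -[rshift a l]/(unsplit (inr l)) unsplitK.
rewrite (reindex J) /=; last first.
  exists (fun i => ([ffun l => i (lshift b l)], [ffun l => i (rshift a l)])) => [[p q]|i] _ /=.
    by congr (_, _); apply/ffunP => l; rewrite ffunE ?Jl ?Jr.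
  apply/ffunP => l; rewrite ffunE -[in RHS](splitK l).
  by case: (fintype.split l) => l' /=; rewrite ffunE.
apply: eq_bigr => p _; rewrite inL_mul.
have -> : xip (J p) = xip p.1 * xip p.2.
  by rewrite /xip big_split_ord /=; congr (_ * _); apply: eq_bigr => l _; rewrite ?Jl ?Jr.
congr (_ *: inL _).
have -> : (fun l => eT (J p (lshift b l))) = (fun l => eT (p.1 l)).
  by apply: functional_extensionality => l; rewrite Jl.
have -> // : (fun l => eT (J p (rshift a l))) = (fun l => eT (p.2 l)).
by apply: functional_extensionality => l; rewrite Jr.
Qed.

Definition Gk k (f : forms F n k) : 'M[Lam]_n := (k`!%:R^-1)%:A *: Sk k f.

Lemma inv_fact_mul k : (k`!%:R^-1)%:A * (k`!%:R)%:A = 1 :> Lam.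
Proof. by rewrite algM mulVf ?fact_neq0 // scale1r. Qed.

Lemma Sk_alt k (f : forms F n k) :
  Sk k (fun v => \sum_(s : 'S_k) (-1) ^+ s *: f (fun l => v (s l))) = (k`!%:R)%:A *: Sk k f.
Proof.
rewrite Sk_sum (eq_bigr (fun=> Sk k f)) => [|s _].
  by rewrite sumr_const card_Sn !scaler_nat.
rewrite (SkZ _ _ (fun v => f (fun l => v (s l)))) Sk_perm scalerA mulr_algl.
case: (odd_perm s) => /=; last by rewrite !expr0 !scale1r.
by rewrite !expr1 scaleN1r opprK scale1r.
Qed.

(** The normalization [1/k!] is chosen for this: antisymmetrizing over [S_(a+b)] produces [(a+b)!],
    which cancels, and the remaining [1/(a! b!)] is shared by the two factors. *)
Lemma Gk_wedgeab a b (f : forms F n a) (h : forms F n b) :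
  Gk (a + b) (wedgeab F n f h) = Gk a f *m Gk b h.
Proof.
rewrite /Gk /wedgeab SkZ.
rewrite (Sk_alt _ (fun v => f (fun l => v (lshift b l)) *m h (fun l => v (rshift a l)))).
rewrite Sk_cat mulmxZA -scalemxAl !scalerA; congr (_ *: _).
rewrite !algM; congr (_%:A).
by rewrite mulrAC mulVf ?fact_neq0 // mul1r mulrC.
Qed.

Lemma Gk_cast k m (e : k = m) (f : forms F n k) :
  Gk m (fun v => f (fun l => v (cast_ord e l))) = Gk k f.
Proof.
case: m / e; congr (_ *: _); apply: Sk_ext => v; congr f.
by apply: functional_extensionality => l; rewrite cast_ord_id.
Qed.

Lemma Gk_big k (f : forms F n k) : (n * n < k)%N -> Gk k f = 0.
Proof.
by move=> lt; rewrite /Gk /Sk big1 ?scaler0 // => i _; rewrite xip_big // scale0r.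
Qed.

Lemma Gk_sum k (I : Type) (r : seq I) (P : pred I) (f : I -> forms F n k) :
  Gk k (fun v => \sum_(j <- r | P j) f j v) = \sum_(j <- r | P j) Gk k (f j).
Proof. by rewrite /Gk Sk_sum scaler_sumr. Qed.

Lemma GkZ k c (f : forms F n k) : Gk k (fun v => c *: f v) = c%:A *: Gk k f.
Proof. by rewrite /Gk SkZ !scalerA; congr (_ *: _); rewrite !algM mulrC. Qed.

(** The sum stops at [n * n] because [Gk] vanishes beyond that degree, there being only [n * n]
    generators [xi t]. *)
Definition Gam (x : E F n) : 'M[Lam]_n := \sum_(k < (n * n).+1) Gk k (x k).

Lemma Gam_wide D (x : E F n) : (n * n < D)%N -> Gam x = \sum_(k < D) Gk k (x k).
Proof.
move=> lt; rewrite /Gam (big_ord_widen _ (fun k => Gk k (x k)) lt) big_mkcond /=.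
by apply: eq_bigr => k _; case: ltnP => // h; rewrite Gk_big.
Qed.

(** The Cauchy product of two graded sums. The truncations of the two sides differ only by terms of
    degree above [n * n], which are zero. *)
Lemma GamM (x y : E F n) : Gam (wedge F n x y) = Gam x *m Gam y.
Proof.
rewrite {1}/Gam.
have e m : Gk m (wedge F n x y m) = \sum_(a < (n * n).+1 | (a <= m)%N) Gk a (x a) *m Gk (m - a) (y (m - a)%N).
  rewrite /wedge (Gk_sum _ _ _ _
    (fun a : 'I_m.+1 => fun v => wedgeab F n (x a) (y (m - a)%N) (fun i => v (cast_ord (le_ord a) i)))).
  rewrite (eq_bigr (fun a : 'I_m.+1 => Gk a (x a) *m Gk (m - a) (y (m - a)%N))); last first.
    by move=> a _; rewrite Gk_cast Gk_wedgeab.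
  pose H a := Gk a (x a) *m Gk (m - a) (y (m - a)%N).
  rewrite -(big_mkord xpredT H) -(big_mkord (fun a => a <= m)%N H).
  rewrite big_nat_cond [RHS]big_nat_cond.
  case: (leqP m (n * n)) => le.
    rewrite [RHS](big_cat_nat (n := m.+1)) //= [X in _ + X]big1_seq ?addr0.
      by apply: eq_bigl => a; apply/idP/idP; lia.
    move=> a /andP[/andP[_ am]]; rewrite mem_index_iota => /andP[h _].
    by rewrite leqNgt h in am.
  have le' : ((n * n).+1 <= m.+1)%N by lia.
  rewrite [LHS](big_cat_nat (n := (n * n).+1)) //= [X in _ + X]big1_seq ?addr0.
    rewrite big_nat_cond [RHS]big_nat_cond.
    by apply: eq_bigl => a; apply/idP/idP; lia.
  move=> a /andP[_]; rewrite mem_index_iota => /andP[h _].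
  by rewrite /H Gk_big // mul0mx.
under eq_bigr => m _ do rewrite e.
rewrite (exchange_big_dep predT) //= {1}/Gam mulmx_suml; apply: eq_bigr => a _.
rewrite (Gam_wide ((n * n).+1 - a + a)); last by have := ltn_ord a; lia.
rewrite mulmx_sumr big_split_ord /= [X in _ + X]big1 ?addr0.
  pose H m := Gk a (x a) *m Gk (m - a) (y (m - a)%N).
  rewrite -(big_mkord (fun m => a <= m)%N H).
  rewrite (big_cat_nat (n := a)) //=; last by rewrite ltnW.
  rewrite [X in X + _]big_nat_cond [X in X + _]big1 ?add0r; last first.
    by move=> m /andP[/andP[_ h1] h2]; rewrite leqNgt h1 in h2.
  rewrite -{1}[a : nat]add0n big_addn big_mkord.
  apply: eq_big => [m|m _]; first by rewrite leq_addl.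
  by rewrite /H addnK.
move=> b _; have lt : (n * n < a + ((n * n).+1 - a + b))%N by have := ltn_ord a; lia.
by rewrite -Gk_wedgeab Gk_big.
Qed.

Lemma Gk_eq0 k (f : forms F n k) : (forall v, f v = 0) -> Gk k f = 0.
Proof.
by move=> f0; rewrite /Gk /Sk big1 ?scaler0 // => i _; rewrite f0 /inL map_mx0 scaler0.
Qed.

Lemma Gam_single k (x : E F n) : (forall k', k' != k -> forall v, x k' v = 0) -> Gam x = Gk k (x k).
Proof.
move=> h; rewrite (Gam_wide (n * n + k).+1); last by rewrite ltnS leq_addr.
have lt : (k < (n * n + k).+1)%N by rewrite ltnS leq_addl.
rewrite (bigD1 (Ordinal lt)) //= big1 ?addr0 // => i ni.
by apply: Gk_eq0; apply: h; rewrite -(inj_eq val_inj) in ni.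
Qed.

Definition Xi : 'M[Lam]_n := \matrix_(p, q) xi (p, q).

Lemma inL1 : inL 1 = 1.
Proof. by rewrite /inL -[1]/(1%:M) map_scalar_mx rmorph1. Qed.

Lemma XiE : Xi = \sum_t xi t *: inL (eT t).
Proof.
apply/matrixP => p q; rewrite summxE (bigD1 (p, q)) //= big1 ?addr0 => [|[a b] /=].
  by rewrite !mxE !eqxx /= scale1r mulr1.
rewrite xpair_eqE => h; rewrite !mxE /= [p == a]eq_sym [q == b]eq_sym (negPf h).
by rewrite scale0r mulr0.
Qed.

Lemma inL_prod (I : Type) (r : seq I) (x : I -> Lam) (A : I -> 'M[F]_n) :
  \prod_(l <- r) (x l *: inL (A l)) = (\prod_(l <- r) x l) *: inL (\prod_(l <- r) A l).
Proof.
elim: r => [|l r IH]; first by rewrite !big_nil scale1r inL1.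
by rewrite !big_cons IH -[_ * _]/(_ *m _) inL_mul.
Qed.

Lemma Sk_prod k : Sk k (fun v => \prod_(l < k) v l) = Xi ^+ k.
Proof.
have -> : Xi ^+ k = \prod_(l < k) Xi by rewrite prodr_const card_ord.
rewrite XiE bigA_distr_bigA /=; apply: eq_bigr => i _.
by rewrite inL_prod.
Qed.

Lemma foldr_mulmx (I : Type) (r : seq I) (w : I -> 'M[F]_n) :
  foldr (fun i acc => w i *m acc) 1%:M r = \prod_(i <- r) w i.
Proof. by elim: r => [|i r IH]; rewrite ?big_nil ?big_cons //= IH. Qed.

Lemma stdpolyE k (v : 'I_k -> 'M[F]_n) :
  stdpoly F n v = \sum_(s : 'S_k) (-1) ^+ s *: \prod_(l < k) v (s l).
Proof.
by rewrite /stdpoly; apply: eq_bigr => s _; rewrite (foldr_mulmx _ _ (fun i => v (s i))) enumT.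
Qed.

Lemma Sk_tr k (f : forms F n k) : Sk k (fun v => (\tr (f v))%:M) = (\tr (Sk k f))%:M.
Proof.
rewrite /Sk [\tr (\sum_i _)]raddf_sum [(\sum_i _)%:M]raddf_sum; apply: eq_bigr => i _ /=.
rewrite mxtraceZ -scale_scalar_mx; congr (_ *: _).
by rewrite /inL map_scalar_mx trace_map_mx.
Qed.

Definition Tr h : Lam := \tr (Xi ^+ (2 * h + 1)).

Lemma Gam_Te h : Gam (Te F n h) = (Tr h)%:M.
Proof.
rewrite (Gam_single (2 * h + 1)) => [|k nk v]; last by rewrite /Te (negPf nk).
rewrite /Gk (Sk_ext _ _ (fun v => (\tr (stdpoly F n v))%:M)) => [|v]; last by rewrite /Te eqxx.
rewrite Sk_tr (Sk_ext _ _ _ (stdpolyE _)).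
rewrite (Sk_alt _ (fun v => \prod_(l < 2 * h + 1) v l)) Sk_prod mxtraceZ -scale_scalar_mx scalerA.
by rewrite inv_fact_mul scale1r.
Qed.

Lemma Gam_one : Gam (oneE F n) = 1.
Proof.
rewrite (Gam_single 0) => [|k nk v]; last by rewrite /oneE (negPf nk).
rewrite /Gk /Sk (big_ffun_ord0 _ _ _ (ffun0 (card_ord 0))) /xip big_ord0 scale1r.
by rewrite -[X in _ *: X]/(inL 1) inL1 invr1 !scale1r.
Qed.

Lemma Gam_X : Gam (Xe F n) = Xi.
Proof.
rewrite (Gam_single 1) => [|[|[|k]] // nk v].
rewrite /Gk invr1 !scale1r -[RHS]expr1 -Sk_prod.
by apply: Sk_ext => v; rewrite big_ord1.
Qed.

Lemma Gam_Xpow i : Gam (Xpow F n i) = Xi ^+ i.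
Proof.
elim: i => [|i IH]; first exact: Gam_one.
by rewrite /Xpow iterS GamM Gam_X -/(Xpow F n i) IH exprS.
Qed.

Definition altE (x : E F n) : Prop :=
  forall k, multilinear F n (x k) /\ Defs.antisymmetric F n (x k).

Definition xset {k} (j : 'I_k -> T) : {set 'I_(n * n).+1} :=
  [set i in [seq xidx (j l) | l <- enum 'I_k]].

Lemma xip_inj k (j : 'I_k -> T) : injective j ->
  exists b : nat, xip j = (-1) ^+ b * ebas F _ (xset j).
Proof.
move=> ij; have u : uniq [seq xidx (j l) | l <- enum 'I_k].
  by rewrite map_inj_uniq ?enum_uniq // => a b /xidx_inj/ij.
have [b eb] := gen_prod F _ _ u; exists b.
by rewrite -eb big_map xip_enum.
Qed.

Lemma xip_ninj k (j : 'I_k -> T) : ~~ injectiveb j -> xip j = 0.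
Proof.
move=> nj; rewrite xip_seq (anti_prod_dup _ _ _ xi_anti xi_sq) //.
Qed.

Lemma sign_ext (b : nat) (x : Lam) A : ((-1) ^+ b * x) A = (-1) ^+ b * x A.
Proof. by rewrite -signr_odd mulr_sign -[in RHS]signr_odd mulr_sign; case: odd; rewrite ?ffunE. Qed.

Lemma xip_coef k k' (i : 'I_k -> T) (j : 'I_k' -> T) : xip i (xset j) != 0 ->
  injective i /\ xset i = xset j.
Proof.
have [/injectiveP ii|/xip_ninj->] := boolP (injectiveb i); last by rewrite ffunE eqxx.
have [b ->] := xip_inj _ _ ii; rewrite sign_ext ffunE.
by case: (xset j =P xset i) => [->//|_]; rewrite mulr0 eqxx.
Qed.

Lemma card_xset k (j : 'I_k -> T) : injective j -> #|xset j| = k.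
Proof.
move=> ij; rewrite cardsE; have /card_uniqP-> : uniq [seq xidx (j l) | l <- enum 'I_k].
  by rewrite map_inj_uniq ?enum_uniq // => a b /xidx_inj/ij.
by rewrite size_map size_enum_ord.
Qed.

Lemma xset_perm k (i j : 'I_k -> T) : injective i -> injective j -> xset i = xset j ->
  exists s : 'S_k, forall l, i l = j (s l).
Proof.
move=> ii ij e.
have h l : exists l', i l == j l'.
  have : xidx (i l) \in xset j by rewrite -e inE; apply/mapP; exists l; rewrite ?mem_enum.
  by rewrite inE => /mapP[l' _ /xidx_inj->]; exists l'.
pose t l := xchoose (h l); have tE l : i l = j (t l) by apply/eqP/(xchooseP (h l)).
have ti : injective t by move=> a b e'; apply: ii; rewrite !tE e'.
by exists (perm ti) => l; rewrite permE.
Qed.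

Definition coefM (A : {set 'I_(n * n).+1}) (M : 'M[Lam]_n) : 'M[F]_n := map_mx (fun x : Lam => x A) M.

Lemma coefM_sum A (I : Type) (r : seq I) (P : pred I) (M : I -> 'M[Lam]_n) :
  coefM A (\sum_(i <- r | P i) M i) = \sum_(i <- r | P i) coefM A (M i).
Proof.
apply/matrixP => p q; rewrite mxE !summxE sum_ffunE.
by apply: eq_bigr => i _; rewrite mxE.
Qed.

Lemma coefMZ A c M : coefM A (c%:A *: M) = c *: coefM A M.
Proof. by apply/matrixP => p q; rewrite !mxE mulr_algl ffunE. Qed.

Lemma coefM_inL A x B : coefM A (x *: inL B) = x A *: B.
Proof. by apply/matrixP => p q; rewrite !mxE mulr_algr ffunE mulrC. Qed.

(** The multi-indices with the same support as [j] are its [k!] rearrangements. All contribute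
    equally, the sign of [f] cancelling that of [xip], and the normalization [1/k!] leaves one
    copy. *)
Lemma coefM_Gk k (f : forms F n k) (j : 'I_k -> T) : Defs.antisymmetric F n f -> injective j ->
  coefM (xset j) (Gk k f) = xip j (xset j) *: f (fun l => eT (j l)).
Proof.
move=> af ij; rewrite /Gk coefMZ /Sk coefM_sum.
under eq_bigr => i _ do rewrite coefM_inL.
pose Q := [set [ffun l => j (s l)] | s : 'S_k].
rewrite (bigID (mem Q)) /= [X in _ + X]big1 ?addr0 => [|i niQ]; last first.
  apply/eqP; rewrite scaler_eq0; apply/orP; left; apply: contraNT niQ => /xip_coef[ii e].
  have [s hs] := xset_perm _ _ _ ii ij e; apply/imsetP; exists s => //.
  by apply/ffunP => l; rewrite ffunE hs.
rewrite big_imset /=; last first.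
  move=> s t _ _ /ffunP e; apply/permP => l; have := e l; rewrite !ffunE; exact: ij.
rewrite (eq_bigr (fun=> xip j (xset j) *: f (fun l => eT (j l)))) => [|s _].
  set y := (_ *: f _); rewrite sumr_const card_Sn -scaler_nat.
  by rewrite (scalerA _ _ y) mulVf ?scale1r ?fact_neq0.
have -> : xip [ffun l => j (s l)] = (-1) ^+ s * xip j.
  by rewrite -xip_perm; apply: eq_bigr => l _; rewrite ffunE.
have -> : (fun l => eT ([ffun l => j (s l)] l)) = (fun l => eT (j (s l))).
  by apply: functional_extensionality => l; rewrite ffunE.
rewrite (af s (fun l => eT (j l))) sign_ext scalerA; congr (_ *: _).
by rewrite mulrAC -signr_addb addbb mul1r.
Qed.

Lemma alt_ninj k (f : forms F n k) (j : 'I_k -> T) : Defs.antisymmetric F n f -> ~~ injectiveb j ->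
  f (fun l => eT (j l)) = 0.
Proof.
move=> af /injectivePn[a [b nab eab]].
have := af (tperm a b) (fun l => eT (j l)); rewrite odd_tperm nab expr1 scaleN1r.
have -> : (fun l => eT (j (tperm a b l))) = (fun l => eT (j l)).
  by apply: functional_extensionality => l; case: tpermP => // ->; rewrite eab.
move=> e; apply/matrixP => p q; rewrite [RHS]mxE; apply: opp_eq0 => //.
by rewrite {1}e mxE.
Qed.

(** The coefficient at [xset j] recovers, up to sign, the value on the matrix units listed by [j];
    other degrees do not interfere, since their supports have another cardinality. Repeated matrix
    units give zero by antisymmetry, and multilinearity gives the remaining arguments. *)
Theorem Gam_inj (x : E F n) : altE x -> Gam x = 0 -> x = zeroE F n.
Proof.
move=> ax Gx; apply: functional_extensionality_dep => k.
have [lx anx] := ax k.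
have x0 (j : 'I_k -> T) : x k (fun l => eT (j l)) = 0.
  have [ij|nj] := boolP (injectiveb j); last exact: alt_ninj.
  have {}ij := injectiveP _ ij.
  have := congr1 (coefM (xset j)) Gx; rewrite (Gam_wide (n * n + k).+1) ?ltnS ?leq_addr //.
  rewrite coefM_sum; have lt : (k < (n * n + k).+1)%N by rewrite ltnS leq_addl.
  rewrite (bigD1 (Ordinal lt)) //= big1 ?addr0 => [|k' nk].
    rewrite coefM_Gk // => /eqP; rewrite /coefM.
    have -> : map_mx (fun y : Lam => y (xset j)) (0 : 'M[Lam]_n) = 0.
      by apply/matrixP => p q; rewrite !mxE ffunE.
    rewrite scaler_eq0 => /orP[|/eqP//].
    have [b ->] := xip_inj _ _ ij; rewrite sign_ext ffunE eqxx mulr1.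
    by rewrite signr_eq0.
  rewrite /Gk coefMZ /Sk coefM_sum big1 ?scaler0 // => i _; rewrite coefM_inL.
  apply/eqP; rewrite scaler_eq0; apply/orP; left; apply: contraNT nk => /xip_coef[ii e].
  by rewrite -(inj_eq val_inj) /= -(card_xset _ _ ii) e card_xset.
apply: functional_extensionality => v.
have -> : v = (fun r => \sum_(t : T) v r t.1 t.2 *: eT t).
  apply: functional_extensionality => r; rewrite {1}[v r]matrix_sum_delta.
  by rewrite (pair_bigA _ (fun i j => v r i j *: delta_mx i j)).
rewrite (mlin_expand _ _ _ _ (x k) _ (fun r t => v r t.1 t.2) (fun _ t => eT t)) //.
by rewrite big1 // => i _; rewrite x0 scaler0.
Qed.

End Gamma.

(** * Closure properties of the algebra of equivariant antisymmetric functions *)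

Section Closure.
Variables (F : fieldType) (n : nat).

Definition goodf {k} (f : forms F n k) : Prop :=
  [/\ multilinear F n f, Defs.antisymmetric F n f & equivariant F n f].

Lemma goodf0 k : @goodf k (fun _ => 0).
Proof.
split=> [v i a y z|s v|g v _]; first by rewrite scaler0 addr0.
  by rewrite scaler0.
by rewrite mulmx0 mul0mx.
Qed.

Lemma goodfD k (f h : forms F n k) : goodf f -> goodf h -> goodf (fun v => f v + h v).
Proof.
case=> lf af ef [lh ah eh]; split=> [v i a y z|s v|g v ug].
- by rewrite lf lh scalerDr addrACA.
- by rewrite af ah scalerDr.
- by rewrite ef // eh // mulmxDr mulmxDl.
Qed.

Lemma goodfZ k c (f : forms F n k) : goodf f -> goodf (fun v => c *: f v).
Proof.
case=> lf af ef; split=> [v i a y z|s v|g v ug].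
- by rewrite lf scalerDr !scalerA mulrC.
- by rewrite af !scalerA mulrC.
- by rewrite ef // -scalemxAr -scalemxAl.
Qed.

Lemma goodf_ext k (f h : forms F n k) : (forall v, f v = h v) -> goodf f -> goodf h.
Proof. by move=> e; have -> : f = h by apply: functional_extensionality. Qed.

Lemma goodf_sum k (I : Type) (r : seq I) (f : I -> forms F n k) :
  (forall i, goodf (f i)) -> goodf (fun v => \sum_(i <- r) f i v).
Proof.
move=> h; elim: r => [|i r IH].
  by apply: goodf_ext (goodf0 k) => v; rewrite big_nil.
by apply: goodf_ext (goodfD _ _ _ (h i) IH) => v; rewrite big_cons.
Qed.

Lemma goodf_cast k m (e : k = m) (f : forms F n k) :
  goodf f -> goodf (fun v => f (fun l => v (cast_ord e l))).
Proof.
case: m / e => gf; apply: goodf_ext gf => v; congr f.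
by apply: functional_extensionality => l; rewrite cast_ord_id.
Qed.

Lemma goodf_wedgeab a b (f : forms F n a) (h : forms F n b) :
  goodf f -> goodf h -> goodf (wedgeab F n f h).
Proof.
case=> lf af ef [lh ah eh]; apply: goodfZ; split=> [v i c y z|s v|g v ug].
- rewrite scaler_sumr -big_split /=; apply: eq_bigr => s _.
  have updl w l0 : i = s (lshift b l0) ->
      (fun l => upd F n v i w (s (lshift b l))) = upd F n (fun l => v (s (lshift b l))) l0 w.
    move=> ->; apply: functional_extensionality => l.
    by rewrite /upd (inj_eq perm_inj) (inj_eq (@lshift_inj _ _)).
  have updl' w l0 : i = s (rshift a l0) ->
      (fun l => upd F n v i w (s (lshift b l))) = (fun l => v (s (lshift b l))).
    move=> ->; apply: functional_extensionality => l.
    by rewrite /upd (inj_eq perm_inj) eq_lrshift.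
  have updr w l0 : i = s (rshift a l0) ->
      (fun l => upd F n v i w (s (rshift a l))) = upd F n (fun l => v (s (rshift a l))) l0 w.
    move=> ->; apply: functional_extensionality => l.
    by rewrite /upd (inj_eq perm_inj) (inj_eq (@rshift_inj _ _)).
  have updr' w l0 : i = s (lshift b l0) ->
      (fun l => upd F n v i w (s (rshift a l))) = (fun l => v (s (rshift a l))).
    move=> ->; apply: functional_extensionality => l.
    by rewrite /upd (inj_eq perm_inj) eq_rlshift.
  (* The slot receiving the argument [i] belongs to exactly one of the two factors, and the other
     factor is unchanged. *)
  case: (split_ordP (s^-1 i)%g) => l0 e; have {}e := canRL (permKV s) e.
    by rewrite !(updl _ _ e) !(updr' _ _ e) lf mulmxDl scalerDr -scalemxAl !scalerA mulrC.
  by rewrite !(updl' _ _ e) !(updr _ _ e) lh mulmxDr scalerDr -scalemxAr !scalerA mulrC.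
- rewrite [in RHS](reindex_inj (mulIg s)) scaler_sumr /=; apply: eq_bigr => t _.
  rewrite scalerA odd_permM signr_addb mulrCA -signr_addb addbb mulr1; congr (_ *: (_ *m _)).
    by congr f; apply: functional_extensionality => l; rewrite permM.
  by congr h; apply: functional_extensionality => l; rewrite permM.
- rewrite mulmx_sumr mulmx_suml; apply: eq_bigr => s _.
  rewrite (ef g (fun i => v (s (lshift b i)))) // (eh g (fun i => v (s (rshift a i)))) //.
  by rewrite -scalemxAr -scalemxAl; congr (_ *: _); rewrite !mulmxA mulmxKV.
Qed.

Lemma InA_wedge x y : InA F n x -> InA F n y -> InA F n (wedge F n x y).
Proof.
move=> hx hy m; apply: (@goodf_sum m _ _ (fun (a : 'I_m.+1) v =>
  wedgeab F n (x a) (y (m - a)%N) (fun i => v (cast_ord (le_ord a) i)))) => a.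
exact/goodf_cast/goodf_wedgeab.
Qed.

Lemma InA_sum (I : Type) (r : seq I) (x : I -> E F n) : (forall i, InA F n (x i)) ->
  InA F n (fun k v => \sum_(i <- r) x i k v).
Proof. by move=> h k; apply: goodf_sum => i; apply: h. Qed.

Lemma InA_scale c (x : E F n) : InA F n x -> InA F n (fun k v => c *: x k v).
Proof. by move=> h k; apply/goodfZ/h. Qed.

Lemma InA_one : InA F n (oneE F n).
Proof.
case=> [|k]; last exact: goodf0.
split=> [v []//|s v|g v ug].
  by rewrite (_ : s = 1%g) ?odd_perm1 ?scale1r //; apply/permP => -[].
by rewrite /oneE /= mulmx1 mulmxV.
Qed.

Lemma InA_X : InA F n (Xe F n).
Proof.
case=> [|[|k]]; [exact: goodf0 | split=> [v i a y z|s v|g v ug] | exact: goodf0].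
- by rewrite /Xe /upd (ord1 i) eqxx.
- rewrite (_ : s = 1%g) ?odd_perm1 ?scale1r /Xe ?perm1 //.
  by apply/permP => i; rewrite perm1 !ord1.
- by [].
Qed.

Lemma prod_upd k (r : seq 'I_k) (v : 'I_k -> 'M[F]_n) i a y z : uniq r -> i \in r ->
  \prod_(l <- r) upd F n v i (a *: y + z) l =
  a *: \prod_(l <- r) upd F n v i y l + \prod_(l <- r) upd F n v i z l.
Proof.
elim: r => [//|j r IH] /= /andP[njr ur]; rewrite inE !big_cons.
have [e' _|nij /= ir] := eqVneq i j; last first.
  rewrite IH // /upd [j == i]eq_sym (negPf nij) mulrDr; congr (_ + _).
  by rewrite -[LHS]/(_ *m (_ *: _)) -scalemxAr.
rewrite -{}e' in njr *.
have e w : \prod_(l <- r) upd F n v i w l = \prod_(l <- r) v l.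
  rewrite big_seq [RHS]big_seq; apply: eq_bigr => l lr; rewrite /upd.
  by case: eqP lr => // ->; rewrite (negPf njr).
have u w : upd F n v i w i = w by rewrite /upd eqxx.
by rewrite !e !u mulrDl; congr (_ + _); rewrite -[LHS]/((_ *: _) *m _) -scalemxAl.
Qed.

Lemma goodf_stdpoly k : @goodf k (fun v => (\tr (stdpoly F n v))%:M).
Proof.
split=> [v i a y z|s v|g v ug].
- rewrite !stdpolyE scale_scalar_mx -raddfD -mxtraceZ -mxtraceD; congr (\tr _)%:M.
  rewrite scaler_sumr -big_split /=; apply: eq_bigr => s _.
  have updE w : \prod_(l < k) upd F n v i w (s l) =
      \prod_(l < k) upd F n (fun l => v (s l)) (s^-1 i)%g w l.
    by apply: eq_bigr => l _; rewrite /upd -(inj_eq (@perm_inj _ s) l) permKV.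
  rewrite !updE prod_upd ?index_enum_uniq ?mem_index_enum //.
  by rewrite scalerDr !scalerA mulrC.
- rewrite !stdpolyE scale_scalar_mx -mxtraceZ; congr (\tr _)%:M.
  rewrite [in RHS](reindex_inj (mulIg s)) scaler_sumr /=; apply: eq_bigr => t _.
  rewrite scalerA odd_permM signr_addb mulrCA -signr_addb addbb mulr1; congr (_ *: _).
  by apply: eq_bigr => l _; rewrite permM.
- rewrite !stdpolyE mul_mx_scalar -scalemxAl mulmxV // scalemx1.
  have -> : \sum_(s : 'S_k) (-1) ^+ s *: \prod_(l < k) (g *m v (s l) *m invmx g) =
     g *m (\sum_(s : 'S_k) (-1) ^+ s *: \prod_(l < k) v (s l)) *m invmx g.
    rewrite mulmx_sumr mulmx_suml; apply: eq_bigr => s _.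
    rewrite -scalemxAr -scalemxAl; congr (_ *: _).
    elim: (index_enum _) => [|l r IH]; first by rewrite !big_nil mulmx1 mulmxV.
    by rewrite !big_cons IH -![_ * _]/(_ *m _) !mulmxA mulmxKV.
  by rewrite mxtrace_mulC mulmxA mulVmx // mul1mx.
Qed.

Lemma InA_Te h : InA F n (Te F n h).
Proof.
by move=> k; rewrite /Te; case: eqP => _; [exact: goodf_stdpoly | exact: goodf0].
Qed.

Lemma InA_Xpow i : InA F n (Xpow F n i).
Proof. by elim: i => [|i IH]; [exact: InA_one | apply: InA_wedge InA_X IH]. Qed.

Lemma InA_Tword w : InA F n (Tword F n w).
Proof. by elim: w => [|h w IH]; [exact: InA_one | apply: InA_wedge (InA_Te h) IH]. Qed.

Lemma InA_InAT y : InAT F n y -> InA F n y.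
Proof.
by case=> s [_ ->]; apply: InA_sum => t; apply/InA_scale/InA_Tword.
Qed.

Lemma InA_Tmono S : InA F n (Tmono F n S).
Proof.
by rewrite /Tmono; elim: (enum _) => [|h w IH] /=; [exact: InA_one | apply: InA_wedge (InA_Te h) IH].
Qed.

Lemma InA_lincomb c : (forall i, InAT F n (c i)) -> InA F n (lincomb F n c).
Proof.
by move=> hc; apply: InA_sum => i; apply: InA_wedge (InA_Xpow i); apply: InA_InAT.
Qed.

Lemma InA_phiTA p : InA F n (phiTA F n p).
Proof.
by apply: InA_sum => b; apply/InA_scale/InA_wedge; [exact: InA_Tmono | exact: InA_Xpow].
Qed.

Lemma InA_altE x : InA F n x -> altE F n x.
Proof. by move=> hx k; have [] := hx k. Qed.

End Closure.

(** * The even subring and the identities of Amitsur-Levitzki type *)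

Section Even.
Variables (F : fieldType) (m : nat).

Definition evenb (x : ext F m) : bool := [forall A : {set 'I_m}, odd #|A| ==> (x A == 0)].

Lemma evenbP (x : ext F m) : reflect (forall A : {set 'I_m}, odd #|A| -> x A = 0) (evenb x).
Proof.
apply: (iffP forallP) => h A; first by move=> oA; apply/eqP/(implyP (h A)).
by apply/implyP => oA; apply/eqP/h.
Qed.

Lemma even_subring : subring_closed evenb.
Proof.
split=> [|x y /evenbP hx /evenbP hy|x y /evenbP hx /evenbP hy]; apply/evenbP => A oA.
- by rewrite ffunE; case: eqP oA => // ->; rewrite cards0.
- by rewrite !ffunE hx // hy // subr0.
rewrite extmulE big1 // => B sB; have [oB|eB] := boolP (odd #|B|).
  by rewrite hx // mul0r mulr0.
rewrite [y _]hy ?mulr0 // cardsD (setIidPr sB) oddB ?subset_leq_card //.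
by rewrite oA (negPf eB).
Qed.

HB.instance Definition _ := GRing.isSubringClosed.Build (ext F m) evenb even_subring.

(** The even part of the exterior algebra is a commutative ring, over which characteristic
    polynomials make sense. *)
Record evn := Evn {evn_val :> ext F m; _ : evenb evn_val}.
HB.instance Definition _ := [isSub for evn_val].
HB.instance Definition _ := [Choice of evn by <:].
HB.instance Definition _ := [SubChoice_isSubNzRing of evn by <:].

Lemma evn_mulC : commutative (@GRing.mul evn).
Proof.
move=> x y; apply: val_inj; rewrite !rmorphM /= (ext_signcomm _ _ 0) ?mul1r // => A B _ xA _.
have /evenbP h := valP x.
by rewrite oddM; case: (boolP (odd #|A|)) => // /h e; rewrite e eqxx in xA.
Qed.

HB.instance Definition _ := GRing.PzRing_hasCommutativeMul.Build evn evn_mulC.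

Lemma homs_even D d x : homs F m D (2 * d) x -> evenb x.
Proof.
move=> hx; apply/evenbP => A oA; apply: hx; apply/negP => /andP[_ /eqP e].
by rewrite e mul2n odd_double in oA.
Qed.

End Even.

(** * The generic matrix: signed cyclicity of the trace and the two identities *)

Section XiIdentities.
Variables (F : fieldType) (n : nat).
Hypothesis char0 : [pchar F] =i pred0.

Local Notation Lam := (ext F (n * n).+1).
Local Notation Xi := (Xi F n).
Local Notation Tr := (Tr F n).

Definition D0 : {set 'I_(n * n).+1} := [set~ ord0].
Definition eps : Lam := gen F _ ord0.

Lemma card_D0 : #|D0| = (n * n)%N.
Proof. by rewrite /D0 cardsC1 card_ord. Qed.

Definition homM d (A : 'M[Lam]_n) := forall p q, homs F _ D0 d (A p q).

Lemma homM_mul d d' A B : homM d A -> homM d' B -> homM (d + d') (A *m B).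
Proof. by move=> hA hB p q; rewrite mxE; apply: homs_sum => l _; apply: homsM. Qed.

Lemma homM_Xi : homM 1 Xi.
Proof. by move=> p q; rewrite mxE; apply: gen_homs; rewrite !inE /xidx eq_sym neq_lift. Qed.

Lemma homM_X j : homM j (Xi ^+ j).
Proof.
elim: j => [|j IH]; last by rewrite exprS; apply: (homM_mul 1 j) homM_Xi IH.
move=> p q; rewrite mxE; case: eqP => _ /=; first exact: homs1.
exact: homs0.
Qed.

Lemma homs_Tr h : homs F _ D0 (2 * h + 1) (Tr h).
Proof. by apply: homs_sum => p _; apply: homM_X. Qed.

Lemma lam_opp_eq0 (x : Lam) : x = - x -> x = 0.
Proof.
move=> e; apply/ffunP => A; rewrite [RHS]ffunE; apply: opp_eq0 => //.
by rewrite {1}e ffunE.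
Qed.

Lemma lam_torsion (x : Lam) j : (0 < j)%N -> x *+ j = 0 -> x = 0.
Proof.
move=> j0 e; apply/ffunP => A; rewrite [RHS]ffunE; have := congr1 (fun y : Lam => y A) e.
rewrite -scaler_nat !ffunE => /eqP; rewrite mulf_eq0 natf0 // => /orP[|/eqP//].
by rewrite eqn0Ngt j0.
Qed.

Lemma trM_sign d d' A B : homM d A -> homM d' B ->
  \tr (A *m B) = (-1) ^+ (d * d') * \tr (B *m A).
Proof.
move=> hA hB; rewrite /mxtrace mulr_sumr.
under eq_bigr => p _ do rewrite mxE.
rewrite exchange_big; apply: eq_bigr => q _ /=.
rewrite mxE mulr_sumr; apply: eq_bigr => p _.
exact: homs_comm (hA p q) (hB q p).
Qed.

(** Carrying one factor [Xi] around the trace, past an odd number of others, changes the sign; so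
    the trace equals its opposite. *)
Lemma tr_even j : (0 < j)%N -> \tr (Xi ^+ (2 * j)) = 0.
Proof.
case: j => // j _; apply: lam_opp_eq0; rewrite mulnS.
have e : \tr (Xi *m Xi ^+ (1 + 2 * j)) = - \tr (Xi ^+ (1 + 2 * j) *m Xi).
  rewrite (trM_sign 1 (1 + 2 * j)) ?mul1n; last exact: homM_X; last exact: homM_Xi.
  by rewrite -signr_odd oddD mul2n odd_double /= mulN1r.
by rewrite {1}exprS [LHS]e -[_ *m Xi]/(_ * Xi) -exprSr.
Qed.

Lemma mulmx_homl d d' A (x : Lam) (B : 'M[Lam]_n) : homM d A -> homs F _ D0 d' x ->
  A *m (x *: B) = (-1) ^+ (d * d') *: (x *: (A *m B)).
Proof.
move=> hA hx; apply/matrixP => p q; rewrite !mxE !mulr_sumr; apply: eq_bigr => l _.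
by rewrite mxE mulrA (homs_comm _ _ _ _ _ _ _ (hA p l) hx) !mulrA.
Qed.

Lemma mulmx_eps d A (B : 'M[Lam]_n) : homM d A -> A *m (eps *: B) = (-1) ^+ d *: (eps *: (A *m B)).
Proof.
move=> hA; apply/matrixP => p q; rewrite !mxE !mulr_sumr; apply: eq_bigr => l _.
have e : A p l * eps = (-1) ^+ (d * 1) * (eps * A p l).
  apply: (homs_comm _ _ setT); last by apply: gen_homs; rewrite inE.
  exact: homsS (subsetT _) (hA p l).
by rewrite mxE mulrA e muln1 !mulrA.
Qed.

Let A := Xi ^+ 2 + eps *: Xi.

(** [eps] commutes with [Xi ^+ 2], and the terms with two factors [eps] vanish. At [j = 0] the
    truncated exponent [2 * j - 1] is harmless, since its multiplicity is 0. *)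
Lemma A_pow j : A ^+ j = Xi ^+ (2 * j) + eps *: (Xi ^+ (2 * j - 1) *+ j).
Proof.
elim: j => [|j IH]; first by rewrite mulr0n scaler0 addr0.
rewrite exprS IH mulrDl !mulrDr -!addrA; congr (_ + _).
  by rewrite -exprD mulnS.
have -> : (eps *: Xi) * (eps *: (Xi ^+ (2 * j - 1) *+ j)) = 0.
  rewrite -[LHS]/(_ *m _) -scalemxAl (mulmx_eps 1) ?scalerA; last exact: homM_Xi.
  by rewrite expr1 mulrN1 mulNr gen_sq oppr0 scale0r.
have e1 (M : 'M[Lam]_n) : Xi ^+ 2 * (eps *: M) = eps *: (Xi ^+ 2 * M).
  rewrite -[LHS]/(_ *m _) (mulmx_eps 2); last exact: homM_X.
  by rewrite -signr_odd /= scale1r.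
have e2 (M : 'M[Lam]_n) : (eps *: Xi) * M = eps *: (Xi * M).
  by rewrite -[LHS]/(_ *m _) -scalemxAl.
rewrite addr0 e1 e2 -scalerDr; congr (_ *: _); rewrite -exprS mulrnAr -exprD.
rewrite (_ : (2 * j.+1 - 1 = (2 * j).+1)%N); last by lia.
case: j {IH} => [|j]; first by rewrite add0r.
by rewrite (_ : (2 + (2 * j.+1 - 1) = (2 * j.+1).+1)%N); [rewrite -mulrSr | lia].
Qed.

Lemma evenA p q : evenb F _ (A p q).
Proof.
apply: (homs_even _ _ setT 1); rewrite mxE [X in _ + X]mxE; apply: homsD.
  exact: homsS (subsetT _) (homM_X 2 p q).
apply: (homsM _ _ _ 1 1); first by apply: gen_homs; rewrite inE.
exact: homsS (subsetT _) (homM_Xi p q).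
Qed.

(** Neither [x] nor [w] involves the generator [ord0], so [x] and [eps * w] have disjoint supports
    and must vanish separately. *)
Lemma eps_homs d d' (x w : Lam) : homs F _ D0 d x -> homs F _ D0 d' w -> x + eps * w = 0 ->
  x = 0 /\ w = 0.
Proof.
move=> hx hw e.
have ewE (B : {set 'I_(n * n).+1}) : ord0 \notin B -> (eps * w) B = 0.
  move=> nB; rewrite extmulE big1 // => C sC; rewrite [eps C]ffunE.
  case: (C =P [set ord0]) sC => [->|_ _]; last by rewrite mul0r mulr0.
  by rewrite sub1set (negPf nB).
have x0 : x = 0.
  apply/ffunP => B; rewrite [RHS]ffunE; have [bB|nB] := boolP (ord0 \in B).
    apply: hx; apply/negP => /andP[/subsetP/(_ _ bB)].
    by rewrite !inE eqxx.
  have : (x + eps * w) B = 0 by rewrite e ffunE.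
  by rewrite ffunE ewE // addr0.
split=> //; move: e; rewrite x0 add0r => e; apply/ffunP => B; rewrite [RHS]ffunE.
have [bB|nB] := boolP (ord0 \in B).
  apply: hw; apply/negP => /andP[/subsetP/(_ _ bB)].
  by rewrite !inE eqxx.
have : (eps * w) (ord0 |: B) = 0 by rewrite e ffunE.
rewrite extmulE.
rewrite (bigD1 [set ord0]) ?sub1set ?inE ?eqxx //= big1 ?addr0 => [|C /andP[_ /negPf nC]].
  rewrite ffunE eqxx mul1r setU1K // => /eqP; rewrite mulf_eq0 signr_eq0 /=; exact/eqP.
by rewrite [eps C]ffunE nC mul0r mulr0.
Qed.

Lemma homM_scale d d' x B : homs F _ D0 d x -> homM d' B -> homM (d + d') (x *: B).
Proof. by move=> hx hB p q; rewrite mxE; apply: homsM. Qed.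

Lemma Xi_master : Xi ^+ (2 * n) +
  eps *: (Xi ^+ (2 * n - 1) *+ n - \sum_(j < n) Tr j *: Xi ^+ (2 * (n - j.+1))) = 0.
Proof.
pose A0 : 'M[evn F (n * n).+1]_n := \matrix_(p, q) Evn _ _ _ (evenA p q).
have valA0 j : map_mx val (A0 ^+ j) = A ^+ j.
  rewrite rmorphXn /=; congr (_ ^+ _); by apply/matrixP => p q; rewrite !mxE.
have evq j : evenb F _ (eps * Tr j).
  apply: (homs_even _ _ setT j.+1); rewrite (_ : (2 * j.+1 = 1 + (2 * j + 1))%N); last by lia.
  apply: homsM; first by apply: gen_homs; rewrite inE.
  exact: homsS (subsetT _) (homs_Tr j).
(* The index is shifted because the j-th power sum of [A] is [j] times
   [eps * \tr (Xi ^+ (2 * j - 1))], and [2 * j - 1 = 2 * (j - 1) + 1]. *)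
pose q j := Evn _ _ _ (evq j.-1).
(* This kills the products of two power sums, and later also the [eps] part of the powers of [A]
   multiplied by [q]. *)
have z j : eps * Tr j * eps = 0.
  rewrite -mulrA (homs_comm _ _ setT (2 * j + 1) 1 (Tr _) eps).
  - by rewrite mulr_signCA (mulrA eps) gen_sq mul0r mulr0.
  - exact: homsS (subsetT _) (homs_Tr _).
  - by apply: gen_homs; rewrite inE.
have e := Cayley_Hamilton_sq0 _ _ A0 q.
have {}e : A0 ^+ n = \sum_(j < n) q j.+1 *: A0 ^+ (n - j.+1).
  apply: e => [x j j0 xj|j j0|i j i0 j0].
  - apply: val_inj; apply: (lam_torsion _ j j0).
    by rewrite -[LHS](rmorphMn (val : evn F _ -> _)) xj.
  - have trv : val (\tr (A0 ^+ j)) = \tr (A ^+ j) by rewrite -valA0 trace_map_mx.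
    apply: val_inj; rewrite [LHS]trv rmorphMn /= A_pow raddfD /= tr_even // add0r.
    rewrite mxtraceZ raddfMn /= mulrnAr; congr (_ * _ *+ _).
    by rewrite /Tr; congr (\tr (_ ^+ _)); lia.
  apply: val_inj; rewrite rmorphM rmorph0 /=.
  by rewrite mulrA z mul0r.
have eA : A ^+ n = \sum_(j < n) eps *: (Tr j *: Xi ^+ (2 * (n - j.+1))).
  rewrite -valA0 e raddf_sum; apply: eq_bigr => j _ /=.
  rewrite [LHS](map_mxZ (val : evn F _ -> _)) valA0 A_pow /=.
  by rewrite scalerDr [X in _ + X]scalerA z scale0r addr0 scalerA.
by move: eA; rewrite A_pow => eA; rewrite scalerBr addrA eA scaler_sumr subrr.
Qed.

Lemma Xi_AL_O : Xi ^+ (2 * n) = 0 /\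
  Xi ^+ (2 * n - 1) *+ n = \sum_(j < n) Tr j *: Xi ^+ (2 * (n - j.+1)).
Proof.
set W := \sum_(j < n) _.
have hW : homM (2 * n - 1) (Xi ^+ (2 * n - 1) *+ n - W).
  move=> p q; rewrite mxE; apply: homsD.
    rewrite -scaler_nat mxE mulr_natl -scaler_nat; apply: homsZ; exact: homM_X.
  rewrite mxE; apply: homsN; rewrite /W summxE; apply: homs_sum => j _.
  rewrite (_ : (2 * n - 1 = 2 * j + 1 + 2 * (n - j.+1))%N); last by have := ltn_ord j; lia.
  by apply: homM_scale; [exact: homs_Tr | exact: homM_X].
have h p q : (Xi ^+ (2 * n)) p q = 0 /\ (Xi ^+ (2 * n - 1) *+ n - W) p q = 0.
  apply: (eps_homs (2 * n) (2 * n - 1)); [exact: homM_X | exact: hW |].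
  by have := congr1 (fun M : 'M[Lam]_n => M p q) Xi_master; rewrite mxE [X in _ + X]mxE [X in _ = X]mxE.
split; first by apply/matrixP => p q; rewrite [RHS]mxE; case: (h p q).
apply/eqP; rewrite -subr_eq0; apply/eqP/matrixP => p q; rewrite [RHS]mxE.
by case: (h p q).
Qed.

End XiIdentities.

(** * Spanning *)

Section Blocks.
Variables (F : fieldType) (n : nat).
Hypothesis char0 : [pchar F] =i pred0.

Local Notation Lam := (ext F (n * n).+1).
Local Notation Xi := (Xi F n).
Local Notation Tr := (Tr F n).

(** A product of traces times a word, with the arguments consumed in their given order. The degree
    is the nested sum of the block lengths, so that [Sk_cat] applies at each block. *)
Fixpoint blk (bs : seq nat) (j : nat) : forms F n (foldr addn j bs) :=
  match bs return forms F n (foldr addn j bs) with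
  | [::] => fun v => \prod_(l < j) v l
  | b :: bs' => fun v => (\tr (\prod_(l < b) v (lshift _ l)))%:M *m blk bs' j (fun l => v (rshift b l))
  end.

Lemma Sk_blk bs j : Sk F n _ (blk bs j) = (\prod_(b <- bs) \tr (Xi ^+ b)) *: Xi ^+ j.
Proof.
elim: bs => [|b bs IH] /=; first by rewrite big_nil scale1r Sk_prod.
rewrite (Sk_cat _ _ b (foldr addn j bs) (fun v => (\tr (\prod_(l < b) v l))%:M) (blk bs j)).
by rewrite Sk_tr Sk_prod IH big_cons mul_scalar_mx scalerA.
Qed.

Lemma blk_words us u0 (w : nat -> 'M[F]_n) :
  (\prod_(u <- us) \tr (wprod F n w u)) *: wprod F n w u0 =
  blk (map size us) (size u0) (fun l => w (nth 0%N (flatten us ++ u0) l)).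
Proof.
have prodE u (r : seq nat) : wprod F n w u = \prod_(l < size u) w (nth 0%N (u ++ r) l).
  rewrite /wprod (big_nth 0%N) big_mkord; apply: eq_bigr => l _.
  by rewrite nth_cat ltn_ord.
elim: us => [|u us IH] /=; first by rewrite big_nil scale1r (prodE _ [::]) cats0.
rewrite big_cons -scalerA IH mul_scalar_mx; congr (_ *: _).
  by rewrite (prodE u (flatten us ++ u0)) catA.
congr (blk _ _ _); apply: functional_extensionality => l /=.
by rewrite -catA [in RHS]nth_cat ltnNge leq_addr /= addKn.
Qed.

(** Reading the letters of all words from left to right gives a permutation of the arguments of
    [blk]; by [Sk_perm] it contributes only its sign. *)
Lemma Sk_trmono k p : perm_eq (flatten p.1 ++ p.2) (iota 0 k) ->
  exists b : bool, Sk F n k (trmono F n p) =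
    (-1) ^+ b *: ((\prod_(u <- p.1) \tr (Xi ^+ size u)) *: Xi ^+ size p.2).
Proof.
move=> pp; have ek : foldr addn (size p.2) (map size p.1) = k.
  rewrite -(size_iota 0 k) -(perm_size pp) size_cat size_flatten /shape.
  by elim: (map size p.1) => //= b bs ->; rewrite addnA.
case: k / ek pp => pp; set k := foldr _ _ _ in pp *.
set L := flatten p.1 ++ p.2 in pp.
have sL : size L = k by rewrite (perm_size pp) size_iota.
have Lk (l : 'I_k) : (nth 0%N L l < k)%N.
  have : nth 0%N L l \in L by rewrite mem_nth // sL.
  by rewrite (perm_mem pp) mem_iota.
have ti : injective (fun l => Ordinal (Lk l)).
  move=> a b [] /eqP; rewrite nth_uniq ?sL // ?(perm_uniq pp) ?iota_uniq // => /eqP.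
  exact: val_inj.
exists (odd_perm (perm ti)).
have -> : \prod_(u <- p.1) \tr (Xi ^+ size u) = \prod_(b <- map size p.1) \tr (Xi ^+ b).
  by rewrite big_map.
rewrite -Sk_blk -Sk_perm; apply: Sk_ext => v.
rewrite /trmono blk_words; congr (blk _ _ _); apply: functional_extensionality => l.
by rewrite permE -[RHS](vext_ord _ _ _ v 0).
Qed.

End Blocks.

(** * Elimination of the last trace and the spanning monomials *)

Section Spanning.
Variables (F : fieldType) (n : nat).
Hypothesis char0 : [pchar F] =i pred0.
Hypothesis n_gt0 : (0 < n)%N.

Local Notation Lam := (ext F (n * n).+1).
Local Notation Xi := (Xi F n).
Local Notation Tr := (Tr F n).

Lemma Xi_big j : (2 * n <= j)%N -> Xi ^+ j = 0.
Proof.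
by move=> le; rewrite -(subnK le) exprD (proj1 (Xi_AL_O F n char0)) mulr0.
Qed.

Lemma Tr_big h : (n <= h)%N -> Tr h = 0.
Proof. by move=> le; rewrite /Tr Xi_big ?mxtrace0 //; lia. Qed.

Lemma Tr_anti h h' : Tr h * Tr h' = - (Tr h' * Tr h).
Proof.
rewrite (homs_comm _ _ _ _ _ _ _ (homs_Tr F n h) (homs_Tr F n h')).
have o k : odd (2 * k + 1) by rewrite addn1 /= mul2n odd_double.
by rewrite -signr_odd oddM !o mulN1r.
Qed.

Lemma Tr_sq h : Tr h * Tr h = 0.
Proof. exact/(lam_opp_eq0 F n char0)/Tr_anti. Qed.

Definition Tw (w : seq nat) : Lam := \prod_(h <- w) Tr h.

Lemma Tr_last : (Tr n.-1)%:M =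
  Xi ^+ (2 * n - 1) *+ n - \sum_(j < n.-1) Tr j *: Xi ^+ (2 * (n - j.+1)).
Proof.
have [_ ->] := Xi_AL_O F n char0.
case: n n_gt0 => // m _; rewrite /= big_ord_recr /= subnn muln0 expr0.
by rewrite addrC addrK -scalemx1.
Qed.

Definition Bspan (z : 'M[Lam]_n) : Prop :=
  exists s : seq (F * (seq nat * nat)),
    all (fun t => all (fun h => h < n.-1)%N t.2.1 && (t.2.2 < 2 * n)%N) s /\
    z = \sum_(t <- s) t.1%:A *: (Tw t.2.1 *: Xi ^+ t.2.2).

Lemma Bspan0 : Bspan 0.
Proof. by exists [::]; rewrite big_nil. Qed.

Lemma BspanD y z : Bspan y -> Bspan z -> Bspan (y + z).
Proof.
case=> s [hs ->] [t [ht ->]]; exists (s ++ t); rewrite all_cat hs ht.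
by rewrite big_cat.
Qed.

Lemma BspanZ c z : Bspan z -> Bspan (c%:A *: z).
Proof.
case=> s [hs ->]; exists [seq (c * t.1, t.2) | t <- s]; split.
  by rewrite all_map; apply: sub_all hs.
rewrite big_map scaler_sumr; apply: eq_bigr => t _ /=.
by rewrite [LHS]scalerA algM.
Qed.

Lemma Bspan_sum (I : Type) (r : seq I) (P : pred I) (z : I -> 'M[Lam]_n) :
  (forall i, P i -> Bspan (z i)) -> Bspan (\sum_(i <- r | P i) z i).
Proof. by move=> h; apply: big_ind => //; [exact: Bspan0 | exact: BspanD]. Qed.

Lemma Bspan_sign (b : nat) z : Bspan z -> Bspan ((-1) ^+ b *: z).
Proof.
move=> /(BspanZ ((-1) ^+ b)); rewrite -signr_odd -[in X in _ -> Bspan X]signr_odd.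
by case: odd => /=; rewrite ?expr0 ?expr1 ?scaleN1r ?scaleNr ?scale1r.
Qed.

Lemma Bspan_natmul z m : Bspan z -> Bspan (z *+ m).
Proof. by move=> hz; rewrite -scaler_nat -(scaler_nat _ 1) ; apply: BspanZ. Qed.

Lemma Bspan_gen w j : all (fun h => h < n.-1)%N w -> Bspan (Tw w *: Xi ^+ j).
Proof.
move=> hw; have [lt|ge] := ltnP j (2 * n).
  exists [:: (1, (w, j))]; rewrite /= hw lt; split=> //.
  by rewrite big_seq1 /= !scale1r.
by rewrite Xi_big // scaler0; apply: Bspan0.
Qed.

(** For [h >= n] the factor is zero, and for [h < n.-1] it lengthens the word. For [h = n.-1] it is
    carried past the word, up to sign, to stand next to the power of [Xi], where [Tr_last] replaces
    it. *)
Lemma Bspan_Tr h z : Bspan z -> Bspan (Tr h *: z).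
Proof.
case=> s [/allP hs ->]; rewrite scaler_sumr big_seq; apply: Bspan_sum => t /hs /andP[hw _].
have -> : Tr h *: (t.1%:A *: (Tw t.2.1 *: Xi ^+ t.2.2)) =
   t.1%:A *: (Tr h *: (Tw t.2.1 *: Xi ^+ t.2.2)).
  by rewrite !scalerA; congr (_ *: _); rewrite !mulr_algl mulr_algr scalerAl.
apply: BspanZ; move: t.2.2 t.2.1 hw => j w hw {t hs s}.
have [ge|lt] := leqP n h; first by rewrite Tr_big // scale0r; apply: Bspan0.
have [lt'|ge'] := ltnP h n.-1.
  rewrite scalerA (_ : Tr h * Tw w = Tw (h :: w)); last by rewrite /Tw big_cons.
  by apply: Bspan_gen; rewrite /= lt' hw.
have -> : h = n.-1 by lia.
rewrite scalerA (anti_prodC _ _ _ Tr_anti) -/(Tw w) -scalerA; apply: Bspan_sign.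
have -> : (Tw w * Tr n.-1) *: Xi ^+ j = Tw w *: ((Tr n.-1)%:M *m Xi ^+ j).
  by rewrite mul_scalar_mx scalerA.
rewrite Tr_last mulmxBl scalerBr; apply: BspanD.
  rewrite -[_ *m _]/(_ * _) mulrnAl -exprD -scalerMnr; apply: Bspan_natmul.
  exact: Bspan_gen.
rewrite mulmx_suml scaler_sumr -sumrN; apply: Bspan_sum => i _.
rewrite -scaleN1r -[-1]expr1; apply: Bspan_sign.
rewrite -scalemxAl -[_ *m _]/(_ * _) -exprD scalerA.
rewrite (_ : Tw w * Tr i = Tw (rcons w i)); last by rewrite /Tw -cats1 big_cat big_seq1.
by apply: Bspan_gen; rewrite all_rcons ltn_ord.
Qed.

Lemma Bspan_tr a z : Bspan z -> Bspan (\tr (Xi ^+ a) *: z).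
Proof.
move=> hz; have [oa|ea] := boolP (odd a).
  rewrite (_ : \tr (Xi ^+ a) = Tr a./2); first exact: Bspan_Tr.
  by rewrite /Tr; congr (\tr (_ ^+ _)); rewrite -[LHS]odd_double_half oa -mul2n addnC.
rewrite -[a]odd_double_half (negPf ea) add0n -mul2n; case: (posnP a./2) => [->|lt].
  rewrite muln0 expr0 mxtrace1 scaler_nat; exact: Bspan_natmul.
by rewrite tr_even // scale0r; apply: Bspan0.
Qed.

Lemma Bspan_Gam x : InA F n x -> Bspan (Gam F n x).
Proof.
move=> hx; apply: Bspan_sum => k _; have [lx _ ex] := hx k.
have [s [hs sE]] := equivariant_span _ _ _ _ char0 lx ex.
apply: BspanZ; rewrite (Sk_ext _ _ _ _ _ sE).
rewrite (Sk_sum _ _ _ _ _ _ (fun t v => t.1 *: trmono F n t.2 v)) big_seq.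
apply: Bspan_sum => t /(allP hs) pt; rewrite SkZ; apply: BspanZ.
have [b ->] := Sk_trmono F n k t.2 pt; apply: Bspan_sign.
elim: (t.2.1) => [|u us IH].
  by have := Bspan_gen [::] (size t.2.2) isT; rewrite /Tw !big_nil.
by rewrite big_cons -scalerA; apply: Bspan_tr.
Qed.

Lemma Gam_sum (I : Type) (r : seq I) (P : pred I) (x : I -> E F n) :
  Gam F n (fun k v => \sum_(i <- r | P i) x i k v) = \sum_(i <- r | P i) Gam F n (x i).
Proof.
rewrite /Gam exchange_big; apply: eq_bigr => k _ /=.
by rewrite (Gk_sum _ _ _ _ _ _ (fun i => x i k)).
Qed.

Lemma GamD (x y : E F n) : Gam F n (fun k v => x k v + y k v) = Gam F n x + Gam F n y.
Proof.
rewrite /Gam -big_split; apply: eq_bigr => k _ /=; rewrite /Gk -scalerDr /Sk -big_split.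
by congr (_ *: _); apply: eq_bigr => i _; rewrite /inL map_mxD scalerDr.
Qed.

Lemma Gam_scale c (x : E F n) : Gam F n (fun k v => c *: x k v) = c%:A *: Gam F n x.
Proof. by rewrite /Gam scaler_sumr; apply: eq_bigr => k _; rewrite GkZ. Qed.

Lemma Gam_Tword w : Gam F n (Tword F n w) = (Tw w)%:M.
Proof.
elim: w => [|h w IH]; first by rewrite Gam_one // /Tw big_nil.
by rewrite /= GamM // Gam_Te // IH -scalar_mxM /Tw big_cons.
Qed.

Lemma Gam_lincomb c : Gam F n (lincomb F n c) = \sum_(i < 2 * n) Gam F n (c i) *m Xi ^+ i.
Proof.
rewrite /lincomb (Gam_sum _ _ _ (fun i => wedge F n (c i) (Xpow F n i))).
by apply: eq_bigr => i _; rewrite GamM // Gam_Xpow.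
Qed.

Lemma Gam_inj2 x y : InA F n x -> InA F n y -> Gam F n x = Gam F n y -> x = y.
Proof.
move=> hx hy e; have := Gam_inj F n char0 (fun k v => x k v + (-1) *: y k v).
have iz : InA F n (fun k v => x k v + (-1) *: y k v).
  by move=> k; apply: goodfD (hx k) _; apply/goodfZ/hy.
have gz : Gam F n (fun k v => x k v + (-1) *: y k v) = 0.
  by rewrite (GamD x (fun k v => -1 *: y k v)) Gam_scale e scaleN1r scaleN1r subrr.
move=> /(_ (InA_altE _ _ _ iz) gz) xy.
apply: functional_extensionality_dep => k; apply: functional_extensionality => v.
have := congr1 (fun z : E F n => z k v) xy.
by rewrite /zeroE scaleN1r => /eqP; rewrite subr_eq0 => /eqP.
Qed.

Lemma span_exists x : InA F n x ->
  exists c : 'I_(2 * n) -> E F n, (forall i, InAT F n (c i)) /\ x = lincomb F n c.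
Proof.
move=> hx; have [s [hs sE]] := Bspan_Gam x hx.
pose l (i : 'I_(2 * n)) := [seq (t.1, t.2.1) | t <- s & t.2.2 == i :> nat].
pose c (i : 'I_(2 * n)) : E F n := fun k v => \sum_(t <- l i) t.1 *: Tword F n t.2 k v.
have cAT i : InAT F n (c i).
  exists (l i); split=> //; apply/allP => t /mapP[u]; rewrite mem_filter => /andP[_ us] -> /=.
  by have /andP[] := allP hs u us.
exists c; split=> //; apply: Gam_inj2 => //; first exact: InA_lincomb.
rewrite sE Gam_lincomb.
transitivity (\sum_(i < 2 * n) \sum_(t <- s | t.2.2 == i :> nat) t.1%:A *: (Tw t.2.1 *: Xi ^+ t.2.2)).
  rewrite (exchange_big_dep predT) //= big_seq [RHS]big_seq; apply: eq_bigr => t ts.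
  have /andP[_ lt] := allP hs t ts.
  by rewrite (big_pred1 (Ordinal lt)) // => i; rewrite -(inj_eq val_inj) eq_sym.
apply: eq_bigr => i _.
rewrite /c (Gam_sum _ _ _ (fun t k v => t.1 *: Tword F n t.2 k v)) /l big_map big_filter.
rewrite mulmx_suml; apply: eq_bigr => t /eqP <-.
by rewrite Gam_scale Gam_Tword -scalemxAl mul_scalar_mx.
Qed.

End Spanning.

(** * The volume form *)

Section Volume.
Variables (F : fieldType) (n : nat).

Lemma eq_lin_mx (A B : 'M[F]_(n * n)) :
  (forall u : 'M[F]_n, mxvec u *m A = mxvec u *m B) -> A = B.
Proof.
move=> h; apply/row_matrixP => i; rewrite !rowE.
by have := h (vec_mx (delta_mx 0 i)); rewrite vec_mxK.
Qed.

Lemma lin_mulmxr_tr (g : 'M[F]_n) : (lin_mulmxr g)^T = lin_mulmxr g^T :> 'M_(n * n).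
Proof.
apply/matrixP => i j; case/mxvec_indexP: i => a b; case/mxvec_indexP: j => c d.
rewrite !mxE /= !vec_mx_delta !mxvecE !mxE.
rewrite (bigD1 d) //= big1 ?addr0 => [|l /negPf nl]; last by rewrite !mxE nl andbF mul0r.
rewrite (bigD1 b) //= big1 ?addr0 => [|l /negPf nl]; last by rewrite !mxE nl andbF mul0r.
by rewrite !mxE !eqxx !andbT eq_sym.
Qed.

(** Transposition, an involution, conjugates left multiplication by [g] into right multiplication by
    [g^T], whose matrix is the transpose of that of right multiplication by [g]. *)
Lemma det_lin_mulmx (g : 'M[F]_n) : \det (lin_mulmx g : 'M_(n * n)) = \det (lin_mulmxr g : 'M_(n * n)).
Proof.
pose t : 'M[F]_(n * n) := lin_mx trmx.
have tE (u : 'M[F]_n) : mxvec u *m t = mxvec u^T by rewrite mul_vec_lin.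
have tt : t *m t = 1%:M.
  by apply: eq_lin_mx => u; rewrite mulmxA !tE trmxK mulmx1.
have e : t *m lin_mulmx g *m t = lin_mulmxr g^T.
  apply: eq_lin_mx => u; rewrite !mulmxA tE [_ *m lin_mulmx g]mul_vec_lin tE mul_vec_lin /=.
  by rewrite trmx_mul trmxK.
have := congr1 determinant e; rewrite !det_mulmx mulrAC -det_mulmx tt det1 mul1r => ->.
by rewrite -lin_mulmxr_tr det_tr.
Qed.

Definition volm (v : 'I_(n * n) -> 'M[F]_n) : 'M[F]_(n * n) := \matrix_i mxvec (v i).

(** For equivariance: conjugation by [g] has determinant 1 on the space of matrices, since left and
    right multiplication have the same determinant. *)
Lemma goodf_vol : goodf F n (fun v : 'I_(n * n) -> 'M[F]_n => (\det (volm v))%:M).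
Proof.
split=> [v i a y z|s v|g v ug].
- rewrite scale_scalar_mx -raddfD /=; congr _%:M.
  have := @determinant_multilinear F _ (volm (upd F n v i (a *: y + z)))
    (volm (upd F n v i y)) (volm (upd F n v i z)) i a 1; rewrite mul1r; apply.
  + by rewrite !rowK /upd eqxx scale1r linearP.
  + by apply/matrixP => p q; rewrite !mxE /upd eq_sym (negPf (neq_lift _ _)).
  + by apply/matrixP => p q; rewrite !mxE /upd eq_sym (negPf (neq_lift _ _)).
- have -> : volm (fun i => v (s i)) = row_perm s (volm v).
    by apply/matrixP => p q; rewrite !mxE.
  by rewrite row_permE det_mulmx det_perm scale_scalar_mx.
have -> : volm (fun i => g *m v i *m invmx g) = volm v *m lin_mulmx g *m lin_mulmxr (invmx g).
  apply/row_matrixP => i; rewrite !row_mul !rowK.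
  by rewrite !mul_vec_lin.
rewrite !det_mulmx det_lin_mulmx -mulrA -det_mulmx.
have -> : (lin_mulmxr g : 'M_(n * n)) *m lin_mulmxr (invmx g) = 1%:M.
  by apply: eq_lin_mx => u; rewrite mulmxA !mul_vec_lin /= mulmxK // mulmx1.
by rewrite det1 mulr1 mul_mx_scalar -scalemxAl mulmxV // scalemx1.
Qed.

(** [vext] turns a family indexed by ['I_k] into one indexed by ['I_(n * n)] without a cast; its
    default value 0 is never reached when [k = n * n]. *)
Definition volE : E F n :=
  fun k v => if k == (n * n)%N then (\det (volm (fun i => vext F n v 0 i)))%:M else 0.

Lemma InA_vol : InA F n volE.
Proof.
move=> k; rewrite /volE; case: eqP => [->|_]; last exact: goodf0.
apply: goodf_ext goodf_vol => v; congr (\det (volm _))%:M.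
by apply: functional_extensionality => i; rewrite vext_ord.
Qed.

Lemma volE_neq0 : (0 < n)%N -> volE <> zeroE F n.
Proof.
move=> n0 e; have := congr1 (fun x : E F n => x (n * n)%N (fun i => vec_mx (delta_mx 0 i))) e.
rewrite /volE eqxx /zeroE.
have -> : volm (fun i => vext F n (fun i : 'I_(n * n) => vec_mx (delta_mx 0 i)) 0 i) = 1%:M.
  apply/row_matrixP => i; rewrite rowK vext_ord vec_mxK row1.
  by [].
rewrite det1 => /matrixP/(_ (Ordinal n0) (Ordinal n0))/eqP.
by rewrite !mxE eqxx oner_eq0.
Qed.

End Volume.

(** * Linear independence *)

Section Independence.
Variables (F : fieldType) (n : nat).
Hypothesis char0 : [pchar F] =i pred0.
Hypothesis n_gt0 : (0 < n)%N.

Local Notation Lam := (ext F (n * n).+1).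
Local Notation Xi := (Xi F n).
Local Notation Tr := (Tr F n).
Local Notation Tw := (Tw F n).
Local Notation D0 := (D0 n).

Definition degw (w : seq nat) : nat := (\sum_(h <- w) (2 * h + 1))%N.

Lemma homs_Tw w : homs F _ D0 (degw w) (Tw w).
Proof.
elim: w => [|h w IH]; first by rewrite /degw /Tw !big_nil; apply: homs1.
by rewrite /degw /Tw !big_cons; apply: homsM IH; apply: homs_Tr.
Qed.

Lemma Tw_perm w w' : perm_eq w w' -> exists b : nat, Tw w = (-1) ^+ b * Tw w'.
Proof. by case/anti_prod_perm => b e; exists b; apply: e; apply: Tr_anti. Qed.

Lemma Tw_dup w : ~~ uniq w -> Tw w = 0.
Proof. exact: anti_prod_dup (Tr_anti F n) (Tr_sq F n char0) _. Qed.

Lemma Tw_cat w w' : Tw (w ++ w') = Tw w * Tw w'.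
Proof. by rewrite /Tw big_cat. Qed.

Lemma degw_iota m : degw (iota 0 m) = (m * m)%N.
Proof.
elim: m => [|m IH]; first by rewrite /degw big_nil.
rewrite -{1}(addn1 m) /degw iotaD big_cat big_seq1 -/(degw _) IH /= add0n mulSn mulnS; lia.
Qed.

(** A word without repetition has degree at most [(n-1)^2], and [j] is at most [2n-1]; as these
    bounds add up to [n^2], both must be attained. *)
Lemma word_top w j : uniq w -> all (fun h => h < n.-1)%N w -> (j < 2 * n)%N ->
  (degw w + j = n * n)%N -> perm_eq w (iota 0 n.-1) /\ j = (2 * n - 1)%N.
Proof.
move=> uw /allP aw lj e.
have p1 : perm_eq w [seq h <- iota 0 n.-1 | h \in w].
  apply: uniq_perm => //; first by rewrite filter_uniq ?iota_uniq.
  move=> h; rewrite mem_filter mem_iota /= add0n.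
  by case hw: (h \in w) => //=; rewrite aw.
have dw : degw w = (\sum_(h <- iota 0 n.-1 | h \in w) (2 * h + 1))%N.
  by rewrite /degw (perm_big _ p1) big_filter.
have := degw_iota n.-1; rewrite /degw (bigID (mem w)) /= -dw => dE.
have [z ->] : (\sum_(h <- iota 0 n.-1 | h \notin w) (2 * h + 1) = 0)%N /\ j = (2 * n - 1)%N.
  by case: n n_gt0 lj e dE => // m _ /=; rewrite mulSn !mulnS /= => lj e dE; split; lia.
split=> //; apply: uniq_perm => //; first exact: iota_uniq.
move=> h; rewrite mem_iota /= add0n; apply/idP/idP => [/aw//|hn].
apply: contraT => nh; move/eqP: z; rewrite sum_nat_seq_eq0 => /allP/(_ h).
by rewrite mem_iota /= add0n hn nh => /(_ isT); rewrite addn1.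
Qed.

Lemma homs_xip k (i : 'I_k -> 'I_n * 'I_n) : homs F _ D0 k (xip F n i).
Proof.
elim: k i => [|k IH] i; first by rewrite /xip big_ord0; apply: homs1.
rewrite /xip big_ord_recl; apply: (homsM _ _ _ 1 k); last exact: IH.
by apply: gen_homs; rewrite !inE /xidx eq_sym neq_lift.
Qed.

Lemma homM_Gk k (f : forms F n k) : homM F n k (Gk F n k f).
Proof.
move=> p q; rewrite mxE mulr_algl; apply: homsZ; rewrite summxE; apply: homs_sum => i _.
by rewrite !mxE mulr_algr; apply: homsZ; apply: homs_xip.
Qed.

(* The volume form lies in the span, and [Tw (iota 0 n.-1) *: Xi ^+ (2 * n - 1)] is
   the only spanning monomial of degree [n * n]. *)
Lemma top_neq0 : Tw (iota 0 n.-1) *: Xi ^+ (2 * n - 1) != 0.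
Proof.
apply/eqP => top0.
have [s [/allP hs sE]] := Bspan_Gam F n char0 n_gt0 _ (InA_vol F n).
apply: (volE_neq0 F n n_gt0); apply: (Gam_inj F n char0); first exact/InA_altE/InA_vol.
have hv : homM F n (n * n) (Gam F n (volE F n)).
  rewrite (Gam_single F n (n * n)) => [|k nk v]; first exact: homM_Gk.
  by rewrite /volE (negPf nk).
apply/matrixP => p q; rewrite [RHS]mxE; apply/ffunP => A; rewrite [RHS]ffunE.
have [/andP[sA /eqP cA]|] := boolP ((A \subset D0) && (#|A| == (n * n)%N)); last exact: hv.
rewrite sE summxE sum_ffunE big_seq big1 // => t /hs/andP[aw lj].
rewrite mxE mulr_algl ffunE; apply/eqP; rewrite mulf_eq0; apply/orP; right; apply/eqP.
have [uw|/Tw_dup->] := boolP (uniq t.2.1); last by rewrite scale0r mxE ffunE.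
have [d|nd] := eqVneq (degw t.2.1 + t.2.2)%N (n * n)%N.
  have [/Tw_perm[b ->] ->] := word_top _ _ uw aw lj d.
  by rewrite -scalerA top0 scaler0 mxE ffunE.
have := homM_scale F n _ _ _ _ (homs_Tw t.2.1) (homM_X F n t.2.2); move/(_ p q); apply.
by rewrite cA eq_sym (negPf nd) andbF.
Qed.

Definition low (S : {set 'I_n}) : bool := [forall h in S, (h < n.-1)%N].
Definition TS (S : {set 'I_n}) : Lam := Tw [seq val h | h <- enum S].

(** Among the nonzero coefficients take [(S, j)] with [j] minimal and then [#|S|] minimal, and
    multiply by [TS C] and [Xi ^+ (2 * n - 1 - j)], where [C] completes [S] to [{0, ..., n-2}]. A
    larger exponent is killed by the vanishing of [Xi ^+ (2 * n)]; at exponent [j] only subsets of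
    [S] avoid a repeated trace, and minimality leaves [S] alone. Its image is the top monomial up to
    sign. *)
Theorem TX_free (d : {set 'I_n} * 'I_(2 * n) -> F) :
    \sum_(b | low b.1) (d b)%:A *: (TS b.1 *: Xi ^+ b.2) = 0 ->
  forall b, low b.1 -> d b = 0.
Proof.
move=> d0 b0 lb0; apply/eqP; apply: contraT => db0.
pose bad (b : {set 'I_n} * 'I_(2 * n)) := low b.1 && (d b != 0).
(* Encodes the lexicographic order on exponent and cardinality, since [#|b.1| < n.+1]. *)
pose wt (b : {set 'I_n} * 'I_(2 * n)) := (b.2 * n.+1 + #|b.1|)%N.
have bad0 : bad b0 by rewrite /bad lb0.
case: (arg_minnP wt bad0) => -[S j] /andP[/= lS dS] minS.
pose C := [set h : 'I_n | (h < n.-1)%N && (h \notin S)].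
have cS (S' : {set 'I_n}) : (#|S'| < n.+1)%N by have := max_card (mem S'); rewrite card_ord ltnS.
have := congr1 (fun M : 'M[Lam]_n => TS C *: (M *m Xi ^+ (2 * n - 1 - j))) d0.
rewrite mul0mx scaler0 mulmx_suml scaler_sumr.
have tE b : TS C *: ((d b)%:A *: (TS b.1 *: Xi ^+ b.2) *m Xi ^+ (2 * n - 1 - j)) =
    (d b)%:A *: (Tw ([seq val h | h <- enum C] ++ [seq val h | h <- enum b.1])
                  *: Xi ^+ (b.2 + (2 * n - 1 - j))).
  rewrite Tw_cat -!scalemxAl -[Xi ^+ _ *m _]/(_ * _) -exprD !scalerA; congr (_ *: _).
  by rewrite !mulr_algl mulr_algr -scalerAl.
under eq_bigr => b _ do rewrite tE.
rewrite (bigD1 (S, j)) //= big1 ?addr0 => [|b /andP[lb nb]].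
  have -> : (j + (2 * n - 1 - j) = 2 * n - 1)%N by have := ltn_ord j; lia.
  have /Tw_perm[c ->] : perm_eq ([seq val h | h <- enum C] ++ [seq val h | h <- enum S]) (iota 0 n.-1).
    rewrite -map_cat; apply: uniq_perm; last 1 first.
    - move=> h; rewrite mem_iota /= add0n; apply/mapP/idP => [[h']|hn].
        rewrite mem_cat !mem_enum inE => /orP[/andP[h1 _] ->//|hS ->].
        exact: (implyP (forallP lS h')).
      have hn' : (h < n)%N by apply: leq_trans hn (leq_pred _).
      exists (Ordinal hn') => //; rewrite mem_cat !mem_enum inE /= hn /=.
      by case: (_ \in S).
    - rewrite map_inj_uniq ?cat_uniq ?enum_uniq //=; last exact: val_inj.
      rewrite andbT; apply/hasPn => h; rewrite !mem_enum inE => ->.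
      by rewrite andbF.
    - exact: iota_uniq.
  rewrite -[(_ * _) *: _]scalerA => e0; case/negP: (top_neq0); apply/eqP.
  have := congr1 (fun M => (-1) ^+ c *: ((d (S, j))^-1%:A *: M)) e0; rewrite !scaler0.
  have K (N : 'M[Lam]_n) : (d (S, j))^-1%:A *: ((d (S, j))%:A *: N) = N.
    by rewrite scalerA algM mulVf // !scale1r.
  have K' (N : 'M[Lam]_n) : (-1) ^+ c *: ((-1) ^+ c *: N) = N.
    by rewrite scalerA -exprD addnn -signr_odd odd_double scale1r.
  by rewrite K K'.
have [->|db] := eqVneq (d b) 0; first by rewrite !scale0r.
have /minS : bad b by rewrite /bad lb.
rewrite /wt /= => wb.
have [lj|gj] := leqP b.2 j; last first.
  by rewrite Xi_big ?scaler0 //; have := ltn_ord j; lia.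
rewrite Tw_dup ?scale0r ?scaler0 //; apply: contra nb.
rewrite -map_cat map_inj_uniq; last exact: val_inj.
rewrite cat_uniq => /and3P[_ /hasPn h _].
have sb : b.1 \subset S.
  apply/subsetP => x xb; have := h x; rewrite !mem_enum => /(_ xb).
  rewrite inE negb_and negbK => /orP[|//].
  by rewrite (implyP (forallP lb x)).
have := subset_leq_card sb; have := cS S; have := cS b.1 => c1 c2 le.
have ej : b.2 = j :> nat.
  apply/eqP; rewrite eqn_leq lj leqNgt; apply/negP => lt.
  have : (b.2.+1 * n.+1 <= j * n.+1)%N by rewrite leq_mul2r lt orbT.
  rewrite mulSn leqNgt => /negP; apply.
  by apply: leq_ltn_trans (leq_trans (leq_addr #|S| _) wb) _; rewrite addnC ltn_add2r.
have eS : b.1 = S by apply/eqP; rewrite eqEcard sb /=; move: wb; rewrite ej leq_add2l.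
by rewrite -eS -(val_inj ej) -surjective_pairing.
Qed.

End Independence.

(** * The formal algebra and the canonical homomorphism *)

Section Freeness.
Variables (F : fieldType) (n : nat).
Hypothesis char0 : [pchar F] =i pred0.
Hypothesis n_gt0 : (0 < n)%N.

Local Notation Lam := (ext F (n * n).+1).
Local Notation Xi := (Xi F n).
Local Notation Tr := (Tr F n).
Local Notation Tw := (Tw F n).
Local Notation TS := (TS F n).
Local Notation low := (low n).

Lemma Tw_TS w : all (fun h => h < n.-1)%N w ->
  exists d : {set 'I_n} -> F, Tw w = \sum_(S | low S) (d S)%:A * TS S.
Proof.
move=> /allP aw; have [uw|nuw] := boolP (uniq w); last first.
  by exists (fun=> 0); rewrite (Tw_dup F n char0) // big1 // => S _; rewrite scale0r mul0r.
pose S := [set h : 'I_n | val h \in w].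
have lS : low S by apply/forallP => h; apply/implyP; rewrite inE => /aw.
have /(Tw_perm F n)[b ->] : perm_eq w [seq val h | h <- enum S].
  apply: uniq_perm => //; first by rewrite map_inj_uniq ?enum_uniq //; apply: val_inj.
  move=> h; apply/idP/mapP => [hw|[h']]; last by rewrite mem_enum inE => ? ->.
  have hn : (h < n)%N by apply: leq_trans (aw h hw) (leq_pred _).
  by exists (Ordinal hn); rewrite // mem_enum inE.
exists (fun S' => if S' == S then (-1) ^+ b else 0).
rewrite (bigD1 S) //= eqxx big1 ?addr0 => [|S' /andP[_ /negPf->]].
  by rewrite mulr_algl -signr_odd -[in RHS]signr_odd mulr_sign;
    case: odd; rewrite ?expr0 ?expr1 ?scaleN1r ?scale1r.
by rewrite scale0r mul0r.
Qed.

Lemma InAT_TS y : InAT F n y ->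
  exists d : {set 'I_n} -> F, Gam F n y = \sum_(S | low S) (d S)%:A *: (TS S)%:M.
Proof.
case=> s [hs ->]; rewrite (Gam_sum _ _ _ _ _ (fun t k v => t.1 *: Tword F n t.2 k v)).
elim: s hs => [|t s IH] /=.
  by exists (fun=> 0); rewrite big_nil big1 // => S _; rewrite !scale0r.
case/andP=> /Tw_TS[d ed] /IH[d' ed']; exists (fun S => t.1 * d S + d' S).
rewrite big_cons ed' Gam_scale (Gam_Tword _ _ char0) ed raddf_sum scaler_sumr -big_split /=.
apply: eq_bigr => S _; rewrite -scale_scalar_mx scalerA algM.
by rewrite [in RHS]scalerDl scalerDl.
Qed.

Lemma AT_free (c c' : 'I_(2 * n) -> E F n) :
    (forall i, InAT F n (c i)) -> (forall i, InAT F n (c' i)) ->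
  lincomb F n c = lincomb F n c' -> c = c'.
Proof.
move=> hc hc' e.
have [d dE] := fin_all_exists (fun i => InAT_TS _ (hc i)).
have [d' dE'] := fin_all_exists (fun i => InAT_TS _ (hc' i)).
have ed i S : low S -> d i S = d' i S.
  move=> lS; apply/eqP; rewrite -subr_eq0; apply/eqP.
  apply: (TX_free F n char0 n_gt0 (fun b => d b.2 b.1 - d' b.2 b.1) _ (S, i) lS).
  have h x dx : (forall i, Gam F n (x i) = \sum_(S | low S) (dx i S)%:A *: (TS S)%:M) ->
      Gam F n (lincomb F n x) =
      \sum_(b : {set 'I_n} * 'I_(2 * n) | low b.1) (dx b.2 b.1)%:A *: (TS b.1 *: Xi ^+ b.2).
    move=> hx; rewrite (Gam_lincomb _ _ char0).
    under eq_bigr => k _ do rewrite hx mulmx_suml.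
    rewrite exchange_big /= [RHS](eq_bigl (fun b : {set 'I_n} * 'I_(2 * n) => low b.1 && predT b.2)).
      rewrite -(pair_big low predT (fun S k => (dx k S)%:A *: (TS S *: Xi ^+ k))) /=.
      apply: eq_bigr => T _; apply: eq_bigr => k _.
      by rewrite -scalemxAl mul_scalar_mx.
    by move=> b; rewrite /= andbT.
  have := congr1 (Gam F n) e; rewrite (h _ _ dE) (h _ _ dE') => /eqP; rewrite -subr_eq0 => /eqP e0.
  rewrite -[RHS]e0 -sumrB; apply: eq_bigr => b _.
  by rewrite scalerBl scalerBl.
apply: functional_extensionality => i; apply: (Gam_inj2 F n char0).
- exact/InA_InAT/hc.
- exact/InA_InAT/hc'.
by rewrite dE dE'; apply: eq_bigr => S lS; rewrite ed.
Qed.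

Lemma invSU_inv (S U : {set 'I_n}) : invSU n S U = ninv n S U.
Proof.
rewrite /invSU /ninv -sum1_card (eq_bigl _ _ (in_set _)).
rewrite (pair_big (mem S) (mem U) (fun a b : 'I_n => (b < a)%N : nat)) /=.
rewrite [RHS]big_mkcond [LHS]big_mkcond /=; apply: eq_bigr => p _.
by case: (p.1 \in S); case: (p.2 \in U); case: (p.2 < p.1)%N.
Qed.

Lemma sorted_enum (S : {set 'I_n}) : sorted (fun i j : 'I_n => (i < j)%N) (enum S).
Proof.
rewrite {1}/enum_mem; apply: sorted_filter; first by move=> a b c; apply: ltn_trans.
by have := iota_ltn_sorted 0 n; rewrite -val_enum_ord sorted_map enumT.
Qed.

Lemma TS_prod S : TS S = \prod_(h <- enum S) Tr (val h).
Proof. by rewrite /TS /Tw big_map. Qed.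

Lemma TS_dup (S U : {set 'I_n}) : ~~ [disjoint S & U] -> TS S * TS U = 0.
Proof.
move=> nd; rewrite -Tw_cat (Tw_dup F n char0) // -map_cat; apply: contra nd.
rewrite map_inj_uniq ?cat_uniq; last exact: val_inj.
case/and3P=> _ /hasPn h _; rewrite disjoint_sym -setI_eq0; apply/eqP/setP => x; rewrite !inE.
apply/negP => /andP[xU xS]; have := h x; rewrite !mem_enum => /(_ xU).
by rewrite xS.
Qed.

Lemma TS_mul (S U : {set 'I_n}) : [disjoint S & U] ->
  TS S * TS U = (-1) ^+ invSU n S U * TS (S :|: U).
Proof.
move=> dSU.
have p : perm_eq (enum S ++ enum U) (enum (S :|: U)).
  apply: uniq_perm; rewrite ?enum_uniq ?cat_uniq ?enum_uniq //=.
    rewrite andbT; apply/hasPn => x; rewrite !mem_enum => xU.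
    by rewrite (disjointFl dSU xU).
  by move=> x; rewrite mem_cat !mem_enum inE.
(* The same sign [b] serves for the traces and for the generators of an exterior algebra on [n]
   letters. In the latter the product is a nonzero basis element, so the sign can be read off there
   and equals that of [invSU]. *)
have [b eb] := anti_prod_perm _ _ _ p.
have eT := eb _ (fun h => Tr (val h)) (fun i j => Tr_anti F n _ _).
have eG := eb _ (gen F n) (gen_anti F n).
move: eT eG; rewrite !big_cat /= -!TS_prod => ->; rewrite !gen_prod_sorted ?sorted_enum //.
have sE (A : {set 'I_n}) : [set i in enum A] = A by apply/setP => i; rewrite inE mem_enum.
rewrite !sE ebasM // -invSU_inv => /(congr1 (fun x : ext F n => x (S :|: U))).
have sg (c : nat) (x : ext F n) A : ((-1) ^+ c * x) A = (-1) ^+ c * x A.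
  by rewrite -signr_odd mulr_sign -[in RHS]signr_odd mulr_sign; case: odd; rewrite ?ffunE.
rewrite !sg ffunE eqxx !mulr1 => e; congr (_ * _).
rewrite -signr_odd -[RHS]signr_odd; congr (_ ^+ _); move: e; rewrite -signr_odd -[RHS]signr_odd.
have n1 : (1 : F) <> -1.
  by move/(opp_eq0 _ char0)/eqP; rewrite oner_eq0.
by case: odd; case: odd => //=; rewrite ?expr0 ?expr1 // => /esym.
Qed.

Lemma degS_degw (S : {set 'I_n}) : degS n S = degw [seq val h | h <- enum S].
Proof. by rewrite /degS /degw big_map big_enum. Qed.

Lemma homs_TS S : homs F _ (D0 n) (degS n S) (TS S).
Proof. by rewrite degS_degw; apply: homs_Tw. Qed.

(** Every [T_h] has odd degree, so the sign rule of [coefbp], stated with cardinalities, agrees with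
    the one given by degrees. *)
Lemma odd_degS (S : {set 'I_n}) : odd (degS n S) = odd #|S|.
Proof.
rewrite /degS -sum1_card; apply: (big_ind2 (fun a b => odd a = odd b)) => // [a b c d|h _].
  by rewrite !oddD => -> ->.
by rewrite addn1 /= mul2n odd_double.
Qed.

Lemma TX_big S j : (n ^ 2 < degS n S + j)%N -> TS S *: Xi ^+ j = 0.
Proof.
move=> lt; apply/matrixP => p q; rewrite [RHS]mxE.
apply: (homs_gt _ _ _ _ _ (homM_scale F n _ _ _ _ (homs_TS S) (homM_X F n j) p q)).
by rewrite card_D0 mulnn.
Qed.

Definition monX (b : idxTA n) : 'M[Lam]_n := TS b.1 *: Xi ^+ b.2.
Definition psi (p : TA F n) : 'M[Lam]_n := \sum_b (p b)%:A *: monX b.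

Lemma Gam_Tmono S : Gam F n (Tmono F n S) = (TS S)%:M.
Proof.
rewrite /Tmono TS_prod; elim: (enum S) => [|h w IH] /=.
  by rewrite (Gam_one F n) // big_nil.
by rewrite GamM // Gam_Te // IH -scalar_mxM big_cons.
Qed.

Lemma Gam_phiTA p : Gam F n (phiTA F n p) = psi p.
Proof.
rewrite /phiTA (Gam_sum _ _ _ _ _ (fun b k v => p b *: wedge F n (Tmono F n b.1) (Xpow F n b.2) k v)).
apply: eq_bigr => b _.
rewrite (Gam_scale _ _ (p b) (wedge F n (Tmono F n b.1) (Xpow F n b.2))) GamM //.
by rewrite Gam_Tmono Gam_Xpow // mul_scalar_mx.
Qed.

Lemma phiTA_eq0 p : phiTA F n p = zeroE F n <-> psi p = 0.
Proof.
split=> [e|e].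
  by rewrite -Gam_phiTA e /Gam big1 // => k _; apply: Gk_eq0.
by apply: (Gam_inj F n char0); rewrite ?Gam_phiTA //; apply/InA_altE/InA_phiTA.
Qed.

(** The structure constants match: a power of [Xi] passes [TS a'.1] at the sign of the degrees,
    [TS_mul] sorts the traces, and the truncation above degree [n ^ 2] is matched by [TX_big]. *)
Lemma monX_mul a a' : monX a *m monX a' = \sum_b (coefbp F n a a' b)%:A *: monX b.
Proof.
have -> : monX a *m monX a' =
    (-1) ^+ (a.2 * #|a'.1|) *: ((TS a.1 * TS a'.1) *: Xi ^+ (a.2 + a'.2)).
  rewrite /monX -scalemxAl (mulmx_homl F n _ _ _ _ _ (homM_X F n a.2) (homs_TS a'.1)).
  rewrite -[Xi ^+ _ *m _]/(_ * _) -exprD !scalerA; congr (_ *: _).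
  rewrite -signr_odd oddM odd_degS -oddM signr_odd.
  by rewrite -mulrA mulr_signCA.
have [dis|ndis] := boolP [disjoint a.1 & a'.1]; last first.
  rewrite TS_dup // scale0r scaler0 big1 // => b _.
  by rewrite /coefbp (negPf ndis) scale0r scale0r.
rewrite TS_mul // -scalerA [LHS]scalerA -exprD.
have [le|gt] := leqP (degS n (a.1 :|: a'.1) + (a.2 + a'.2)) (n ^ 2); last first.
  rewrite TX_big // scaler0 big1 // => b _; rewrite /coefbp dis /=.
  case: eqP => //= [e1|_]; last by rewrite !scale0r.
  case: eqP => //= [e2|_]; last by rewrite !scale0r.
  by rewrite /degI e1 e2 leqNgt gt /= !scale0r.
have lt : (a.2 + a'.2 < (n ^ 2).+1)%N by rewrite ltnS (leq_trans _ le) // leq_addl.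
rewrite (bigD1 (a.1 :|: a'.1, Ordinal lt)) //= big1 ?addr0 => [|b nb].
  rewrite /coefbp dis /= !eqxx /degI /= le /monX /=.
  by congr (_ *: _); rewrite -signr_odd -[in RHS]signr_odd; case: odd;
    rewrite ?expr0 ?expr1 ?scaleN1r ?scale1r.
rewrite /coefbp; case: ifP; rewrite ?scale0r // => /and4P[_ /eqP e1 /eqP e2 _].
case/negP: nb; case: b e1 e2 => b1 b2 /= -> e2; apply/eqP; congr (_, _); exact: val_inj.
Qed.

Lemma psi_mul p q : psi (mulTA F n p q) = psi p *m psi q.
Proof.
rewrite /psi mulmx_suml; under [RHS]eq_bigr => a _ do rewrite mulmx_sumr.
transitivity (\sum_a \sum_a' \sum_b (p a * q a' * coefbp F n a a' b)%:A *: monX b).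
  under eq_bigr => b _ do rewrite ffunE scaler_suml scaler_suml.
  rewrite exchange_big; apply: eq_bigr => a _ /=.
  under eq_bigr => b _ do rewrite scaler_suml scaler_suml.
  by rewrite exchange_big.
apply: eq_bigr => a _; apply: eq_bigr => a' _.
rewrite mulmxZA -scalemxAl scalerA algM monX_mul scaler_sumr; apply: eq_bigr => b _.
by rewrite scalerA algM [q a' * p a]mulrC.
Qed.

Lemma psi_eTA S j : psi (eTA F n S j) = TS S *: Xi ^+ j.
Proof.
have [le|gt] := leqP (degS n S + j) (n ^ 2); last first.
  rewrite TX_big // /psi big1 // => b _.
  by rewrite ffunE [(_ <= _)%N]leqNgt gt andbF !scale0r.
have lt : (j < (n ^ 2).+1)%N by rewrite ltnS (leq_trans _ le) // leq_addl.
rewrite /psi (bigD1 (S, Ordinal lt)) //= big1 ?addr0 => [|[S' j'] nb].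
  by rewrite ffunE /= !eqxx le !scale1r.
rewrite ffunE /= le andbT; case: andP; rewrite ?scale0r // => -[/eqP e1 /eqP e2].
by case/negP: nb; rewrite e1; apply/eqP; congr (_, _); apply: val_inj.
Qed.

Lemma TS0 : TS set0 = 1. Proof. by rewrite TS_prod enum_set0 big_nil. Qed.
Lemma TS1 h : TS [set h] = Tr h. Proof. by rewrite TS_prod enum_set1 big_seq1. Qed.

Lemma psi_Xpow i : psi (XpowTA F n i) = Xi ^+ i.
Proof.
elim: i => [|i IH]; first by rewrite psi_eTA TS0 scale1r.
by rewrite /XpowTA iterS psi_mul -/(XpowTA F n i) IH psi_eTA TS0 scale1r expr1 exprS.
Qed.

Lemma psi_lin (I : Type) (r : seq I) (c : I -> F) (x : I -> TA F n) :
  psi [ffun b => \sum_(i <- r) c i * x i b] = \sum_(i <- r) (c i)%:A *: psi (x i).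
Proof.
rewrite /psi; under eq_bigr => b _ do rewrite ffunE scaler_suml scaler_suml.
rewrite exchange_big; apply: eq_bigr => i _ /=; rewrite scaler_sumr.
by apply: eq_bigr => b _; rewrite scalerA algM.
Qed.

(** [OTA] is first written as one linear combination over ['I_n.+1], with index [ord0] for the power
    of [X]. The even power [X^(2i)] then passes the trace without a sign, and reversing the
    summation gives the identity in [Xi_AL_O]. *)
Lemma psi_OTA : psi (OTA F n) = 0.
Proof.
have -> : OTA F n = [ffun b => \sum_(o < n.+1)
    vcons n%:R (fun _ : 'I_n => -1) o *
    vcons (XpowTA F n (2 * n - 1))
      (fun i : 'I_n => mulTA F n (XpowTA F n (2 * i)) (TTA F n (rev_ord i))) o b].
  apply/ffunP => b; rewrite !ffunE big_ord_recl !vcons0; congr (_ + _).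
  by rewrite -sumrN; apply: eq_bigr => i _; rewrite !vconsS mulN1r.
rewrite psi_lin big_ord_recl !vcons0 psi_Xpow.
have [_ o] := Xi_AL_O F n char0.
rewrite !scaler_nat o; apply/eqP; rewrite addr_eq0; apply/eqP.
rewrite (reindex_inj rev_ord_inj) -sumrN; apply: eq_bigr => i _ /=.
rewrite !vconsS psi_mul psi_Xpow psi_eTA TS1 expr0 scaleN1r scaleN1r opprK.
rewrite (mulmx_homl F n _ _ _ _ 1 (homM_X F n (2 * i)) (homs_Tr F n _)) mulmx1.
have -> : (n - (n - i.+1).+1 = i)%N by have := ltn_ord i; lia.
by rewrite -signr_odd -mulnA oddM /= scale1r.
Qed.

Lemma psi_ideal p : InIdeal F n p -> psi p = 0.
Proof.
case=> s ->.
have -> : [ffun b => \sum_(t <- s) mulTA F n (mulTA F n t.1.1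
      (if t.1.2 then XpowTA F n (2 * n) else OTA F n)) t.2 b] =
    [ffun b => \sum_(t <- s) 1 * mulTA F n (mulTA F n t.1.1
      (if t.1.2 then XpowTA F n (2 * n) else OTA F n)) t.2 b] :> TA F n.
  by apply/ffunP => b; rewrite !ffunE; apply: eq_bigr => t _; rewrite mul1r.
rewrite psi_lin big1 // => t _; rewrite !psi_mul.
have -> : psi (if t.1.2 then XpowTA F n (2 * n) else OTA F n) = 0.
  by case: ifP => _; rewrite ?psi_OTA // psi_Xpow Xi_big.
by rewrite mulmx0 mul0mx scaler0.
Qed.

(** * Linear combinations in the formal algebra and reduction modulo the ideal *)

Definition lc (I : finType) (c : I -> F) (x : I -> TA F n) : TA F n :=
  [ffun b => \sum_i c i * x i b].

Lemma lcE I c x b : lc I c x b = \sum_i c i * x i b.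
Proof. by rewrite ffunE. Qed.

Lemma lc_unit c x b : lc unit (fun=> c) (fun=> x) b = c * x b.
Proof. by rewrite lcE (big_pred1 tt) // => -[]. Qed.

Lemma mulTA_lcl I c x q : mulTA F n (lc I c x) q = lc I c (fun i => mulTA F n (x i) q).
Proof.
apply/ffunP => b; rewrite !ffunE.
under eq_bigr => a _ do under eq_bigr => a' _ do rewrite ffunE !mulr_suml.
under eq_bigr => a _ do rewrite exchange_big /=.
rewrite exchange_big; apply: eq_bigr => i _ /=; rewrite ffunE mulr_sumr.
by apply: eq_bigr => a _; rewrite mulr_sumr; apply: eq_bigr => a' _; rewrite !mulrA.
Qed.

Lemma mulTA_lcr I c x q : mulTA F n q (lc I c x) = lc I c (fun i => mulTA F n q (x i)).
Proof.
apply/ffunP => b; rewrite !ffunE.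
under eq_bigr => a _ do under eq_bigr => a' _ do rewrite ffunE mulr_sumr mulr_suml.
under eq_bigr => a _ do rewrite exchange_big /=.
rewrite exchange_big; apply: eq_bigr => i _ /=; rewrite ffunE mulr_sumr.
apply: eq_bigr => a _; rewrite mulr_sumr; apply: eq_bigr => a' _.
by rewrite !mulrA [c i * q a]mulrC.
Qed.

Lemma degSU (S U : {set 'I_n}) : [disjoint S & U] ->
  degS n (S :|: U) = (degS n S + degS n U)%N.
Proof. by move=> d; rewrite /degS -bigU //=; apply: eq_bigl => h; rewrite inE. Qed.

Lemma eTA_mul S i U j : mulTA F n (eTA F n S i) (eTA F n U j) =
  [ffun b => [disjoint S & U]%:R * (-1) ^+ (i * #|U| + invSU n S U) * eTA F n (S :|: U) (i + j) b].
Proof.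
apply/ffunP => b; rewrite !ffunE.
(* If a factor is already truncated to zero, the product exceeds degree [n ^ 2] as well, so the
   right side vanishes too. *)
have z : (n ^ 2 < degS n S + i)%N || (n ^ 2 < degS n U + j)%N ->
    [disjoint S & U]%:R * (-1) ^+ (i * #|U| + invSU n S U) *
    ((b.1 == S :|: U) && (b.2 == (i + j)%N :> nat) && (degS n (S :|: U) + (i + j) <= n ^ 2)%N)%:R
    = 0 :> F.
  move=> h; have [d|_] := boolP [disjoint S & U]; last by rewrite !mul0r.
  by rewrite degSU // [(_ + _ <= _)%N]leqNgt (_ : (_ < _)%N) ?andbF ?mulr0 //; case/orP: h => h; lia.
have [le1|gt1] := leqP (degS n S + i) (n ^ 2); last first.
  rewrite z ?gt1 // big1 // => a _; rewrite big1 // => a' _.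
  by rewrite ffunE [(_ <= _)%N]leqNgt gt1 andbF !mul0r.
have [le2|gt2] := leqP (degS n U + j) (n ^ 2); last first.
  rewrite z ?gt2 ?orbT // big1 // => a _; rewrite big1 // => a' _.
  by rewrite [eTA F n U j a']ffunE [(_ <= _)%N]leqNgt gt2 andbF mulr0 mul0r.
have lt1 : (i < (n ^ 2).+1)%N by rewrite ltnS (leq_trans _ le1) // leq_addl.
have lt2 : (j < (n ^ 2).+1)%N by rewrite ltnS (leq_trans _ le2) // leq_addl.
have e0 (V : {set 'I_n}) k (lt : (k < (n ^ 2).+1)%N) a : a != (V, Ordinal lt) -> eTA F n V k a = 0.
  move=> na; rewrite ffunE; case: eqP => //= e1; case: eqP => //= e2.
  by case/negP: na; case: a e1 e2 => a1 a2 /= -> e2; apply/eqP; congr (_, _); apply: val_inj.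
rewrite (bigD1 (S, Ordinal lt1)) //= [X in _ + X]big1 ?addr0 => [|a na]; last first.
  by rewrite big1 // => a' _; rewrite (e0 S i lt1) // !mul0r.
rewrite (bigD1 (U, Ordinal lt2)) //= [X in _ + X]big1 ?addr0 => [|a' na]; last first.
  by rewrite (e0 U j lt2) // mulr0 mul0r.
rewrite !ffunE /= !eqxx le1 le2 /= !mul1r /coefbp /=.
have [d|_] := boolP [disjoint S & U]; last by rewrite !mul0r.
rewrite mul1r /degI /=; case: eqP => /= [e1|_]; last by rewrite mulr0.
case: eqP => /= [e2|_]; last by rewrite mulr0.
by rewrite e1 e2; case: ifP => _; rewrite ?mulr1 ?mulr0.
Qed.

Lemma invSU_0 (S : {set 'I_n}) : invSU n S set0 = 0%N.
Proof. by rewrite invSU_inv invs0. Qed.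

Lemma eTA_mul0 S i j : mulTA F n (eTA F n S i) (eTA F n set0 j) = eTA F n S (i + j).
Proof.
rewrite eTA_mul; apply/ffunP => b; rewrite ffunE cards0 muln0 invSU_0 setU0.
by rewrite -setI_eq0 setI0 eqxx !mul1r.
Qed.

Lemma XpowTA_eTA i : XpowTA F n i = eTA F n set0 i.
Proof.
elim: i => [|i IH] //; rewrite /XpowTA iterS -/(XpowTA F n i) IH /XTA eTA_mul0.
by rewrite add1n.
Qed.

Lemma OTA_lc : OTA F n = lc _ (vcons n%:R (fun _ : 'I_n => -1))
  (vcons (eTA F n set0 (2 * n - 1)) (fun i : 'I_n => eTA F n [set rev_ord i] (2 * i))).
Proof.
apply/ffunP => b; rewrite !ffunE big_ord_recl !vcons0 XpowTA_eTA; congr (_ * _ + _).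
rewrite -sumrN; apply: eq_bigr => i _; rewrite !vconsS mulN1r XpowTA_eTA /TTA eTA_mul.
rewrite ffunE set0U addn0 cards1 muln1 invSU_inv inv0s addn0 -signr_odd oddM /=.
by rewrite -setI_eq0 set0I eqxx !mul1r.
Qed.

Lemma InIdeal_lc I c x : (forall i, InIdeal F n (x i)) -> InIdeal F n (lc I c x).
Proof.
move=> h; rewrite /lc; elim: (index_enum I) => [|i r [s es]].
  by exists [::]; apply/ffunP => b; rewrite !ffunE !big_nil.
have [t et] := h i.
exists ([seq (lc unit (fun=> c i) (fun=> u.1.1), u.1.2, u.2) | u <- t] ++ s).
apply/ffunP => b; rewrite !ffunE big_cons big_cat big_map /=; congr (_ + _); last first.
  by have /ffunP/(_ b) := es; rewrite !ffunE.
rewrite et ffunE mulr_sumr; apply: eq_bigr => u _.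
by rewrite !mulTA_lcl lc_unit.
Qed.

Lemma InIdeal0 : InIdeal F n [ffun _ => 0].
Proof. by exists [::]; apply/ffunP => b; rewrite !ffunE big_nil. Qed.

Definition reduced (p : TA F n) : Prop :=
  forall b : idxTA n, ~~ (low b.1 && (b.2 < 2 * n)%N) -> p b = 0.

Definition reducible (p : TA F n) : Prop :=
  exists q, reduced q /\ InIdeal F n [ffun b => p b - q b].

Lemma reducible_lc I c x : (forall i, reducible (x i)) -> reducible (lc I c x).
Proof.
move=> /fin_all_exists[q hq]; exists (lc I c q); split=> [b nb|].
  by rewrite ffunE big1 // => i _; rewrite (proj1 (hq i)) // mulr0.
have := InIdeal_lc I c _ (fun i => proj2 (hq i)).
congr (InIdeal F n _); apply/ffunP => b; rewrite !ffunE -sumrB.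
by apply: eq_bigr => i _; rewrite ffunE mulrBr.
Qed.

Lemma reducible_ideal p : InIdeal F n p -> reducible p.
Proof.
move=> hp; exists [ffun _ => 0]; split=> [b _|]; first by rewrite ffunE.
by have -> : [ffun b => p b - [ffun=> 0] b] = p by apply/ffunP => b; rewrite !ffunE subr0.
Qed.

(** Either the monomial is already reduced, or [X^(2n)] can be factored out of it. *)
Lemma reducible_low S j : low S -> reducible (eTA F n S j).
Proof.
move=> lS; have [lt|ge] := ltnP j (2 * n).
  exists (eTA F n S j); split=> [b|].
    rewrite ffunE; case: eqP => //= ->; case: eqP => //= ->; by rewrite lS lt.
  by have -> : [ffun b => eTA F n S j b - eTA F n S j b] = [ffun _ => 0];
    [apply/ffunP => b; rewrite !ffunE subrr | exact: InIdeal0].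
apply: reducible_ideal; exists [:: (eTA F n S 0, true, eTA F n set0 (j - 2 * n))].
apply/ffunP => b; rewrite [RHS]ffunE big_seq1 /= XpowTA_eTA !eTA_mul0.
by rewrite add0n subnKC.
Qed.

(** If [S] contains [n-1], put [S' = S :\ la] and consider [T_S' O_n X^j] in the ideal. Its summand
    [i = 0] is exactly [- T_S X^j], no sign arising because [n-1] is the largest index; all other
    summands avoid [T_(n-1)]. *)
Lemma reducible_eTA S j : reducible (eTA F n S j).
Proof.
have [lS|nlS] := boolP (low S); first exact: reducible_low.
pose la : 'I_n := rev_ord (Ordinal n_gt0).
have laE : la = n.-1 :> nat by rewrite /= subn1.
have lS : la \in S.
  move: nlS; rewrite negb_forall => /existsP[h]; rewrite negb_imply => /andP[hS].
  rewrite -leqNgt => hn; suff -> : la = h by [].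
  by apply: ord_inj; rewrite laE; have := ltn_ord h; lia.
pose S' := S :\ la.
have lS' : low S'.
  apply/forallP => h; apply/implyP; rewrite !inE -(inj_eq (@ord_inj n)) laE => /andP[h1 _].
  by have := ltn_ord h; lia.
pose c := vcons n%:R (fun _ : 'I_n => -1) : 'I_n.+1 -> F.
pose g := vcons (eTA F n set0 (2 * n - 1)) (fun i : 'I_n => eTA F n [set rev_ord i] (2 * i)).
pose X := mulTA F n (mulTA F n (eTA F n S' 0) (OTA F n)) (eTA F n set0 j).
pose y o := mulTA F n (mulTA F n (eTA F n S' 0) (g o)) (eTA F n set0 j).
have XE : X = lc _ c y by rewrite /X OTA_lc mulTA_lcr mulTA_lcl.
have hX : InIdeal F n X.
  exists [:: (eTA F n S' 0, false, eTA F n set0 j)].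
  by apply/ffunP => b; rewrite [RHS]ffunE big_seq1.
(* The position in [OTA_lc] of the summand [i = 0], the one containing [T_(n-1)]. *)
pose o0 : 'I_n.+1 := lift ord0 (Ordinal n_gt0).
have yS (i : 'I_n) : y (lift ord0 i) =
    lc unit (fun=> [disjoint S' & [set rev_ord i]]%:R * (-1) ^+ invSU n S' [set rev_ord i])
       (fun=> eTA F n (S' :|: [set rev_ord i]) (2 * i + j)).
  rewrite /y /g vconsS eTA_mul mul0n !add0n.
  have -> (d : F) (x : TA F n) : [ffun b => d * x b] = lc unit (fun=> d) (fun=> x) :> TA F n.
    by apply/ffunP => b; rewrite lc_unit ffunE.
  by rewrite mulTA_lcl; congr (lc _ _ _); apply: functional_extensionality => _; rewrite eTA_mul0.
have yo0 : y o0 = eTA F n S j.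
  rewrite yS -/la /=; apply/ffunP => b; rewrite lc_unit.
  have -> : S' :|: [set la] = S by rewrite /S' setUC setD1K.
  have -> : invSU n S' [set la] = 0%N.
    rewrite invSU_inv /ninv big1 // => h hS; rewrite big_set1.
    by rewrite ltnNge laE -ltnS prednK // ltn_ord.
  rewrite muln0 add0n -setI_eq0; have -> : S' :&: [set la] = set0.
    by apply/setP => h; rewrite !inE; case: (h == la); rewrite ?andbF.
  by rewrite eqxx !mul1r.
have cE o : o != o0 -> reducible (y o).
  case: (unliftP ord0 o) => [i ->|-> _].
    rewrite (inj_eq lift_inj) yS => ni; apply: reducible_lc => _; apply: reducible_low.
    apply/forallP => h; apply/implyP; rewrite in_setU in_set1 => /orP[hS|/eqP->].
      exact: (implyP (forallP lS' h)).
    have i0 : (0 < i)%N.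
      by apply: contraNT ni; rewrite -leqNgt leqn0 => /eqP i0; apply/eqP/val_inj.
    by rewrite /=; move: (nat_of_ord i) (ltn_ord i) i0 => k /=; lia.
  rewrite /y /g vcons0 !eTA_mul0; exact: reducible_low.
(* Solving for the summand at [o0] writes [T_S X^j] as [- X] plus the remaining summands, all of
   them reducible. *)
pose z o := if o == o0 then X else y o.
have zo0 : z o0 = X by rewrite /z eqxx.
have zE o : o != o0 -> z o = y o by move=> /negPf no; rewrite /z no.
have co0 : c o0 = -1 by rewrite /c /o0 vconsS.
have Xb b : X b = - eTA F n S j b + \sum_(o | o != o0) c o * y o b.
  by rewrite XE lcE (bigD1 o0) //= yo0 co0 mulN1r.
have -> : eTA F n S j = lc _ (fun o => if o == o0 then -1 else c o) z.
  apply/ffunP => b; rewrite lcE (bigD1 o0) //.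
  transitivity (-1 * X b + \sum_(o | o != o0) c o * y o b).
    by rewrite Xb mulN1r opprD opprK subrK.
  apply: (congr2 +%R); first by rewrite zo0 eqxx.
  by apply: eq_big => // o no; rewrite zE // (negPf no).
apply: reducible_lc => o; rewrite /z; case: eqP => [_|/eqP]; first exact: reducible_ideal.
exact: cE.
Qed.

Lemma reduced_psi p : reduced p -> psi p = 0 -> forall b, p b = 0.
Proof.
(* This is [(n-1)^2 >= 0]; it ensures that all exponents below [2n] occur in the index type of
   [TA]. *)
move=> rp p0; have le : (2 * n <= (n ^ 2).+1)%N by case: n n_gt0 => [//|[//|m]] _; nia.
have [b0|nb] := boolP [forall b, p b == 0]; first by move=> b; apply/eqP/(forallP b0).
pose d (b : {set 'I_n} * 'I_(2 * n)) := p (b.1, widen_ord le b.2).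
have dz : forall b, low b.1 -> d b = 0.
  apply: (TX_free F n char0 n_gt0); rewrite -[RHS]p0 /psi.
  rewrite (eq_bigl (fun b : {set 'I_n} * 'I_(2 * n) => low b.1 && predT b.2)); last first.
    by move=> b; rewrite /= andbT.
  rewrite -(pair_big low predT (fun S k => (d (S, k))%:A *: (TS S *: Xi ^+ k))) /=.
  rewrite [RHS](eq_bigr (fun b : idxTA n => (p (b.1, b.2))%:A *: monX (b.1, b.2))); last by case.
  rewrite -(pair_bigA _ (fun S k => (p (S, k))%:A *: monX (S, k))) /=.
  rewrite big_mkcond; apply: eq_bigr => S _.
  case: ifP => lS; last first.
    by rewrite big1 // => k _; rewrite rp ?scale0r ?scale0r //= lS.
  rewrite [RHS](bigID (fun k : 'I_(n ^ 2).+1 => (k < 2 * n)%N)) /= [X in _ + X]big1 ?addr0 => [|k nk].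
    rewrite [RHS](eq_bigr (fun k : 'I_(n ^ 2).+1 => (p (S, inord k))%:A *: (TS S *: Xi ^+ k))).
      rewrite -(big_ord_widen _ (fun k => (p (S, inord k))%:A *: (TS S *: Xi ^+ k)) le).
      apply: eq_bigr => k _; rewrite /d /=; congr ((p (_, _))%:A *: _).
      by apply: val_inj; rewrite /= inordK // (leq_trans (ltn_ord k)).
    by move=> k _; rewrite inord_val.
  by rewrite rp ?scale0r ?scale0r //= lS.
move=> b; have [/andP[lb lj]|/rp//] := boolP (low b.1 && (b.2 < 2 * n)%N).
have := dz (b.1, Ordinal lj) lb; rewrite /d /= => <-; congr (p _).
by case: b {lb} lj => b1 b2 lj; congr (_, _); apply: val_inj.
Qed.

(** Modulo the ideal, [p] equals a reduced [q]. The ideal maps to zero, so [psi q = 0] and hence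
    [q = 0] by independence. [TA_wf] makes [p] the combination of the truncated monomials [eTA]. *)
Lemma kernel_ideal p : TA_wf F n p -> psi p = 0 -> InIdeal F n p.
Proof.
move=> wp p0.
have pE : p = lc _ (fun b => p b) (fun b => eTA F n b.1 b.2).
  apply/ffunP => b; rewrite ffunE (bigD1 b) //= big1 ?addr0 => [|a na].
    rewrite ffunE !eqxx /=; case: leqP => [_|/wp->]; by rewrite ?mulr1 ?mul0r.
  rewrite ffunE; case: eqP => //= [e1|_]; last by rewrite mulr0.
  case: eqP => //= [e2|_]; last by rewrite mulr0.
  by case/negP: na; case: a b e1 e2 => a1 a2 [b1 b2] /= -> /val_inj ->.
have [q [rq iq]] : reducible p by rewrite pE; apply: reducible_lc => b; apply: reducible_eTA.
have q0 : psi q = 0.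
  have := psi_ideal _ iq.
  have -> : [ffun b => p b - q b] = [ffun b => \sum_(i <- [:: true; false])
      (if i then 1 else -1) * (if i then p else q) b] :> TA F n.
    by apply/ffunP => b; rewrite !ffunE !big_cons big_nil addr0 mul1r mulN1r.
  rewrite psi_lin !big_cons big_nil addr0 p0 scaler0 add0r scaleN1r scaleN1r => /eqP.
  by rewrite oppr_eq0 => /eqP.
have qz := reduced_psi q rq q0.
suff <- : [ffun b => p b - q b] = p by [].
by apply/ffunP => b; rewrite ffunE qz subr0.
Qed.

End Freeness.

Theorem mainTheorem8 (F : fieldType) (n : nat) :
  [pchar F] =i pred0 -> (0 < n)%N ->
  (* A_n is a free left AT_{n-1}-module with basis 1, X, ..., X^{2n-1} *)
  ((forall c : 'I_(2 * n) -> E F n, (forall i, InAT F n (c i)) -> InA F n (lincomb F n c)) /\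
   (forall x : E F n, InA F n x ->
      exists c : 'I_(2 * n) -> E F n, (forall i, InAT F n (c i)) /\ x = lincomb F n c) /\
   (forall c c' : 'I_(2 * n) -> E F n, (forall i, InAT F n (c i)) -> (forall i, InAT F n (c' i)) ->
      lincomb F n c = lincomb F n c' -> c = c')) /\
  (* kernel of TA_n -> A_n is the ideal generated by X^{2n} and O_n *)
  (forall p : TA F n, TA_wf F n p -> (phiTA F n p = zeroE F n <-> InIdeal F n p)).
Proof.
move=> char0 n_gt0; split; [split; [|split]|].
- exact: InA_lincomb.
- exact: span_exists.
- exact: AT_free.
move=> p wp; split=> [e|i].
  by apply: kernel_ideal => //; apply/(phiTA_eq0 F n char0).
by apply/(phiTA_eq0 F n char0); apply: psi_ideal.
Qed.
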